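(* Let $\tau\in(2,3)$ and consider the weighted configuration models $\mathrm{CM}_n(\boldsymbol d,\boldsymbol L)$, $n\ge 1$, whose degree sequences satisfy the following two conditions. Power-law tail behaviour: there exist $\gamma\in(0,1)$, $C>0$ and $\alpha>1/2$ (not depending on $n$) such that for all $x\in[1,n^{\alpha})$, $$\frac{1}{x^{\tau-1}}\mathrm e^{-C(\log x)^{\gamma}}\le 1-F_n(x)\le \frac{1}{x^{\tau-1}}\mathrm e^{C(\log x)^{\gamma}} ,$$ and $\min_{v\in[n]}d_v\ge 2$. Limiting distributions: there exist distribution functions $F_D,F_B$ (not depending on $n$) such that for some $\kappa>0$, $\max\{d_{TV}(F_n,F_D),d_{TV}(F_{B_n},F_B)\}\le n^{-\kappa}$. Suppose that the edge-lengths are i.i.d. copies of a non-negative random variable $L$ with distribution function $F_L$. Let $u$ and $v$ be two uniformly chosen vertices from $[n]$. Suppose that $$\sum_{k=1}^{\infty}F_L^{(-1)}\big(\mathrm e^{-\mathrm e^{k}}\big)=\infty .$$ Write $$a_n:=\sum_{i=1}^{\left\lfloor \frac{\log\log n}{|\log(\tau-2)|}\right\rfloor}F_L^{(-1)}\Big(\mathrm e^{-\left(\frac{1}{\tau-2}\right)^{i}}\Big).$$ Then: (i) $\dfrac{d_L(u,v)}{2a_n}\to 1$ in probability as $n\to\infty$. (ii) For all $\varepsilon>0$, $$\lim_{n\to\infty}\mathbb P\Big(d_H(u,v)\Big/\Big(\tfrac{2\log\log n}{|\log(\tau-2)|}\Big)\ \ge\ 1-\varepsilon\Big)=1 .$$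 (iii) For all $\varepsilon>0$, with probability tending to $1$ as $n\to\infty$, there exists at least one path between $u$ and $v$ whose total length (sum of its edge-lengths) is at most $(1+\varepsilon)\,2a_n$ and whose number of edges is at most $(1+\varepsilon)\frac{2\log\log n}{|\log(\tau-2)|}$.
   Context: **Configuration model.** For each $n$ let $[n]=\{1,\dots,n\}$ and let $\boldsymbol d=(d_1,\dots,d_n)$ be a (deterministic, $n$-dependent) degree sequence of positive integers; $\mathcal H_n:=\sum_{v\in[n]}d_v$ (if $\mathcal H_n$ is odd, one half-edge is added to vertex $n$). Attach $d_v$ half-edges to each $v\in[n]$ and take a uniformly random perfect matching of all half-edges; each pair of matched half-edges forms an edge. The resulting random multigraph is $\mathrm{CM}_n(\boldsymbol d)$. Assigning to each edge $e$ an i.i.d. edge-length $L_e$ distributed as $L$ (independent of the graph) gives $\mathrm{CM}_n(\boldsymbol d,\boldsymbol L)$. Let $F_n(x):=\frac1n\sum_{v\in[n]}\mathbf 1_{\{d_v\le x\}}$, let $D_n$ have distribution function $F_n$, and let $B_n$ have law $\mathbb P(B_n=k)=\frac{k+1}{\mathbb E[D_n]}\mathbb P(D_n=k+1)$, with distribution function $F_{B_n}$. **Total variation distance.** $d_{TV}(F,G):=\frac12\sum_{x\in\mathbb N}|F(x+1)-F(x)-(G(x+1)-G(x))|$. **Distances.** $d_L(u,v):=\min_{\pi:u\to v}\sum_{e\in\pi}L_e$, the minimum being over all paths $\pi$ connecting $u$ to $v$; $d_L(u,v)=0$ if $u=v$ and $d_L(u,v)=\infty$ if $u,v$ are not connected.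 The hopcount $d_H(u,v)$ is the number of edges on the optimal path realising $d_L(u,v)$. **Generalised inverse.** $F_L^{(-1)}(x):=\inf\{y\in\mathbb R:F_L(y)\ge x\}$. $F_L$ need not be continuous. *)

(* Defs.v *)
From HB Require Import structures.
From mathcomp Require Export all_boot all_order all_algebra.
From mathcomp Require Export all_classical all_reals all_analysis.

Set Implicit Arguments.
Unset Strict Implicit.
Unset Printing Implicit Defensive.
Import Order.TTheory GRing.Theory Num.Theory.
Import numFieldNormedType.Exports.

Local Open Scope classical_set_scope.
Local Open Scope ring_scope.

(* Vertex sets are 'I_m.+1, i.e. the graph has n = m.+1 >= 1 vertices and
   vertex "n" is ord_max. *)

Section Degrees.
Context {R : realType} {m : nat} (d : 'I_m.+1 -> nat).

Definition emp_cdf (x : R) : R :=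
  #|[set v | (d v)%:R <= x]%SET|%:R / m.+1%:R.

Definition max_degree : nat := (\max_(v < m.+1) d v)%N.

Definition deg_pmf (k : nat) : R := #|[set v | d v == k]%SET|%:R / m.+1%:R.

Definition mean_degree : R := \sum_(k < max_degree.+1) k%:R * deg_pmf k.

Definition biased_pmf (k : nat) : R :=
  k.+1%:R / mean_degree * deg_pmf k.+1.

(* biased_pmf k = 0 as soon as k >= max_degree, so the sum is complete. *)
Definition biased_cdf (x : R) : R :=
  \sum_(k < max_degree | k%:R <= x) biased_pmf k.

(* One half-edge is added to the last vertex when the degree sum is odd. *)
Definition cm_degree (v : 'I_m.+1) : nat :=
  (d v + ((v == ord_max) && odd (\sum_(w < m.+1) d w)))%N.

Definition half_edge : finType := {v : 'I_m.+1 & 'I_(cm_degree v)}.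

Definition owner (h : half_edge) : 'I_m.+1 := tag h.

(* A perfect matching, encoded by the fixed-point-free involution sending each
   half-edge to its partner. *)
Definition perfect_matchings : {set {ffun half_edge -> half_edge}} :=
  [set M : {ffun half_edge -> half_edge}
     | [forall h, (M h != h) && (M (M h) == h)]]%SET.

Definition edge_of (M : {ffun half_edge -> half_edge}) (h : half_edge) :
  {set half_edge} := [set h; M h]%SET.

Definition edges (M : {ffun half_edge -> half_edge}) : {set {set half_edge}} :=
  [set edge_of M h | h in [set: half_edge]]%SET.

(* A path is given by the half-edges through which it leaves its successive
   vertices; this keeps parallel edges apart. *)
Fixpoint is_walk (M : {ffun half_edge -> half_edge}) (a b : 'I_m.+1)
    (p : seq half_edge) : bool :=
  if p is h :: q then (owner h == a) && is_walk M (owner (M h)) b q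
  else a == b.

Definition is_path (M : {ffun half_edge -> half_edge}) (a b : 'I_m.+1)
    (p : seq half_edge) : bool :=
  is_walk M a b p && uniq (a :: [seq owner (M h) | h <- p]).

Definition path_length (M : {ffun half_edge -> half_edge})
    (len : {set half_edge} -> R) (p : seq half_edge) : R :=
  \sum_(h <- p) len (edge_of M h).

(* There are finitely many paths, so the infimum is a minimum, with value +oo
   when a and b are not connected; the empty path gives 0 when a = b. *)
Definition dist_L (M : {ffun half_edge -> half_edge})
    (len : {set half_edge} -> R) (a b : 'I_m.+1) : \bar R :=
  ereal_inf [set (path_length M len p)%:E | p in [set p | is_path M a b p]].

(* If several paths are optimal, the one with fewest edges is used. *)
Definition dist_H (M : {ffun half_edge -> half_edge})
    (len : {set half_edge} -> R) (a b : 'I_m.+1) : \bar R :=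
  ereal_inf [set (size p)%:R%:E | p in
    [set p | is_path M a b p /\ (path_length M len p)%:E = dist_L M len a b]].

End Degrees.

Local Open Scope ereal_scope.

(* The weighted configuration model together with two vertices, on an arbitrary
   probability space.  In wcm_law, the matching and the two vertices are uniform
   and, given them, the lengths of the edges of the graph are i.i.d. copies of
   X; len e is irrelevant when e is not an edge of the graph. *)
Record weighted_cm (R : realType) (m : nat) (d : 'I_m.+1 -> nat)
    (dO : measure_display) (Omega : measurableType dO) (Q : probability Omega R)
    (X : {RV Q >-> R}) := WeightedCM {
  wcm_disp : measure_display ;
  wcm_space : measurableType wcm_disp ;
  wcm_prob : probability wcm_space R ;
  wcm_matching : wcm_space -> {ffun half_edge d -> half_edge d} ;
  wcm_len : {set half_edge d} -> {RV wcm_prob >-> R} ;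
  wcm_u : wcm_space -> 'I_m.+1 ;
  wcm_v : wcm_space -> 'I_m.+1 ;
  wcm_measurable_matching :
    forall M, measurable [set w | wcm_matching w = M] ;
  wcm_measurable_u : forall a, measurable [set w | wcm_u w = a] ;
  wcm_measurable_v : forall b, measurable [set w | wcm_v w = b] ;
  wcm_law : forall M a b (A : {set half_edge d} -> set R),
    M \in perfect_matchings d ->
    (forall e, measurable (A e)) ->
    wcm_prob [set w | [/\ wcm_matching w = M, wcm_u w = a, wcm_v w = b &
                          forall e, e \in edges M -> A e (wcm_len e w)]]
    = (#|perfect_matchings d|%:R^-1)%:E * (m.+1%:R^-1)%:E * (m.+1%:R^-1)%:E
      * \prod_(e in edges M) distribution Q X (A e)
}.

Section RandomDistances.
Context {R : realType} {m : nat} {d : 'I_m.+1 -> nat} {dO : measure_display}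
  {Omega : measurableType dO} {Q : probability Omega R} {X : {RV Q >-> R}}
  (G : weighted_cm d X).

Definition wcm_len_at (w : wcm_space G) (e : {set half_edge d}) : R :=
  wcm_len G e w.

Definition wcm_dist_L (w : wcm_space G) : \bar R :=
  dist_L (wcm_matching w) (wcm_len_at w) (wcm_u w) (wcm_v w).

Definition wcm_dist_H (w : wcm_space G) : \bar R :=
  dist_H (wcm_matching w) (wcm_len_at w) (wcm_u w) (wcm_v w).

Definition wcm_is_path (w : wcm_space G) (p : seq (half_edge d)) : bool :=
  is_path (wcm_matching w) (wcm_u w) (wcm_v w) p.

Definition wcm_path_length (w : wcm_space G) (p : seq (half_edge d)) : R :=
  path_length (wcm_matching w) (wcm_len_at w) p.

End RandomDistances.

Section Conditions.
Context {R : realType}.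

(* The sum starts at x = 0, so it sees the masses of all positive integers. *)
Definition dTV (F G : R -> R) : \bar R :=
  (2^-1)%:E * \sum_(0 <= x <oo)
    (`|F x.+1%:R - F x%:R - (G x.+1%:R - G x%:R)|%R)%:E.

Definition power_law_tail (tau : R) (d : forall m, 'I_m.+1 -> nat) : Prop :=
  exists gamma C alpha : R,
    [/\ (0 < gamma < 1)%R, (0 < C)%R, (2^-1 < alpha)%R &
     forall (m : nat) (x : R), (1 <= x < m.+1%:R `^ alpha)%R ->
       ((x `^ (tau - 1))^-1 * expR (- (C * ln x `^ gamma))
          <= 1 - emp_cdf (d m) x
          <= (x `^ (tau - 1))^-1 * expR (C * ln x `^ gamma))%R].

Definition limiting_distributions (d : forall m, 'I_m.+1 -> nat) : Prop :=
  exists FD FB : cumulativeBounded (0 : R) (1 : R),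
  exists2 kappa : R, (0 < kappa)%R &
    forall m : nat,
      maxe (dTV (emp_cdf (d m)) FD) (dTV (biased_cdf (d m)) FB)
        <= (m.+1%:R `^ (- kappa))%:E.

Definition generalised_inverse (F : R -> \bar R) (x : R) : R :=
  inf [set y | x%:E <= F y].

Local Open Scope ring_scope.

(* Num.truncn agrees with the floor on nonnegative reals and is 0 on negative
   ones, where the sum up to the floor is empty as well. *)
Definition typical_dist (tau : R) (F : R -> \bar R) (n : nat) : R :=
  \sum_(1 <= i < (Num.truncn (ln (ln n%:R) / `|ln (tau - 2)|)).+1)
    generalised_inverse F (expR (- (tau - 2)^-1 ^+ i)).

Definition typical_hops (tau : R) (n : nat) : R :=
  2 * ln (ln n%:R) / `|ln (tau - 2)|.

End Conditions.

(* Main.v *)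
Require Import Defs.
From mathcomp Require Import perm measurable_realfun ring lra zify.

Set Implicit Arguments.
Unset Strict Implicit.
Unset Printing Implicit Defensive.
Import Order.TTheory GRing.Theory Num.Theory.
Import numFieldNormedType.Exports.

Local Open Scope classical_set_scope.
Local Open Scope ring_scope.

(** The degrees seen from a typical vertex grow doubly exponentially. Write
    q = 1 / (tau - 2). A uniform half-edge belongs to a vertex of degree larger
    than z with probability about z^-(tau - 2), so that a vertex of degree y has
    neighbours of degree up to about y^q, and no more. Hence vertices of degree
    exp(q^i) are about i steps away, and degrees of order a power of n are
    reached after loglog n / |log (tau - 2)| steps. A vertex of degree y has
    about y edges to choose from, whose shortest length is about the quantile of
    L at the level 1 / y: crossing the i-th layer costs the quantile at
    exp(- q^i), and a_n is the total cost on one side. Since a_n tends to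
    infinity, the scales may be changed by bounded factors, and q by a factor
    close to 1.

    Lower bound. Let x be slightly larger than q, b_i = exp (A x^i), and ell_i
    the quantile at exp (- 2 A x^i). Counting walks shows that, if A is large,
    walks from a uniform vertex rarely leave the profile b, or meet an edge
    shorter than ell_i at the i-th step within it ([side_bound_le]), and that
    walks within the two profiles rarely join the two vertices
    ([meet_bound_le]). Otherwise all paths are long, in the number of edges and
    in length ([path_far]). Thinning the sequence of quantiles compares the sum
    of the ell_i with a_n ([sum_skip_ge]).

    Upper bound. Let rho be slightly smaller than q and consider the layers
    y_(i+1) = y_i^rho. From a vertex of degree at least y_i, a fixed proportion
    of y_i half-edges are examined one by one, until one of them leads to degree
    larger than y_(i+1) through an edge of length at most the quantile at
    y_i^-delta; all of them fail with probability at most y_i^-delta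
    ([climb_failure_le]). The first layer is reached by a non-backtracking walk
    with a bounded number of steps, which exists since all degrees are at least
    two ([cond_le_walk]). Two vertices of degree n^beta with beta > 1/2, one on each
    side, are joined by a short edge ([cond_le_join]).

    Both bounds reveal the matching and the lengths along few half-edges. A list
    of pins records what was revealed; its probability is explicit, since the
    partner of a further half-edge is uniform among the free ones
    ([card_extensions_cons]) and the lengths are independent. *)

(** * Partial matchings and their extensions *)

Section Matchings.
Local Open Scope nat_scope.
Variable T : finType.

Definition involutions : {set {ffun T -> T}} :=
  [set M : {ffun T -> T} | [forall h, (M h != h) && (M (M h) == h)]]%SET.

Lemma involutionsP (M : {ffun T -> T}) :
  reflect (forall h, M h <> h /\ M (M h) = h) (M \in involutions).
Proof.
rewrite inE; apply: (iffP forallP) => H h.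
  by have /andP[/eqP ? /eqP ?] := H h.
by have [/eqP ? /eqP ?] := H h; apply/andP.
Qed.

Definition endpoints (s : seq (T * T)) : seq T := flatten [seq [:: t.1; t.2] | t <- s].

Lemma endpoints_cons h g s : endpoints ((h, g) :: s) = [:: h, g & endpoints s].
Proof. by []. Qed.

Lemma size_endpoints s : size (endpoints s) = (size s).*2.
Proof. by elim: s => //= t s ->; rewrite doubleS. Qed.

Definition extensions (s : seq (T * T)) : {set {ffun T -> T}} :=
  [set M in involutions | all (fun t => M t.1 == t.2) s]%SET.

Lemma extensions_cons h g s M :
  (M \in extensions ((h, g) :: s)) = (M h == g) && (M \in extensions s).
Proof. by rewrite !inE /= andbCA. Qed.

Lemma extension_closed s M h :
  M \in extensions s -> M h \in endpoints s -> h \in endpoints s.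
Proof.
rewrite inE => /andP[/involutionsP invM].
elim: s => //= -[a b] s IH /= /andP[/eqP Mab Ms].
rewrite !inE => /or3P[/eqP Ma|/eqP Mb|/(IH Ms) ->]; last by rewrite !orbT.
  by rewrite -(invM h).2 Ma Mab eqxx orbT.
by rewrite -(invM h).2 Mb -Mab (invM a).2 eqxx.
Qed.

(** Conjugation by the transposition of g and g' exchanges these two partners
    of h, and fixes the pinned half-edges. *)
Lemma card_extensions_swap_le h g g' s :
  uniq (endpoints ((h, g) :: s)) -> uniq (endpoints ((h, g') :: s)) ->
  #|extensions ((h, g) :: s)| <= #|extensions ((h, g') :: s)|.
Proof.
rewrite !endpoints_cons => U U'.
pose c (M : {ffun T -> T}) := [ffun x => tperm g g' (M (tperm g g' x))].
have cinj : injective c.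
  move=> M M' /ffunP cE; apply/ffunP => x.
  by have := cE (tperm g g' x); rewrite !ffunE tpermK => /perm_inj.
rewrite -(card_imset _ cinj); apply/subset_leq_card/fintype.subsetP => _ /imsetP[M + ->].
rewrite extensions_cons => /andP[/eqP Mh Ms].
have /involutionsP invM : M \in involutions by move: Ms; rewrite inE => /andP[].
have /and3P[] : [&& h \notin g :: endpoints s, g \notin endpoints s & uniq (endpoints s)] by [].
rewrite inE negb_or => /andP[hg hs] gs us.
have /and3P[] : [&& h \notin g' :: endpoints s, g' \notin endpoints s & uniq (endpoints s)] by [].
rewrite inE negb_or => /andP[hg' _] gs' _.
rewrite extensions_cons ffunE (tpermD (z := h)) 1?eq_sym // Mh tpermL eqxx /=.
rewrite !inE; apply/andP; split.
  apply/forallP => x; rewrite !ffunE !tpermK (invM _).2 tpermK eqxx andbT.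
  apply/eqP => /(congr1 (tperm g g')); rewrite tpermK; exact: (invM _).1.
move: Ms; rewrite inE => /andP[_ Ms].
have mem_fix x : x \in endpoints s -> tperm g g' x = x.
  by move=> xs; apply: tpermD; apply: contraTneq xs => <-.
apply/allP => -[a b] ab /=; rewrite ffunE.
have aend : a \in endpoints s.
  by apply/flattenP; exists [:: a; b]; rewrite ?inE ?eqxx //; apply/mapP; exists (a, b).
have bend : b \in endpoints s.
  apply/flattenP; exists [:: a; b]; rewrite ?inE ?eqxx ?orbT //.
  by apply/mapP; exists (a, b).
by have /eqP /= Mab := allP Ms _ ab; rewrite (mem_fix a) // Mab mem_fix.
Qed.

(** Given a pinned partial matching, the partner of a further half-edge is
    uniform among the remaining ones: exchanging two candidate partners is a
    bijection between the corresponding sets of matchings. *)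
Lemma card_extensions_cons h g s :
  uniq (endpoints ((h, g) :: s)) ->
  #|extensions ((h, g) :: s)| * (#|T| - (size s).*2.+1) = #|extensions s|.
Proof.
move=> U; have := U; rewrite endpoints_cons => /and3P[].
rewrite inE negb_or => /andP[hg hs] gs us.
pose free := [pred g' | g' \notin h :: endpoints s].
have cfree : #|free| = #|T| - (size s).*2.+1.
  have -> : #|free| = #|[predC (h :: endpoints s)]| by apply: eq_card => x; rewrite !inE.
  have := cardC (mem (h :: endpoints s)).
  have /card_uniqP -> : uniq (h :: endpoints s) by rewrite cons_uniq hs.
  rewrite /= size_endpoints => <-; rewrite addKn; apply: eq_card => x.
  by rewrite !inE.
rewrite -cfree mulnC -sum_nat_const.
have -> : \sum_(g' in free) #|extensions ((h, g) :: s)| =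
          \sum_(g' in free) #|extensions ((h, g') :: s)|.
  apply: eq_bigr => g'; rewrite !inE negb_or => /andP[g'h g's].
  have U' : uniq (endpoints ((h, g') :: s)).
    by rewrite endpoints_cons !cons_uniq inE negb_or eq_sym g'h hs g's.
  by apply/eqP; rewrite eqn_leq !card_extensions_swap_le.
rewrite -sum1_card (partition_big (fun M : {ffun T -> T} => M h) free) /=.
  apply: eq_bigr => g' _; rewrite -sum1_card; apply: eq_bigl => M.
  by rewrite extensions_cons andbC.
move=> M Ms; rewrite !inE negb_or; apply/andP; split.
  by move: Ms; rewrite inE => /andP[/involutionsP invM _]; apply/eqP => /(invM h).1.
by apply: contra hs => /(extension_closed Ms).
Qed.

(** Consecutive elements of an enumeration are paired. *)
Lemma involutions_neq0 : ~~ odd #|T| -> involutions != finset.set0.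
Proof.
move=> evT.
pose flip i := if odd i then i.-1 else i.+1.
have flipK : involutive flip.
  move=> i; rewrite /flip; case: i => //= i.
  by case: (boolP (odd i)) => /= [->|/negbTE ->].
have flip_neq i : flip i != i.
  by rewrite /flip; case: ifP => oi; [case: i oi => //= i _|]; rewrite -?ltn_neqAle // neq_ltn ltnSn ?orbT.
have flip_lt i : i < #|T| -> flip i < #|T|.
  rewrite /flip; case: ifPn => oi iT; first by apply: leq_ltn_trans iT; exact: leq_pred.
  rewrite ltn_neqAle iT andbT; apply: contraNneq evT => <-; exact: oi.
pose M := [ffun h : T => enum_val (Ordinal (flip_lt _ (ltn_ord (enum_rank h))))].
apply/set0Pn; exists M; apply/involutionsP => h; rewrite !ffunE; split.
  move/(congr1 enum_rank); rewrite enum_valK => /(congr1 val) /= /eqP.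
  by rewrite (negbTE (flip_neq _)).
apply: enum_rank_inj; rewrite enum_valK; apply: val_inj => /=.
by rewrite enum_valK /= flipK.
Qed.

End Matchings.

(** * Outer bounds, and the probability of revealed edges *)

Section Small.
Context {disp : measure_display} {T : measurableType disp} {R : realType}
  (mu : probability T R).

(** An outer bound on the probability: with it, the auxiliary events need not
    be shown to be measurable. *)
Definition small (A : set T) (x : R) : Prop :=
  exists B, [/\ measurable B, A `<=` B & (mu B <= x%:E)%E].

Lemma small_le (A A' : set T) (x y : R) :
  A `<=` A' -> x <= y -> small A' x -> small A y.
Proof.
move=> AA' xy [B [mB A'B Bx]]; exists B; split=> //; first exact: subset_trans A'B.
by apply: le_trans Bx _; rewrite lee_fin.
Qed.

Lemma small0 : small set0 0.
Proof. by exists set0; split; rewrite ?measure0 // lexx. Qed.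

Lemma small_empty (A : set T) (x : R) : A `<=` set0 -> 0 <= x -> small A x.
Proof. by move=> A0 x0; apply: small_le A0 x0 small0. Qed.

Lemma smallU (A A' : set T) (x y : R) : small A x -> small A' y -> small (A `|` A') (x + y).
Proof.
move=> [B [mB AB Bx]] [B' [mB' AB' By]]; exists (B `|` B'); split.
- exact: measurableU.
- exact: setUSS.
- by rewrite EFinD (le_trans (measureU2 _ _ _)) // leeD.
Qed.

Lemma small_bigcup_seq (I : eqType) (r : seq I) (F : I -> set T) (x : I -> R) (A : set T) :
  (forall w, A w -> exists2 i, i \in r & F i w) ->
  (forall i, i \in r -> small (F i) (x i)) -> small A (\sum_(i <- r) x i).
Proof.
elim: r A => [|i r IH] A cov sm.
  by rewrite big_nil; apply: small_empty => // w /cov[].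
rewrite big_cons; apply: (@small_le _ (F i `|` [set w | exists2 j, j \in r & F j w]) _ (x i + \sum_(j <- r) x j)) => //.
  move=> w /cov[j]; rewrite inE => /predU1P[->|jr] Fj; first by left.
  by right; exists j.
apply: smallU; first by apply: sm; rewrite mem_head.
by apply: IH => // j jr; apply: sm; rewrite inE jr orbT.
Qed.

Lemma small_bigcup (I : finType) (P : pred I) (F : I -> set T) (x : I -> R) (A : set T) :
  (forall w, A w -> exists2 i, P i & F i w) ->
  (forall i, P i -> small (F i) (x i)) -> small A (\sum_(i | P i) x i).
Proof.
move=> cov sm; rewrite -big_filter; apply: (small_bigcup_seq (F := F)).
  by move=> w /cov[i Pi Fi]; exists i => //; rewrite mem_filter Pi mem_index_enum.
by move=> i; rewrite mem_filter => /andP[Pi _]; exact: sm.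
Qed.

Lemma small_bigcup_nat (a b : nat) (F : nat -> set T) (x : nat -> R) (A : set T) :
  (forall w, A w -> exists2 i, (a <= i < b)%N & F i w) ->
  (forall i, (a <= i < b)%N -> small (F i) (x i)) -> small A (\sum_(a <= i < b) x i).
Proof.
move=> cov sm; apply: (small_bigcup_seq (F := F)).
  by move=> w /cov[i Pi Fi]; exists i => //; rewrite mem_index_iota.
by move=> i; rewrite mem_index_iota; exact: sm.
Qed.

End Small.

Section Pins.
Context {R : realType} {m : nat} {d : 'I_m.+1 -> nat} {dO : measure_display}
  {Omega : measurableType dO} {Q : probability Omega R} {X : {RV Q >-> R}}
  (G : weighted_cm d X).

Local Notation H := (half_edge d).
Local Notation N := #|half_edge d|.
Local Notation mu := (wcm_prob G).

(** The distribution of X takes extended real values; probabilities are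
    handled as reals. *)
Definition length_law (B : set R) : R := fine (distribution Q X B).

Lemma length_law_ge0 B : 0 <= length_law B.
Proof. exact: fine_ge0. Qed.

Lemma length_lawE B : measurable B -> (length_law B)%:E = distribution Q X B.
Proof. by move=> mB; rewrite fineK // fin_num_measure. Qed.

Lemma length_law_setT : length_law setT = 1.
Proof. by rewrite /length_law probability_setT. Qed.

Lemma length_law_le1 B : measurable B -> length_law B <= 1.
Proof. by move=> mB; rewrite -lee_fin length_lawE // probability_le1. Qed.

Lemma length_law_setC B : measurable B -> length_law (~` B) = 1 - length_law B.
Proof.
move=> mB; apply: EFin_inj; rewrite length_lawE; last exact: measurableC.
by rewrite probability_setC // EFinB length_lawE.
Qed.

(** A pin (h, g, B) prescribes the partner g of h and a set B of lengths for
    their edge. *)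
Definition pin : Type := (H * H * set R)%type.

Definition used (s : seq pin) : seq H := endpoints (map fst s).

Lemma used_cons t s : used (t :: s) = [:: t.1.1, t.1.2 & used s].
Proof. by []. Qed.

Lemma size_used s : size (used s) = (size s).*2.
Proof. by rewrite /used size_endpoints size_map. Qed.

Fixpoint measurable_pins (s : seq pin) : Prop :=
  if s is t :: s' then measurable t.2 /\ measurable_pins s' else True.

Definition wf_pins (s : seq pin) : Prop := uniq (used s) /\ measurable_pins s.

Fixpoint pinned (s : seq pin) : set (wcm_space G) :=
  if s is t :: s' then
    [set w | wcm_matching w t.1.1 = t.1.2 /\ t.2 (wcm_len_at w [set t.1.1; t.1.2]%SET)] `&` pinned s'
  else setT.

(** The probability of the pins, revealed from the last one to the first: when
    k pins are known, N - 2 k - 1 half-edges may be the next partner. *)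
Fixpoint pin_weight (s : seq pin) : R :=
  if s is t :: s' then length_law t.2 / (N - (size s').*2.+1)%:R * pin_weight s' else 1.

Lemma pin_weight_ge0 s : 0 <= pin_weight s.
Proof. by elim: s => //= t s IH; rewrite mulr_ge0 // divr_ge0 ?ler0n // length_law_ge0. Qed.

Lemma wf_pins_cons h g B s : wf_pins ((h, g, B) :: s) <->
  [/\ measurable B, h \notin used s, g \notin h :: used s & wf_pins s].
Proof.
rewrite /wf_pins used_cons /= !inE !negb_or; split.
  by case=> /andP[/andP[hg hs] /andP[gs us]] [mB ms]; split; rewrite // eq_sym hg.
case=> mB hs /andP[gh gs] [us ms]; split => //.
by rewrite eq_sym gh hs gs.
Qed.

Lemma wf_pins_size s : wf_pins s -> ((size s).*2 <= N)%N.
Proof.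
case=> us _; rewrite -size_used -(card_uniqP us); exact: max_card.
Qed.

(** The law of the model prescribes a set of lengths for each edge; this is the
    one that the pins prescribe. *)
Fixpoint pin_constraint (s : seq pin) (e : {set H}) : set R :=
  if s is t :: s' then
    if e == [set t.1.1; t.1.2]%SET then t.2 else pin_constraint s' e
  else setT.

Lemma measurable_pin_constraint s e : measurable_pins s -> measurable (pin_constraint s e).
Proof. by elim: s => //= t s IH [mt ms]; case: ifP => // _; exact: IH. Qed.

Lemma pin_constraint_unused s h g : h \notin used s -> pin_constraint s [set h; g]%SET = setT.
Proof.
elim: s => //= t s IH; rewrite used_cons !inE !negb_or => /and3P[h1 h2 hs].
case: eqP => [E|_]; last exact: IH.
have : h \in [set t.1.1; t.1.2]%SET by rewrite -E !inE eqxx.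
by rewrite !inE (negbTE h1) (negbTE h2).
Qed.

Lemma prod_pin_constraint s M : wf_pins s -> M \in extensions (map fst s) ->
  (\prod_(e in edges M) distribution Q X (pin_constraint s e))%E
  = (\prod_(t <- s) length_law t.2)%:E.
Proof.
elim: s => [|[[h g] B] s IH].
  by rewrite big_nil => _ _; rewrite big1 // => e _; rewrite /= probability_setT.
move/wf_pins_cons => [mB hs gs ws]; rewrite /= extensions_cons => /andP[/eqP Mh Ms].
have he : [set h; g]%SET \in edges M.
  by apply/imsetP; exists h; rewrite // /edge_of Mh.
have /= IHs := IH ws Ms.
rewrite big_cons (bigD1 [set h; g]%SET) //= eqxx EFinM length_lawE //; congr (_ * _)%E.
rewrite -IHs [RHS](bigD1 [set h; g]%SET) //= pin_constraint_unused //.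
rewrite probability_setT mul1e; apply: eq_bigr => e /andP[_ eh].
by rewrite (negbTE eh).
Qed.

(** Revealing the pins one at a time turns the proportion of the matchings that
    extend them into a product. *)
Lemma prod_pin_weight s : wf_pins s ->
  #|extensions (map fst s)|%:R * \prod_(t <- s) length_law t.2
  = #|perfect_matchings d|%:R * pin_weight s.
Proof.
elim: s => [|[[h g] B] s IH] /=.
  move=> _; rewrite big_nil /= !mulr1; congr (_%:R); apply: eq_card => M.
  by rewrite !inE andbT.
move=> W; have [mB hs gs ws] := (wf_pins_cons h g B s).1 W.
have := card_extensions_cons W.1; rewrite size_map => cE.
have Npos : (0 < N - (size s).*2.+1)%N.
  by rewrite subn_gt0; have := wf_pins_size W; rewrite /= doubleS.
rewrite big_cons; have := IH ws; rewrite -cE natrM.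
set k := (N - (size s).*2.+1)%N in Npos *; set c := _%:R; set p := \prod_(_ <- _) _.
rewrite -/k => IHs; have k0 : (k%:R : R) != 0 by rewrite pnatr_eq0 -lt0n.
have -> : #|perfect_matchings d|%:R * (length_law B / k%:R * pin_weight s) =
  length_law B / k%:R * (#|perfect_matchings d|%:R * pin_weight s) by ring.
by rewrite -IHs; field.
Qed.

End Pins.
Arguments pinned {R m d dO Omega Q X} G s _.
Arguments length_law {R dO Omega Q} X B.
Arguments pin_weight {R m d dO Omega Q} X s.

Section CountableMeasurable.
Context {dT : measure_display} {T : measurableType dT} {I : countType}.

Lemma measurable_exists_count (A : I -> set T) :
  (forall i, measurable (A i)) -> measurable [set w | exists i, A i w].
Proof.
move=> mA; have -> : [set w | exists i, A i w] =
    \bigcup_n (if unpickle n is Some i then A i else set0).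
  apply/seteqP; split=> [w /= [i Ai]|w [n _]]; first by exists (pickle i) => //; rewrite pickleK.
  by case: (unpickle n) => // i Ai; exists i.
by apply: bigcup_measurable => n _; case: (unpickle n).
Qed.

Lemma measurable_forall_count (A : I -> set T) :
  (forall i, measurable (A i)) -> measurable [set w | forall i, A i w].
Proof.
move=> mA; have -> : [set w | forall i, A i w] = ~` [set w | exists i, (~` A i) w].
  apply/seteqP; split=> [w /= Aw [i]|w /= nA i]; first exact.
  by apply: contrapT => nAi; apply: nA; exists i.
by apply: measurableC; apply: measurable_exists_count => i; exact: measurableC.
Qed.

End CountableMeasurable.

Section FiniteMeasurable.
Context {disp : measure_display} {T : measurableType disp} {R : realType}
  (mu : probability T R).

Lemma measure_disjoint_seq (I : eqType) (r : seq I) (F : I -> set T) :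
  uniq r -> (forall i, i \in r -> measurable (F i)) ->
  (forall i j w, F i w -> F j w -> i = j) ->
  (mu [set w | exists2 i, i \in r & F i w] = \sum_(i <- r) mu (F i))%E.
Proof.
elim: r => [|i r IH] /=.
  move=> _ _ _; rewrite big_nil; rewrite (_ : [set w | _] = set0) ?measure0 //.
  by apply/seteqP; split => // w [].
move=> /andP[ir ur] mF dF; rewrite big_cons -IH //; last first.
  by move=> j jr; apply: mF; rewrite inE jr orbT.
have mr : measurable [set w | exists2 j, j \in r & F j w].
  rewrite (_ : [set w | _] = \bigcup_(j in [set` r]) F j); last first.
    by apply/seteqP; split => w [j]; exists j.
  by apply: fin_bigcup_measurable => // j /= jr; apply: mF; rewrite inE jr orbT.
rewrite -measureU //; [|by apply: mF; rewrite mem_head|]; last first.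
  apply/seteqP; split => // w /= [Fi [j jr Fj]].
  by rewrite (dF _ _ _ Fi Fj) jr in ir.
congr (mu _); apply/seteqP; split => w /=.
  move=> [j]; rewrite inE => /predU1P[->|jr] Fj; first by left.
  by right; exists j.
by move=> [Fi|[j jr Fj]]; [exists i|exists j] => //; rewrite inE ?eqxx ?jr ?orbT.
Qed.

End FiniteMeasurable.

Lemma card_half_edge m (d : 'I_m.+1 -> nat) : #|half_edge d| = (\sum_v cm_degree d v)%N.
Proof. by rewrite /half_edge card_tagged sumnE big_map big_enum /=; apply: eq_bigr => i _; rewrite card_ord. Qed.

Lemma odd_card_half_edge m (d : 'I_m.+1 -> nat) : ~~ odd #|half_edge d|.
Proof.
rewrite card_half_edge /cm_degree big_split /= oddD.
have -> : (\sum_(i < m.+1) ((i == ord_max) && odd (\sum_(w < m.+1) d w)) =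
  odd (\sum_(w < m.+1) d w))%N.
  set o := odd _; rewrite (bigD1 ord_max) //= big1; last by move=> i /negbTE ->.
  by rewrite eqxx /= addn0.
by rewrite oddb addbb.
Qed.

Lemma perfect_matchings_gt0 m (d : 'I_m.+1 -> nat) : (0 < #|perfect_matchings d|)%N.
Proof. by rewrite card_gt0; exact: (involutions_neq0 (odd_card_half_edge d)). Qed.

Section ProductEvents.
Context {R : realType} {m : nat} {d : 'I_m.+1 -> nat} {dO : measure_display}
  {Omega : measurableType dO} {Q : probability Omega R} {X : {RV Q >-> R}}
  (G : weighted_cm d X).

Local Notation H := (half_edge d).
Local Notation N := #|half_edge d|.
Local Notation mu := (wcm_prob G).
Local Notation n := (m.+1%:R : R).

Lemma pinned_constraint s w e : pinned G s w -> pin_constraint s e (wcm_len_at w e).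
Proof. by elim: s => //= t s IH [[_ tl] evs]; case: eqP => [->|_] //; exact: IH. Qed.

Lemma pinned_extensions s w : pinned G s w -> wcm_matching w \in perfect_matchings d ->
  wcm_matching w \in extensions (map fst s).
Proof.
move=> evs Mw; elim: s evs => [|[[h g] B] s IH] /=; first by rewrite inE Mw.
by move=> [[/= Mh _] evs]; rewrite extensions_cons Mh eqxx IH.
Qed.

(** These are the events whose probabilities the model gives. *)
Lemma measurable_law_atom M a b (A : {set H} -> set R) :
  (forall e, measurable (A e)) ->
  measurable [set w | [/\ wcm_matching w = M, wcm_u w = a, wcm_v w = b &
     forall e, e \in edges M -> A e (wcm_len G e w)]].
Proof.
move=> mA; have -> : [set w | [/\ wcm_matching w = M, wcm_u w = a, wcm_v w = b &
     forall e, e \in edges M -> A e (wcm_len G e w)]] =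
   [set w | wcm_matching w = M] `&` [set w | wcm_u w = a] `&` [set w | wcm_v w = b] `&`
   [set w | forall e, e \in edges M -> A e (wcm_len G e w)].
  by apply/seteqP; split => w /= => [[]|[[[]]]].
apply: measurableI; first apply: measurableI; first apply: measurableI.
- exact: wcm_measurable_matching.
- exact: wcm_measurable_u.
- exact: wcm_measurable_v.
apply: (measurable_forall_count (A := fun e w => e \in edges M -> A e (wcm_len G e w))) => e.
case: (boolP (e \in edges M)) => eM; last first.
  by rewrite (_ : (fun _ => _) = setT) //; apply/seteqP; split => w.
rewrite (_ : (fun _ => _) = wcm_len G e @^-1` A e).
  by rewrite -[X in measurable X]setTI; exact: measurable_funPT.
by apply/seteqP; split => w /=; [apply|].
Qed.

Lemma small_atom M a b s : wf_pins s -> M \in extensions (map fst s) ->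
  small mu (pinned G s `&` [set w | [/\ wcm_matching w = M, wcm_u w = a & wcm_v w = b]])
    (#|perfect_matchings d|%:R^-1 * n^-1 * n^-1 * \prod_(t <- s) length_law X t.2).
Proof.
move=> ws Ms; have MP : M \in perfect_matchings d by move: Ms; rewrite inE => /andP[].
exists [set w | [/\ wcm_matching w = M, wcm_u w = a, wcm_v w = b &
     forall e, e \in edges M -> pin_constraint s e (wcm_len G e w)]]; split.
- by apply: measurable_law_atom => e; apply: measurable_pin_constraint ws.2.
- by move=> w /= [evs [-> -> ->]]; split => // e _; exact: pinned_constraint.
- rewrite wcm_law //; last by move=> e; apply: measurable_pin_constraint ws.2.
  by rewrite (prod_pin_constraint ws Ms) -!EFinM.
Qed.

(** The atoms over all perfect matchings have total mass one. *)
Lemma small_not_matching : small mu [set w | wcm_matching w \notin perfect_matchings d] 0.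
Proof.
pose I := ({ffun H -> H} * ('I_m.+1 * 'I_m.+1))%type.
pose F (i : I) := [set w | [/\ wcm_matching w = i.1, wcm_u w = i.2.1, wcm_v w = i.2.2 &
     forall e, e \in edges i.1 -> setT (wcm_len G e w)]].
pose P := [pred i : I | i.1 \in perfect_matchings d].
have mF i : measurable (F i) by apply: (@measurable_law_atom i.1 i.2.1 i.2.2 (fun=> [set: R])).
have dF i j w : F i w -> F j w -> i = j.
  by move: i j => [M [a b]] [M' [a' b']] [/= <- <- <- _] [/= <- <- <- _].
set U := [set w | exists2 i, i \in enum P & F i w].
have muU : mu U = 1%E.
  rewrite measure_disjoint_seq ?enum_uniq // big_enum /=.
  rewrite (eq_bigr (fun i : I => (#|perfect_matchings d|%:R^-1 * n^-1 * n^-1)%:E)); last first.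
    move=> i Pi; rewrite /F (@wcm_law _ _ _ _ _ _ _ G _ _ _ (fun=> setT)) //.
    rewrite big1 ?mule1 -?EFinM // => e _; exact: probability_setT.
  rewrite sumEFin sumr_const; congr (_%:E).
  have -> : #|P| = (#|perfect_matchings d| * (m.+1 * m.+1))%N.
    have -> : #|P| = #|[predX perfect_matchings d & predT : pred ('I_m.+1 * 'I_m.+1)]|.
      by apply: eq_card => -[M c]; rewrite !inE andbT.
    by rewrite cardX; congr (_ * _)%N; rewrite card_prod card_ord.
  rewrite -[LHS]mulr_natl !natrM.
  have := perfect_matchings_gt0 d; rewrite lt0n -(pnatr_eq0 R) => p0.
  have : n != 0 by rewrite pnatr_eq0.
  by move: (n) => x x0; field; rewrite p0 x0.
have mU : measurable U.
  rewrite (_ : U = \bigcup_(j in [set` enum P]) F j); last first.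
    by apply/seteqP; split => w [j]; exists j.
  by apply: fin_bigcup_measurable => // j /= jr; exact: mF.
exists (~` U); split; first exact: measurableC.
  move=> w /= nM [[M [a b]]]; rewrite mem_enum inE /= => PM [/= E _ _ _].
  by rewrite E PM in nM.
by rewrite probability_setC // muU subee.
Qed.

(** An event whose conditioning leaves the matching uniform and the lengths
    independent, so that pins have their product weight. *)
Definition product_event (E : set (wcm_space G)) (p : R) : Prop :=
  [/\ 0 <= p, (forall w, E w -> wcm_matching w \in perfect_matchings d)
    & forall s, wf_pins s -> small mu (E `&` pinned G s) (p * pin_weight X s)].

Definition matched : set (wcm_space G) := [set w | wcm_matching w \in perfect_matchings d].

Lemma product_event_uv a b :
  product_event (matched `&` [set w | wcm_u w = a /\ wcm_v w = b]) (n^-1 * n^-1).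
Proof.
split=> [|w [] //|s ws]; first by rewrite mulr_ge0 // invr_ge0.
apply: (@small_le _ _ _ _ _ _ (\sum_(M in extensions (map fst s))
   (#|perfect_matchings d|%:R^-1 * n^-1 * n^-1 * \prod_(t <- s) length_law X t.2))).
- exact: subset_refl.
- rewrite sumr_const -[leLHS]mulr_natl.
  have -> : #|extensions (map fst s)|%:R *
    (#|perfect_matchings d|%:R^-1 * n^-1 * n^-1 * \prod_(t <- s) length_law X t.2) =
    #|perfect_matchings d|%:R^-1 * n^-1 * n^-1 *
    (#|extensions (map fst s)|%:R * \prod_(t <- s) length_law X t.2) by ring.
  rewrite prod_pin_weight //.
  have := perfect_matchings_gt0 d; rewrite lt0n -(pnatr_eq0 R) => p0.
  have : n != 0 by rewrite pnatr_eq0.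
  by move: (n) => x x0; rewrite le_eqVlt; apply/orP; left; apply/eqP; field; rewrite p0 x0.
apply: (small_bigcup (F := fun M => pinned G s `&`
  [set w | [/\ wcm_matching w = M, wcm_u w = a & wcm_v w = b]])).
- move=> w [[Mw [ua vb]] evs]; exists (wcm_matching w) => //.
  exact: pinned_extensions.
- by move=> M Ms; exact: small_atom.
Qed.

(** Summing over the values of a vertex multiplies the probability by n. *)
Lemma product_event_union (E : set (wcm_space G)) (F : 'I_m.+1 -> set (wcm_space G)) (p : R) :
  (forall a, product_event (F a) (p / n)) -> (forall w, E w -> exists a, F a w) -> product_event E p.
Proof.
have n0 : n != 0 by rewrite pnatr_eq0.
move=> bF cov; split=> [|w /cov[a Fw]|s ws].
- by have [p0 _ _] := bF ord0; rewrite -(divfK n0 p) mulr_ge0.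
- by have [_ FM _] := bF a; exact: FM Fw.
apply: (@small_le _ _ _ _ _ _ (\sum_(a < m.+1) (p / n * pin_weight X s))).
- exact: subset_refl.
- by rewrite sumr_const card_ord -[leLHS]mulr_natl mulrA mulrCA divff // mulr1.
apply: (small_bigcup (F := fun a => F a `&` pinned G s)).
- by move=> w [/cov[a Fw] evs]; exists a.
- by move=> a _; have [_ _] := bF a; apply.
Qed.

Lemma product_event_u a : product_event (matched `&` [set w | wcm_u w = a]) n^-1.
Proof. by apply: product_event_union (product_event_uv a) _ => w [Mw ua]; exists (wcm_v w). Qed.

Lemma product_event_v b : product_event (matched `&` [set w | wcm_v w = b]) n^-1.
Proof. by apply: product_event_union (product_event_uv^~ b) _ => w [Mw vb]; exists (wcm_u w). Qed.

Lemma product_event_matched : product_event matched 1.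
Proof.
apply: (product_event_union (F := fun a => matched `&` [set w | wcm_u w = a])) => [a|w Mw].
  by rewrite mul1r; exact: product_event_u.
by exists (wcm_u w).
Qed.

End ProductEvents.

Arguments matched {R m d dO Omega Q X} G _.

(** * First moment bounds for walks *)

Lemma eq_ler (R : numDomainType) (x y : R) : x = y -> x <= y.
Proof. by move=> ->. Qed.

Lemma sumr_const_pred (R : pzRingType) (I : finType) (P : pred I) (a : R) :
  \sum_(i | P i) a = #|[pred i | P i]|%:R * a.
Proof. by rewrite mulr_natl -sumr_const; apply: eq_bigl => i; rewrite inE. Qed.

Lemma card_owner m (d : 'I_m.+1 -> nat) (x : 'I_m.+1) :
  #|[pred h : half_edge d | owner h == x]| = cm_degree d x.
Proof.
pose f (i : 'I_(cm_degree d x)) : half_edge d := Tagged (fun v => 'I_(cm_degree d v)) i.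
have finj : injective f by move=> i j /eqP; rewrite eq_Tagged => /eqP.
rewrite -[RHS]card_ord -(card_codom finj); apply: eq_card => -[y j].
rewrite !inE /owner /=; apply/eqP/codomP => [yx|[i /(congr1 tag)] //].
by subst y; exists j.
Qed.

Section FirstMoment.
Context {R : realType} {m : nat} {d : 'I_m.+1 -> nat} {dO : measure_display}
  {Omega : measurableType dO} {Q : probability Omega R} {X : {RV Q >-> R}}
  (G : weighted_cm d X).

Local Notation H := (half_edge d).
Local Notation N := #|half_edge d|.
Local Notation mu := (wcm_prob G).
Local Notation D := (cm_degree d).

(** Endpoints of pins are closed under taking partners. *)
Lemma partner_free E p (s : seq (@pin R m d)) h w : product_event E p -> h \notin used s -> E w -> pinned G s w ->
  wcm_matching w h \notin h :: used s.
Proof.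
move=> [_ EM _] hs Ew evs; have Mw := EM _ Ew.
have Ms := pinned_extensions evs Mw; rewrite inE negb_or; apply/andP; split.
  by have /involutionsP/(_ h)[/eqP] : wcm_matching w \in involutions H by [].
by apply: contra hs => /(extension_closed Ms).
Qed.

Lemma pin_weight_cons_le (h g : H) (B : set R) (s : seq (@pin R m d)) : wf_pins ((h, g, B) :: s) -> (4 * (size s).+1 <= N)%N ->
  pin_weight X ((h, g, B) :: s) <= length_law X B * (2 / N%:R) * pin_weight X s.
Proof.
move=> W szN; rewrite /= ler_wpM2r ?pin_weight_ge0 // ler_wpM2l ?length_law_ge0 //.
have kN : (N <= 2 * (N - (size s).*2.+1))%N by move: szN; rewrite -mul2n; lia.
have N0 : (0 < N)%N by lia.
have k0 : (0 < N - (size s).*2.+1)%N by lia.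
rewrite -[X in X <= _]mul1r ler_pdivrMr ?ltr0n // mulrAC ler_pdivlMr ?ltr0n // mul1r.
by rewrite -natrM ler_nat.
Qed.

(** The recursion reveals the half-edges of the walk in their order; U collects
    those already used, so that each step meets a fresh half-edge. *)
Fixpoint walks (B : set R) (U : seq H) (x : 'I_m.+1) (cs : seq (pred 'I_m.+1)) :
    set (wcm_space G) :=
  if cs is c :: cs' then
    [set w | exists h, [/\ owner h = x, h \notin U, c (owner (wcm_matching w h)),
       (if cs' is [::] then B else setT) (wcm_len_at w [set h; wcm_matching w h]%SET) &
       walks B [:: h, wcm_matching w h & U] (owner (wcm_matching w h)) cs' w]]
  else setT.

Definition half_edges_at (c : pred 'I_m.+1) : R := #|[pred g : H | c (owner g)]|%:R.

(** An entrance and an exit with the same owner: the ways for a walk to pass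
    through a vertex in c. *)
Definition pairs_at (c : pred 'I_m.+1) : R := \sum_(g : H | c (owner g)) (D (owner g))%:R.

(** An expected number of walks for each half-edge of the starting vertex. While
    at most a quarter of the half-edges are used, a prescribed pairing has
    probability at most 2 / N. *)
Fixpoint walk_bound (B : set R) (cs : seq (pred 'I_m.+1)) : R :=
  if cs is c :: cs' then
    2 / N%:R * (if cs' is [::] then half_edges_at c * length_law X B
                else pairs_at c * walk_bound B cs')
  else 1.

Lemma walk_bound_ge0 B cs : 0 <= walk_bound B cs.
Proof.
elim: cs => //= c cs IH; rewrite mulr_ge0 ?divr_ge0 //.
case: cs IH => [_|c' cs IH]; first by rewrite mulr_ge0 // length_law_ge0.
by rewrite mulr_ge0 // sumr_ge0.
Qed.

(** Each step reveals one pin, and the walks are summed over the pins that they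
    may reveal. *)
Lemma small_walks E p B cs (s : seq (@pin R m d)) x : product_event E p -> measurable B -> wf_pins s -> cs != [::] ->
  (4 * (size s + size cs) <= N)%N ->
  small mu (E `&` pinned G s `&` walks B (used s) x cs)
    (p * pin_weight X s * (D x)%:R * walk_bound B cs).
Proof.
move=> bE mB; have [p0 _ Esm] := bE.
elim: cs s x => // c cs IH s x ws _ szN.
pose B' := if cs is [::] then B else setT.
have mB' : measurable B' by rewrite /B'; case: (cs).
pose F (i : H * H) := E `&` pinned G s `&` [set w | [/\ i.1 \notin used s,
   wcm_matching w i.1 = i.2, B' (wcm_len_at w [set i.1; i.2]%SET) &
   walks B [:: i.1, i.2 & used s] (owner i.2) cs w]].
pose y (i : H * H) : R := p * pin_weight X s * (2 / N%:R) *
  (if cs is [::] then length_law X B else (D (owner i.2))%:R * walk_bound B cs).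
have cover : small mu (E `&` pinned G s `&` walks B (used s) x (c :: cs))
    (\sum_(i | (owner i.1 == x) && c (owner i.2)) y i).
  apply: (small_bigcup (F := F)).
  - move=> w [[Ew evs] [h [hx hU ch Bl wk]]]; exists (h, wcm_matching w h).
      by rewrite /= hx eqxx ch.
    by split.
  - move=> [h g] /andP[/= hx cg].
    have y0 : 0 <= y (h, g).
      rewrite /y !mulr_ge0 ?invr_ge0 ?pin_weight_ge0 //; case: (cs) => [|? ?]; first exact: length_law_ge0.
      by rewrite mulr_ge0 // walk_bound_ge0.
    case: (boolP ((h \notin used s) && (g \notin h :: used s))) => [/andP[hs gs]|nf]; last first.
      apply: small_empty y0 => w [[Ew evs] [/= hs Mh _ _]].
      by move: nf; rewrite hs -Mh (partner_free bE hs Ew evs).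
    have ws' : wf_pins ((h, g, B') :: s) by apply/wf_pins_cons.
    have szs : (4 * (size s).+1 <= N)%N by move: szN => /=; lia.
    have wt' := pin_weight_cons_le ws' szs.
    case: cs IH szN @B' mB' @F @y y0 ws' wt' => [|c' cs] IH szN B' mB' F y y0 ws' wt'.
      apply: (small_le _ _ (Esm _ ws')).
        by move=> w [[Ew evs] [_ Mh Bl _]]; split.
      rewrite /y -!mulrA ler_wpM2l //; apply: le_trans wt' _.
      by apply/eq_ler; rewrite /B'; ring.
    apply: (small_le _ _ (IH ((h, g, B') :: s) (owner g) ws' isT _)).
    - move=> w [[Ew evs] [_ Mh Bl wk]]; split=> //; split=> //.
    - apply: (@le_trans _ _ (p * (length_law X B' * (2 / N%:R) * pin_weight X s) * (D (owner g))%:R *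
        walk_bound B (c' :: cs))).
        by rewrite ler_wpM2r ?walk_bound_ge0 // ler_wpM2r // ler_wpM2l.
      by rewrite /B' length_law_setT /y /=; apply/eq_ler; ring.
    - by move: szN => /=; lia.
apply: small_le cover; first exact: subset_refl.
apply: (@le_trans _ _ (\sum_(h : H | owner h == x) \sum_(g : H | c (owner g)) y (h, g))).
  by rewrite pair_big; apply/eq_ler/eq_big => // -[].
rewrite /y /= sumr_const_pred card_owner.
rewrite /half_edges_at /pairs_at; case: (cs) => [|c' cs'] /=.
  by rewrite sumr_const_pred; apply/eq_ler; ring.
by rewrite -mulr_sumr -mulr_suml; apply/eq_ler; ring.
Qed.

End FirstMoment.

Section Exploration.
Context {R : realType} {m : nat} {d : 'I_m.+1 -> nat} {dO : measure_display}
  {Omega : measurableType dO} {Q : probability Omega R} {X : {RV Q >-> R}}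
  (G : weighted_cm d X) (E : set (wcm_space G)) (p : R) (bE : product_event E p)
  (Bad : set (wcm_space G)).

Local Notation H := (half_edge d).
Local Notation N := #|half_edge d|.
Local Notation mu := (wcm_prob G).
Local Notation D := (cm_degree d).

(** Given the pins s, the conditional probability of Bad is at most q. *)
Definition cond_le (s : seq pin) (q : R) : Prop :=
  small mu (E `&` pinned G s `&` Bad) (q * (p * pin_weight X s)).

Let p_ge0 : 0 <= p. Proof. by case: bE. Qed.

Lemma cond_le_trans s q q' : cond_le s q -> q <= q' -> cond_le s q'.
Proof.
move=> b qq'; apply: small_le b => //.
by rewrite ler_wpM2r // mulr_ge0 // pin_weight_ge0.
Qed.

Lemma cond_le1 s : wf_pins s -> cond_le s 1.
Proof.
move=> ws; have [_ _ /(_ s ws)] := bE; rewrite /cond_le mul1r; apply: small_le => //.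
Qed.

Lemma cond_le0 s : (forall w, E w -> pinned G s w -> Bad w -> False) -> cond_le s 0.
Proof.
move=> h; rewrite /cond_le mul0r; apply: small_empty => // w [[Ew evs]]; exact: h.
Qed.

Definition short (t : R) : set R := `]-oo, t].

Lemma measurable_short t : measurable (short t).
Proof. exact: measurable_itv. Qed.

(** The outcome of looking whether an edge is short. *)
Definition tested (t : R) (b : bool) : set R := if b then short t else ~` short t.

Lemma measurable_tested t b : measurable (tested t b).
Proof. by case: b; [|apply: measurableC]; exact: measurable_short. Qed.

(** Examining the half-edge h: the conditional probability of Bad is the
    average over the partner of h and over whether the edge is short. *)
Lemma cond_le_examine s h t (q : H -> bool -> R) : wf_pins s -> h \notin used s ->
  (forall g b, g \notin h :: used s -> cond_le ((h, g, tested t b) :: s) (q g b)) ->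
  cond_le s ((\sum_(g | g \notin h :: used s)
     (length_law X (short t) * q g true + (1 - length_law X (short t)) * q g false))
     / (N - (size s).*2.+1)%:R).
Proof.
move=> ws hs Hq.
set f := length_law X (short t).
pose F (i : H * bool) := E `&` pinned G ((h, i.1, tested t i.2) :: s) `&` Bad.
pose y (i : H * bool) : R := q i.1 i.2 * (p * pin_weight X ((h, i.1, tested t i.2) :: s)).
have cover : small mu (E `&` pinned G s `&` Bad)
    (\sum_(i | (i.1 \notin h :: used s) && true) y i).
  apply: (small_bigcup (F := F)).
  - move=> w [[Ew evs] Bw]; pose g := wcm_matching w h.
    have gs : g \notin h :: used s by apply: partner_free bE hs Ew evs.
    case: (pselect (short t (wcm_len_at w [set h; g]%SET))) => l.
      by exists (g, true) => /=; [rewrite gs|].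
    by exists (g, false) => /=; [rewrite gs|].
  - by move=> [g b] /andP[/= gs _]; exact: Hq.
apply: small_le cover; first exact: subset_refl.
apply: (@le_trans _ _ (\sum_(g : H | g \notin h :: used s) \sum_(b : bool | true) y (g, b))).
    by rewrite pair_big; apply/eq_ler/eq_big => // -[].
  apply/eq_ler; rewrite !mulr_suml; apply: eq_bigr => g _; rewrite big_bool /y /=.
  by rewrite (length_law_setC (measurable_short t)) -/f; ring.
Qed.

Lemma card_free (s : seq (@pin R m d)) h : wf_pins s -> h \notin used s ->
  #|[pred g : H | g \notin h :: used s]| = (N - (size s).*2.+1)%N.
Proof.
move=> [us _] hs.
have -> : #|[pred g : H | g \notin h :: used s]| = #|[predC (h :: used s)]|.
  by apply: eq_card => g; rewrite !inE.
have := cardC (mem (h :: used s)).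
have /card_uniqP -> : uniq (h :: used s) by rewrite cons_uniq hs.
by rewrite /= size_used => <-; rewrite addKn; apply: eq_card => g; rewrite !inE.
Qed.

(** A successful examination (partner in T and short edge) improves the bound
    from q2 to q1; a partner in Z or a long edge costs an extra e. *)
Lemma cond_le_examine_targets s h t (T Z : pred H) (q1 q2 e sigma eta : R) :
  wf_pins s -> h \notin used s -> 0 <= e -> q1 <= q2 ->
  (forall g, T g -> g \notin h :: used s) ->
  (0 < N - (size s).*2.+1)%N ->
  sigma * (N - (size s).*2.+1)%:R <= #|T|%:R * length_law X (short t) ->
  e * (#|Z|%:R + (1 - length_law X (short t)) * (N - (size s).*2.+1)%:R)
     <= eta * (N - (size s).*2.+1)%:R ->
  (forall g b, g \notin h :: used s ->
     cond_le ((h, g, tested t b) :: s)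
       (q2 - (q2 - q1) * (T g && b)%:R + e * ((Z g)%:R + (~~ b)%:R))) ->
  cond_le s (q2 - (q2 - q1) * sigma + eta).
Proof.
move=> ws hs e0 q12 Tfree k0 sT eZ Hq; apply: cond_le_trans (cond_le_examine ws hs Hq) _.
move: k0 sT eZ; rewrite -(ltr0n R); set k : R := _%:R => k0 sT eZ.
rewrite ler_pdivrMr //; set f := length_law X (short t) in sT eZ *.
have f01 : 0 <= 1 - f by rewrite subr_ge0 length_law_le1 //; exact: measurable_short.
apply: (@le_trans _ _ (q2 * k - (q2 - q1) * (#|T|%:R * f) + e * (#|Z|%:R + (1 - f) * k))).
  have kE : k = \sum_(g | g \notin h :: used s) (1 : R).
    by rewrite sumr_const_pred mulr1 (card_free ws hs).
  have TE : #|T|%:R = \sum_(g | g \notin h :: used s) ((T g)%:R : R).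
    rewrite -sumr_const big_mkcond /= [RHS]big_mkcond /=; apply: eq_bigr => g _.
    rewrite unfold_in; case: ifP => Tg; first by rewrite Tfree.
    by case: ifP.
  have ZE : \sum_(g | g \notin h :: used s) ((Z g)%:R : R) <= #|Z|%:R.
    rewrite -sumr_const big_mkcond /= [leRHS]big_mkcond /=; apply: ler_sum => g _.
    by rewrite unfold_in; case: (Z g); case: ifP.
  apply: (@le_trans _ _ (q2 * k - (q2 - q1) * (#|T|%:R * f)
     + e * (\sum_(g | g \notin h :: used s) ((Z g)%:R : R) + (1 - f) * k))).
    rewrite TE kE; apply/eq_ler.
    rewrite !mulr_sumr !mulr_suml !mulr_sumr -sumrB -!big_split /= !mulr_sumr -big_split /=.
    by apply: eq_bigr => g _; case: (T g); case: (Z g) => /=; ring.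
  by rewrite lerD2l ler_wpM2l // lerD2r.
have : (q2 - q1) * (sigma * k) <= (q2 - q1) * (#|T|%:R * f) by rewrite ler_wpM2l // subr_ge0.
by move: eZ; lra.
Qed.

End Exploration.

Arguments half_edges_at {R m} d c.
Arguments pairs_at {R m} d c.
Arguments walk_bound {R m} d {dO Omega Q} X B cs.

(** * Free half-edges, and connections by walks *)

Section HalfEdgeCounts.
Variables (m : nat) (d : 'I_m.+1 -> nat).
Local Open Scope nat_scope.
Local Notation H := (half_edge d).
Local Notation D := (cm_degree d).
Implicit Types (U : seq H) (v : 'I_m.+1).

Definition count_at U v := count (fun h : H => owner h == v) U.

Lemma sum_count_at U : \sum_v count_at U v = size U.
Proof.
elim: U => [|h U IH]; first by rewrite big1.
rewrite /= -IH -[RHS]add1n.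
rewrite (eq_bigr (fun v => (owner h == v) + count_at U v)) // big_split /=; congr (_ + _).
rewrite (bigD1 (owner h)) //= eqxx big1 // => v /negbTE.
by rewrite eq_sym => ->.
Qed.

Lemma card_by_owner (P : pred H) : #|P| = \sum_v #|[pred g : H | P g & owner g == v]|.
Proof.
rewrite -sum1_card (partition_big (fun g : H => owner g) xpredT) //=.
by apply: eq_bigr => v _; rewrite -sum1_card; apply: eq_bigl => g; rewrite !inE unfold_in.
Qed.

Lemma card_free_at U v : uniq U ->
  #|[pred g : H | g \notin U & owner g == v]| + count_at U v = D v.
Proof.
move=> uU; rewrite -card_owner -(cardID (mem U) [pred h : H | owner h == v]) addnC.
congr addn.
rewrite /count_at -size_filter -(card_uniqP (filter_uniq _ uU)).
by apply: eq_card => g; rewrite !inE mem_filter.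
Qed.

Lemma free_half_edge U v : uniq U -> count_at U v < D v ->
  exists2 h : H, owner h = v & h \notin U.
Proof.
move=> uU; rewrite -(card_free_at v uU) -{1}[count_at U v]add0n ltn_add2r.
by case/card_gt0P => h; rewrite !inE => /andP[hU /eqP hv]; exists h.
Qed.

(** The factor 4 leaves a target vertex mostly free, so that the exploration
    can go on from it. *)
Definition good_target U (Gam : pred 'I_m.+1) : pred H :=
  [pred g | [&& g \notin U, Gam (owner g) & 4 * count_at U (owner g) < D (owner g)]].

(** A used half-edge spoils itself and at most four more, as a vertex is only
    discarded when a quarter of its half-edges are used. *)
Lemma card_good_target U Gam :
  #|[pred g : H | Gam (owner g)]| <= #|good_target U Gam| + 5 * size U.
Proof.
pose B := [pred g : H | D (owner g) <= 4 * count_at U (owner g)].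
have cB : #|B| <= 4 * size U.
  rewrite card_by_owner -sum_count_at big_distrr /=; apply: leq_sum => v _.
  case: (leqP (D v) (4 * count_at U v)) => Dv.
    apply: leq_trans Dv; rewrite -card_owner; apply: subset_leq_card.
    by apply/fintype.subsetP => g; rewrite !inE => /andP[].
  rewrite (_ : #|_| = 0) //; apply: eq_card0 => g; rewrite !inE.
  by case: eqP => [->|]; rewrite ?andbF // andbT; apply/negbTE; rewrite -ltnNge.
have cU : #|[pred g in U]| <= size U.
  by rewrite (eq_card (B := mem U)) ?card_size // => g; rewrite !inE.
have : #|[pred g : H | Gam (owner g)]| <= #|good_target U Gam| + #|[pred g in U]| + #|B|.
  apply: (@leq_trans #|[predU [predU good_target U Gam & [pred g in U]] & B]|).
    apply: subset_leq_card; apply/fintype.subsetP => g; rewrite !inE => ->.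
    by case: (g \in U) => //=; case: ltnP.
  have cu (A A' : pred H) : #|[predU A & A']| <= #|A| + #|A'| by rewrite -cardUI leq_addr.
  by apply: leq_trans (cu _ _) _; rewrite leq_add2r; exact: cu.
move=> h; apply: leq_trans h _; lia.
Qed.

(** Owners for which the half-edge is the last free one: a walk that enters
    there cannot be continued. *)
Definition dead_end U : pred H :=
  [pred g | (g \notin U) && (D (owner g) <= (count_at U (owner g)).+1)].

(** Since all degrees are at least two, a vertex with a single free half-edge
    has a used one. *)
Lemma card_dead_end U : uniq U -> (forall v, 2 <= D v) -> #|dead_end U| <= size U.
Proof.
move=> uU D2; rewrite card_by_owner -sum_count_at; apply: leq_sum => v _.
case: (leqP (D v) (count_at U v).+1) => Dv.
  have : #|[pred g | dead_end U g & owner g == v]| <=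
         #|[pred g : H | g \notin U & owner g == v]|.
    apply: subset_leq_card; apply/fintype.subsetP => g; rewrite !inE.
    by move=> /andP[/andP[-> _] ->].
  have := card_free_at v uU; have := D2 v; lia.
rewrite (_ : #|_| = 0) //; apply: eq_card0 => g; rewrite !inE /dead_end /=.
by case: (owner g =P v) => [->|]; rewrite ?andbF // andbT leqNgt Dv andbF.
Qed.

End HalfEdgeCounts.

Section Reach.
Context {R : realType} {m : nat} {d : 'I_m.+1 -> nat}
  (M : {ffun half_edge d -> half_edge d}) (len : {set half_edge d} -> R).

Local Notation H := (half_edge d).

Definition reach (a b : 'I_m.+1) (c : R) (k : nat) : Prop :=
  exists p : seq H, [/\ is_walk M a b p, path_length M len p <= c & (size p <= k)%N].

Lemma reach_refl a : reach a a 0 0.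
Proof. by exists [::]; rewrite /path_length big_nil /= eqxx. Qed.

Lemma reach_le a b c c' k k' : c <= c' -> (k <= k')%N -> reach a b c k -> reach a b c' k'.
Proof.
move=> cc kk [p [wp lp sp]]; exists p; split => //; first exact: le_trans lp cc.
exact: leq_trans sp kk.
Qed.

Lemma is_walk_cat a b e p q :
  is_walk M a b p -> is_walk M b e q -> is_walk M a e (p ++ q).
Proof.
elim: p a => [a /eqP ->|h p IH a] //= /andP[-> wp] wq.
exact: IH wq.
Qed.

Lemma path_length_cat p q :
  path_length M len (p ++ q) = path_length M len p + path_length M len q.
Proof. by rewrite /path_length big_cat. Qed.

Lemma reach_trans a b e c c' k k' :
  reach a b c k -> reach b e c' k' -> reach a e (c + c') (k + k').
Proof.
move=> [p [wp lp sp]] [q [wq lq sq]]; exists (p ++ q); split.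
- exact: is_walk_cat wp wq.
- by rewrite path_length_cat lerD.
- by rewrite size_cat leq_add.
Qed.

Lemma reach_edge h t : len [set h; M h]%SET <= t -> reach (owner h) (owner (M h)) t 1.
Proof. by move=> lt; exists [:: h]; rewrite /path_length big_seq1 /= !eqxx. Qed.

Lemma edge_of_partner h : M (M h) = h -> edge_of M (M h) = edge_of M h.
Proof. by move=> MM; rewrite /edge_of MM finset.setUC. Qed.

Hypothesis invM : M \in perfect_matchings d.

Let MK h : M (M h) = h.
Proof. by have /involutionsP/(_ h)[] : M \in involutions H by []. Qed.

Lemma is_walk_rev a b p : is_walk M a b p -> is_walk M b a (rev (map M p)).
Proof.
elim: p a => [a /eqP ->|h p IH a] //=.
move=> /andP[/eqP <- wp]; rewrite rev_cons -cats1; apply: is_walk_cat (IH _ wp) _.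
by rewrite /= eqxx MK eqxx.
Qed.

Lemma path_length_rev p : path_length M len (rev (map M p)) = path_length M len p.
Proof.
rewrite /path_length big_rev /= big_map; apply: eq_bigr => h _.
by rewrite edge_of_partner.
Qed.

Lemma reach_sym a b c k : reach a b c k -> reach b a c k.
Proof.
move=> [p [wp lp sp]]; exists (rev (map M p)); split; first exact: is_walk_rev.
- by rewrite path_length_rev.
- by rewrite size_rev size_map.
Qed.

(** Cutting out loops turns a walk into a path without lengthening it. *)
Lemma reach_path a b c k : (forall h, 0 <= len (edge_of M h)) -> reach a b c k ->
  exists p, [/\ is_path M a b p, path_length M len p <= c & (size p <= k)%N].
Proof.
move=> len0 [p [wp lp sp]].
suff [q [pq lq sq]] : exists q, [/\ is_path M a b q,
    path_length M len q <= path_length M len p & (size q <= size p)%N].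
  by exists q; split=> //; [exact: le_trans lp|exact: leq_trans sp].
elim: p a wp {lp sp} => [a /= ab|h p IH a /=].
  by exists [::]; rewrite /is_path /= ab.
move=> /andP[/eqP ha /IH[q [/andP[wq uq] lq sq]]].
have lenS q' : path_length M len (h :: q') = len (edge_of M h) + path_length M len q'.
  by rewrite /path_length big_cons.
have split_at : forall y z r, is_walk M y b r -> z \in y :: [seq owner (M g) | g <- r] ->
    uniq (y :: [seq owner (M g) | g <- r]) ->
    exists r1 r2, [/\ r = r1 ++ r2, is_walk M z b r2
      & uniq (z :: [seq owner (M g) | g <- r2])].
  move=> y z r; elim: r y => [|g r IHr] y wr.
    by rewrite inE => /eqP -> _; exists [::], [::].
  rewrite inE => /predU1P[->|zr] ur; first by exists [::], (g :: r).
  move: wr => /= /andP[_ wr].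
  have ur' : uniq (owner (M g) :: [seq owner (M g) | g <- r]) by case/andP: ur.
  by have [r1 [r2 [-> w2 u2]]] := IHr _ wr zr ur'; exists (g :: r1), r2.
case: (boolP (a \in owner (M h) :: [seq owner (M g) | g <- q])) => aq; last first.
  exists (h :: q); split; last by [].
    by rewrite /is_path cons_uniq /= ha eqxx wq aq.
  by rewrite !lenS lerD2l.
have [r1 [r2 [qE w2 u2]]] := split_at _ _ _ wq aq uq.
exists r2; split; first by rewrite /is_path w2.
- rewrite lenS; apply: (@le_trans _ _ (path_length M len q)); last first.
    by apply: le_trans lq _; rewrite lerDr.
  by rewrite qE path_length_cat lerDr sumr_ge0.
- by apply: leq_trans (leqW sq); rewrite qE size_cat leq_addl.
Qed.

End Reach.

(** * Exploring the graph along half-edges *)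

Section Phases.
Context {R : realType} {m : nat} {d : 'I_m.+1 -> nat} {dO : measure_display}
  {Omega : measurableType dO} {Q : probability Omega R} {X : {RV Q >-> R}}
  (G : weighted_cm d X) (E : set (wcm_space G)) (p : R) (bE : product_event E p)
  (Bad : set (wcm_space G)).

Local Notation H := (half_edge d).
Local Notation N := #|half_edge d|.
Local Notation D := (cm_degree d).
Local Notation pin := (@pin R m d).
Local Notation cond_le := (cond_le E p Bad).
Local Notation cnt s v := (count_at (used s) v).
Local Notation F t := (length_law X (short t)).

Lemma size_pins_cons (t : pin) (s : seq pin) : size (t :: s) = (size s).+1.
Proof. by []. Qed.

Definition extends (s s' : seq pin) : Prop := exists l, s' = l ++ s.

Lemma extends_refl s : extends s s.
Proof. by exists [::]. Qed.

Lemma extends_cons s s' t : extends s s' -> extends s (t :: s').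
Proof. by case=> l ->; exists (t :: l). Qed.

Lemma extends_trans s s' s'' : extends s s' -> extends s' s'' -> extends s s''.
Proof. by case=> l -> [l' ->]; exists (l' ++ l); rewrite catA. Qed.

Lemma extends_pinned s s' w : extends s s' -> pinned G s' w -> pinned G s w.
Proof. by case=> l ->; elim: l => //= t l IH [_ /IH]. Qed.

Lemma extends_count s s' v : extends s s' ->
  (cnt s' v <= cnt s v + 2 * (size s' - size s))%N.
Proof.
case=> l ->; have -> : used (l ++ s) = used l ++ used s.
  by rewrite /used /endpoints map_cat map_cat flatten_cat.
rewrite /count_at count_cat addnC leq_add2l size_cat addnK.
by rewrite (leq_trans (count_size _ _)) // size_used -mul2n.
Qed.

Lemma count_used_cons (h g : H) (B : set R) (s : seq pin) v :
  cnt ((h, g, B) :: s) v = (count_at (h :: used s) v + (owner g == v))%N.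
Proof. by rewrite used_cons /count_at /= -addnA [(_ + (owner g == v))%N]addnC. Qed.

Definition reached (s : seq pin) (x y : 'I_m.+1) (c : R) (k : nat) : Prop :=
  forall w, E w -> pinned G s w -> reach (wcm_matching w) (wcm_len_at w) x y c k.

Lemma reached_extends s s' x y c k : extends s s' -> reached s x y c k -> reached s' x y c k.
Proof. by move=> ss cs w Ew /(extends_pinned ss); exact: cs. Qed.

Lemma reached_le s x y c c' k k' : c <= c' -> (k <= k')%N -> reached s x y c k -> reached s x y c' k'.
Proof. by move=> cc kk cs w Ew evs; apply: reach_le cc kk (cs w Ew evs). Qed.

Lemma reached_cons s a h g t c k : reached s a (owner h) c k ->
  reached ((h, g, short t) :: s) a (owner g) (c + t) (k + 1).
Proof.
move=> cs w Ew [[/= Mh lt] evs]; apply: reach_trans (cs w Ew evs) _.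
by rewrite -Mh; apply: reach_edge; move: lt; rewrite -Mh /short /= in_itv.
Qed.

Lemma free_count_gt0 (s : seq pin) : (4 * (size s).+1 <= N)%N -> (0 < N - (size s).*2.+1)%N.
Proof. by rewrite -mul2n; lia. Qed.

(** A failed try leaves the other half-edges of x to be tried under the same
    conditions, so that the failure probabilities multiply. *)
Lemma cond_le_tries (t q1 sigma : R) x r (s : seq pin) : 0 <= sigma <= 1 -> 0 <= q1 ->
  wf_pins s -> (cnt s x + 2 * r <= D x)%N -> (4 * (size s + r) <= N)%N ->
  (forall s' h, wf_pins s' -> extends s s' -> (size s' < size s + r)%N ->
     h \notin used s' -> owner h = x ->
     exists T : pred H, [/\ forall g, T g -> g \notin h :: used s',
       sigma * N%:R <= #|T|%:R * F t &
       forall g, T g -> wf_pins ((h, g, short t) :: s') -> cond_le ((h, g, short t) :: s') q1]) ->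
  cond_le s (q1 + (1 - sigma) ^+ r).
Proof.
move=> /andP[s0 s1] q10; elim: r s => [|r IH] s ws cx szN Hs.
  by apply: (cond_le_trans bE (cond_le1 bE Bad ws)); rewrite expr0 lerDr.
have [h hx hs] : exists2 h : H, owner h = x & h \notin used s.
  by apply: free_half_edge ws.1 _; lia.
have [T [Tfree sT HT]] := Hs s h ws (extends_refl s) (ltac:(lia)) hs hx.
have pos : (0 < N - (size s).*2.+1)%N by apply: free_count_gt0; lia.
have -> : q1 + (1 - sigma) ^+ r.+1 =
  q1 + (1 - sigma) ^+ r - (q1 + (1 - sigma) ^+ r - q1) * sigma + 0.
  by rewrite exprS; ring.
have e0 : 0 <= (1 - sigma) ^+ r by rewrite exprn_ge0 // subr_ge0.
apply: (cond_le_examine_targets (T := T) (Z := pred0) (e := 0) (t := t) bE ws hs) => //.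
- by rewrite lerDl.
- apply: le_trans sT; rewrite ler_wpM2l // ler_nat leq_subr //.
- by rewrite !mul0r.
- move=> g b gs; rewrite mul0r addr0.
  have ws' : wf_pins ((h, g, tested t b) :: s) by apply/wf_pins_cons; split => //; exact: measurable_tested.
  case: (boolP (T g && b)) => [/andP[Tg bb]|nTb].
    rewrite bb in ws' *; apply: (cond_le_trans bE (HT g Tg ws')).
    by rewrite mulr1 opprB addrCA subrr addr0.
  rewrite mulr0 subr0; apply: IH => //.
  + have := extends_count x (extends_cons (h, g, tested t b) (extends_refl s)).
    rewrite size_pins_cons subSnn; move: cx; clear.
    by move: (count_at _ _) (count_at _ _) => c c'; lia.
  + by move: szN; rewrite size_pins_cons; clear; lia.
  + move=> s' h' ws'' ss szs; apply: Hs => //.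
      by apply: extends_trans ss; exact/extends_cons/extends_refl.
    by move: szs; rewrite size_pins_cons; clear; lia.
Qed.

Variable Zmax : nat.
Hypothesis ZmaxN : (4 * Zmax <= N)%N.

(** A lower bound sigma for the probability that an examination finds a mostly
    free target; used half-edges and their owners spoil at most the subtracted
    number of targets. *)
Definition hit_prob (Gam : pred 'I_m.+1) (t sigma : R) : Prop :=
  [/\ 0 <= sigma <= 1, sigma * N%:R <= (half_edges_at d Gam - (5 * (2 * Zmax).+1)%:R) * F t
    & forall v, Gam v -> (3 <= D v)%N].

Lemma good_target_prob Gam (t sigma : R) (s : seq pin) (h : H) : hit_prob Gam t sigma -> (size s < Zmax)%N ->
  sigma * N%:R <= #|good_target (h :: used s) Gam|%:R * F t.
Proof.
move=> [_ + _] sz; move/le_trans; apply; rewrite ler_wpM2r ?length_law_ge0 //.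
rewrite lerBlDr -natrD ler_nat; apply: leq_trans (card_good_target (h :: used s) Gam) _.
by rewrite leq_add2l leq_mul2l [size _]/= size_used -mul2n ltnS leq_mul2l ltnW.
Qed.

Lemma good_target_unspoiled Gam (t sigma : R) (s : seq pin) (h g : H) (B : set R) : hit_prob Gam t sigma ->
  good_target (h :: used s) Gam g ->
  Gam (owner g) /\ (2 * cnt ((h, g, B) :: s) (owner g) <= D (owner g))%N.
Proof.
move=> [_ _ D3] Tg.
have /and3P[_ Gg c4] : [&& g \notin h :: used s, Gam (owner g)
  & 4 * count_at (h :: used s) (owner g) < D (owner g)]%N := Tg.
split => //.
have := D3 _ Gg; move: c4; rewrite count_used_cons eqxx; lia.
Qed.

(** The tries at one vertex, whose targets are the mostly free vertices in Gam. *)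
Lemma cond_le_layer Gam (t sigma : R) a x (c : R) k r (s : seq pin) (q1 : R) : hit_prob Gam t sigma -> 0 <= q1 ->
  wf_pins s -> (size s + r <= Zmax)%N -> (4 * r <= D x)%N -> (2 * cnt s x <= D x)%N ->
  reached s a x c k ->
  (forall s' x', wf_pins s' -> extends s s' -> (size s' <= size s + r)%N -> Gam x' ->
     (2 * cnt s' x' <= D x')%N -> reached s' a x' (c + t) (k + 1) -> cond_le s' q1) ->
  cond_le s (q1 + (1 - sigma) ^+ r).
Proof.
move=> hp q10 ws szs rx cx cs Hs; have [s01 _ _] := hp.
apply: (cond_le_tries (t := t) (x := x)) => //; [by lia|by lia|].
move=> s' h ws' ss szs' hs hx; exists (good_target (h :: used s') Gam); split.
- by move=> g /= /and3P[].
- by apply: good_target_prob => //; lia.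
- move=> g Tg ws''; have [Gg ug] := good_target_unspoiled (short t) hp Tg.
  apply: (Hs _ (owner g)) => //.
  + exact: extends_cons.
  + by apply: reached_cons; rewrite hx; apply: reached_extends cs.
Qed.

(** Induction on the number j of layers that remain. *)
Lemma cond_le_layers (Gam : nat -> pred 'I_m.+1) (t sigma : nat -> R) (r : nat -> nat) a (c : R) K (q1 : R) :
  0 <= q1 -> (forall i, (i < K)%N -> hit_prob (Gam i.+1) (t i) (sigma i)) ->
  (forall i v, (i < K)%N -> Gam i v -> (4 * r i <= D v)%N) ->
  forall j x s k, (j <= K)%N -> wf_pins s -> (size s + \sum_(K - j <= i < K) r i <= Zmax)%N ->
  Gam (K - j)%N x -> (2 * cnt s x <= D x)%N ->
  reached s a x c k ->
  (forall s' x', wf_pins s' -> extends s s' ->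
     (size s' <= size s + \sum_(K - j <= i < K) r i)%N -> Gam K x' ->
     (2 * cnt s' x' <= D x')%N ->
     reached s' a x' (c + \sum_(K - j <= i < K) t i) (k + j) -> cond_le s' q1) ->
  cond_le s (q1 + \sum_(K - j <= i < K) (1 - sigma i) ^+ r i).
Proof.
move=> q10 hp Gr j; elim: j c => [|j IH] c x s k jK ws szs Gx cx cs Hs.
  move: szs Gx Hs; rewrite subn0 !big_geq // !addr0 !addn0 => szs Gx Hs.
  by apply: (Hs s x) => //; exact: extends_refl.
have jE : (K - j = (K - j.+1).+1)%N by lia.
have jlt : (K - j.+1 < K)%N by lia.
have sum0 : 0 <= \sum_(K - j <= i < K) (1 - sigma i) ^+ r i.
  rewrite big_nat_cond; apply: sumr_ge0 => i /andP[/andP[_ iK] _].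
  by rewrite exprn_ge0 // subr_ge0; have [/andP[]] := hp i iK.
rewrite (big_ltn jlt) -jE [X in _ + X]addrC addrA.
move: szs; rewrite (big_ltn jlt) -jE => szs.
apply: (cond_le_layer (Gam := Gam (K - j)%N) (t := t (K - j.+1)%N) (x := x) (a := a) (c := c) (k := k)) => //.
- by rewrite jE; apply: hp.
- by rewrite addr_ge0.
- by lia.
- exact: Gr jlt Gx.
move=> s' x' ws' ss szs' Gx' cx' cs'.
apply: (IH (c + t (K - j.+1)%N) x' s' (k + 1)%N) => //; [by lia|by lia|].
move=> s'' x'' ws'' ss' szs'' Gx'' cx'' cs''.
apply: (Hs s'' x'') => //; first exact: extends_trans ss ss'.
  by rewrite (big_ltn jlt) -jE; move: szs' szs''; clear; lia.
move: cs''; rewrite (big_ltn jlt) -jE addrA; apply: reached_le => //.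
by rewrite addnAC addn1 addnS.
Qed.

(** A non-backtracking walk: since all degrees are at least two, it can be
    continued unless it meets a used vertex or a long edge. *)
Lemma cond_le_walk Gam (t sigma eps1 : R) a (c q1 : R) : hit_prob Gam t sigma -> 0 <= t -> 0 <= q1 ->
  (forall v, 2 <= D v)%N ->
  ((2 * Zmax).+1 * 2)%:R / N%:R + (1 - F t) <= eps1 ->
  forall r x s k, wf_pins s -> (size s + r <= Zmax)%N -> (cnt s x < D x)%N -> reached s a x c k ->
  (forall s' x', wf_pins s' -> extends s s' -> (size s' <= size s + r)%N -> Gam x' ->
     (2 * cnt s' x' <= D x')%N -> reached s' a x' (c + t *+ r) (k + r) -> cond_le s' q1) ->
  cond_le s (q1 + (1 - sigma) ^+ r + eps1 *+ r).
Proof.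
move=> hp t0 q10 D2 eps1P r; have [/andP[s0 s1] _ _] := hp.
have Ft1 : 0 <= 1 - F t by rewrite subr_ge0 length_law_le1 //; exact: measurable_short.
have e10 : 0 <= eps1.
  by apply: le_trans eps1P; rewrite addr_ge0 // divr_ge0.
elim: r c => [|r IH] c x s k ws szs cx cs Hs.
  by apply: (cond_le_trans bE (cond_le1 bE Bad ws)); rewrite expr0 mulr0n addr0 lerDr.
have [h hx hs] : exists2 h : H, owner h = x & h \notin used s.
  by apply: free_half_edge ws.1 _.
have pos : (0 < N - (size s).*2.+1)%N by apply: free_count_gt0; lia.
have szZ : (size s < Zmax)%N by lia.
have N0 : (0 < N)%N by lia.
have kN : (N <= 2 * (N - (size s).*2.+1))%N by rewrite -mul2n; lia.
have e0 : 0 <= (1 - sigma) ^+ r by rewrite exprn_ge0 // subr_ge0.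
set U := h :: used s.
set q2 := q1 + (1 - sigma) ^+ r + eps1 *+ r.
have er0 : 0 <= eps1 *+ r by rewrite mulrn_wge0.
apply: (@cond_le_trans _ _ _ _ _ _ _ _ _ _ bE _ _ (q2 - (q2 - q1) * sigma + eps1)); last first.
  rewrite /q2 exprS mulrSr -subr_ge0.
  set y := (1 - sigma) ^+ r; set z := eps1 *+ r in er0 *.
  have -> : q1 + (1 - sigma) * y + (z + eps1) - (q1 + y + z - (q1 + y + z - q1) * sigma + eps1) = z * sigma by ring.
  exact: mulr_ge0.
(* e = 1: a dead end or a long edge counts as a failure of the whole search *)
apply: (cond_le_examine_targets (T := good_target U Gam) (Z := dead_end U) (e := 1) (t := t) bE ws hs) => //.
- by rewrite /q2 -addrA lerDl addr_ge0.
- by move=> g /= /and3P[].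
- apply: le_trans (good_target_prob h hp szZ).
  by rewrite ler_wpM2l // ler_nat leq_subr.
- have zc : (#|dead_end U| <= (2 * Zmax).+1)%N.
    apply: leq_trans (card_dead_end _ D2) _; first by rewrite cons_uniq hs ws.1.
    by rewrite /= size_used -mul2n ltnS leq_mul2l ltnW.
  rewrite mul1r; set k' : R := (N - _)%:R.
  have k'0 : 0 <= k' by rewrite ler0n.
  apply: (@le_trans _ _ (((2 * Zmax).+1 * 2)%:R / N%:R * k' + (1 - F t) * k')); last first.
    by rewrite -mulrDl ler_wpM2r.
  rewrite lerD2r natrM; apply: (@le_trans _ _ (2 * Zmax).+1%:R); first by rewrite ler_nat.
  rewrite -!mulrA ler_peMr // mulrA mulrAC ler_pdivlMr ?ltr0n // mul1r.
  by rewrite /k' -natrM ler_nat.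
- move=> g b gs; rewrite mul1r.
  have ws' : wf_pins ((h, g, tested t b) :: s) by apply/wf_pins_cons; split => //; exact: measurable_tested.
  have q20 : 0 <= q2 by rewrite /q2 !addr_ge0.
  case: b ws' => ws'; last first.
    apply: (cond_le_trans bE (cond_le1 bE Bad ws')); rewrite andbF mulr0 subr0 /= addrA lerDr.
    by rewrite addr_ge0.
  rewrite andbT addr0; case: (boolP (good_target U Gam g)) => Tg.
    have [Gg ug] := good_target_unspoiled (short t) hp Tg.
    apply: (@cond_le_trans _ _ _ _ _ _ _ _ _ _ bE _ _ q1); last first.
      by rewrite mulr1 opprB addrCA subrr addr0 lerDl.
    apply: (Hs _ (owner g)) => //; [exact/extends_cons/extends_refl|by rewrite size_pins_cons; clear; lia|].
    apply: reached_le (reached_cons (g := g) (t := t) (_ : reached s a (owner h) c k)).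
    + by rewrite lerD2l mulrS lerDl mulrn_wge0.
    + by rewrite leq_add2l.
    + by rewrite hx.
  rewrite mulr0 subr0; case: (boolP (dead_end U g)) => Zg.
    by apply: (cond_le_trans bE (cond_le1 bE Bad ws')); rewrite lerDr.
  rewrite addr0; apply: (IH (c + t) (owner g) _ (k + 1)%N) => //.
  + by move: szs; rewrite size_pins_cons; clear; lia.
  + by move: Zg; rewrite count_used_cons eqxx /dead_end /= gs /= -ltnNge addn1.
  + by apply: reached_cons; rewrite hx.
  + move=> s' x' ws'' ss szs' Gx' cx' cs'; apply: (Hs s' x') => //.
    * by apply: extends_trans ss; exact/extends_cons/extends_refl.
    * by move: szs'; rewrite size_pins_cons; clear; lia.
    * apply: reached_le cs'; last by clear; lia.
      by rewrite mulrS addrA.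
Qed.

End Phases.

Arguments hit_prob {R m} d {dO Omega Q} X Zmax Gam t sigma.

(** * Joining the explorations from both vertices *)

Section Connection.
Context {R : realType} {m : nat} {d : 'I_m.+1 -> nat} {dO : measure_display}
  {Omega : measurableType dO} {Q : probability Omega R} {X : {RV Q >-> R}}
  (G : weighted_cm d X).

Local Notation H := (half_edge d).
Local Notation N := #|half_edge d|.
Local Notation D := (cm_degree d).
Local Notation pin := (@pin R m d).
Local Notation cnt s v := (count_at (used s) v).
Local Notation F t := (length_law X (short t)).
Local Notation n := (m.+1%:R : R).
Local Notation mu := (wcm_prob G).

Local Notation E_u a := (matched G `&` [set w | wcm_u w = a]).
Local Notation E_uv a b := (matched G `&` [set w | wcm_u w = a /\ wcm_v w = b]).

Hypothesis D2 : forall v, (2 <= D v)%N.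

(** The second vertex may be revealed after the exploration from the first one;
    it is then unlikely to have been used up. *)
Lemma cond_le_reveal (Bad : set (wcm_space G)) a (s : seq pin) (q : R) : wf_pins s -> 0 <= q ->
  (forall b, (cnt s b < D b)%N -> cond_le (E_uv a b) (n^-1 * n^-1) Bad s q) ->
  cond_le (E_u a) n^-1 Bad s (q + (size s)%:R / n).
Proof.
move=> ws q0 Hb.
pose y (b : 'I_m.+1) := (q + (D b <= cnt s b)%:R) * (n^-1 * n^-1 * pin_weight X s).
have w0 : 0 <= n^-1 * n^-1 * pin_weight X s by rewrite !mulr_ge0 ?invr_ge0 ?pin_weight_ge0.
have n0 : n != 0 by rewrite pnatr_eq0.
have ubound : \sum_(b < m.+1) ((D b <= cnt s b)%:R : R) <= (size s)%:R.
  rewrite -natr_sum ler_nat -(leq_pmul2l (isT : 0 < 2)%N) [leqRHS]mul2n -size_used.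
  rewrite -sum_count_at big_distrr /=; apply: leq_sum => b _.
  by case: (leqP (D b)) => //= Db; rewrite muln1 (leq_trans (D2 b)).
have cover : small mu (E_u a `&` pinned G s `&` Bad) (\sum_(b < m.+1) y b).
  apply: (small_bigcup (F := fun b => E_uv a b `&` pinned G s `&` Bad)).
    by move=> w [[[Mw ua] evs] Bw]; exists (wcm_v w).
  move=> b _; rewrite /y; case: (leqP (D b) (cnt s b)) => Db /=.
    apply: small_le (cond_le1 (product_event_uv G a b) Bad ws); first exact: subset_refl.
    by rewrite ler_wpM2r // lerDr.
  by rewrite addr0; exact: Hb.
apply: small_le cover; first exact: subset_refl.
rewrite /y -mulr_suml big_split /= sumr_const card_ord -[X in X + _]mulr_natl.
apply: (@le_trans _ _ ((n * q + (size s)%:R) * (n^-1 * n^-1 * pin_weight X s))).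
  by rewrite ler_wpM2r // lerD2l.
by move: (n) n0 => x x0; apply/eq_ler; field.
Qed.

Variables (Zmax : nat) (Gam : nat -> pred 'I_m.+1) (t sigma : nat -> R) (r : nat -> nat)
  (K R0 : nat) (t0 sigma0 eps1 : R).
Hypotheses (ZmaxN : (4 * Zmax <= N)%N) (t00 : 0 <= t0)
  (hit0 : hit_prob d X Zmax (Gam 0%N) t0 sigma0)
  (hit : forall i, (i < K)%N -> hit_prob d X Zmax (Gam i.+1) (t i) (sigma i))
  (deg : forall i v, (i < K)%N -> Gam i v -> (4 * r i <= D v)%N)
  (eps1P : ((2 * Zmax).+1 * 2)%:R / N%:R + (1 - F t0) <= eps1).

Definition side_failure : R :=
  (1 - sigma0) ^+ R0 + eps1 *+ R0 + \sum_(0 <= i < K) (1 - sigma i) ^+ r i.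

Definition side_length : R := t0 *+ R0 + \sum_(0 <= i < K) t i.

Lemma layers_failure_ge0 : 0 <= \sum_(0 <= i < K) (1 - sigma i) ^+ r i.
Proof.
rewrite big_nat_cond; apply: sumr_ge0 => i /andP[/andP[_ iK] _].
by rewrite exprn_ge0 // subr_ge0; have [/andP[]] := hit iK.
Qed.

Lemma side_failure_ge0 : 0 <= side_failure.
Proof.
have [/andP[s0 s1] _ _] := hit0.
rewrite !addr_ge0 ?layers_failure_ge0 ?exprn_ge0 ?subr_ge0 // mulrn_wge0 //.
apply: le_trans eps1P; rewrite addr_ge0 ?divr_ge0 // subr_ge0 length_law_le1 //.
exact: measurable_short.
Qed.

(** The walk phase reaches the first layer, and the climb starts from there. *)
Lemma cond_le_side E p (bE : product_event (G := G) E p) (Bad : set (wcm_space G)) a (s : seq pin) (q : R) :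
  0 <= q -> wf_pins s -> (size s + R0 + \sum_(0 <= i < K) r i <= Zmax)%N -> (cnt s a < D a)%N ->
  (forall s' x, wf_pins s' -> extends s s' ->
     (size s' <= size s + R0 + \sum_(0 <= i < K) r i)%N -> Gam K x ->
     (2 * cnt s' x <= D x)%N -> reached E s' a x side_length (R0 + K) -> cond_le E p Bad s' q) ->
  cond_le E p Bad s (q + side_failure).
Proof.
move=> q0 ws szs ca Hs.
have -> : q + side_failure =
  (q + \sum_(0 <= i < K) (1 - sigma i) ^+ r i) + (1 - sigma0) ^+ R0 + eps1 *+ R0.
  by rewrite /side_failure; ring.
apply: (@cond_le_walk _ _ _ _ _ _ _ G E p bE Bad Zmax ZmaxN (Gam 0%N) t0 sigma0 eps1 a 0
  (q + \sum_(0 <= i < K) (1 - sigma i) ^+ r i) hit0 t00 _ D2 eps1P R0 a s 0%N ws) => //.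
- by rewrite addr_ge0 // layers_failure_ge0.
- by move: szs; clear; lia.
- by move=> w _ _; exact: reach_refl.
move=> s' x' ws' ss szs' Gx' cx' cs'.
have := @cond_le_layers _ _ _ _ _ _ _ G E p bE Bad Zmax ZmaxN Gam t sigma r a
  (0 + t0 *+ R0) K q q0 hit deg K x' s' (0 + R0) (leqnn K) ws'.
rewrite subnn; apply => //; first by move: szs szs'; clear; lia.
move=> s'' x'' ws'' ss' szs'' Gx'' cx'' cs''; apply: (Hs s'' x'') => //.
- exact: extends_trans ss ss'.
- by move: szs' szs''; clear; lia.
- by move: cs''; rewrite add0r add0n.
Qed.

Variables (rf : nat) (tf sigmaf : R).
Hypotheses (ZN : (4 * (Zmax + rf) <= N)%N) (sigmaf01 : 0 <= sigmaf <= 1)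
  (lastdeg : forall v, Gam K v -> (8 * (Zmax + rf) + 4 <= D v)%N)
  (lasthit : forall v, Gam K v -> sigmaf * N%:R * 4 <= (D v)%:R * F tf).

(** Half-edges of y are tried. A quarter of the half-edges of x remain free
    meanwhile, and pairing with any of them by a short edge joins both sides. *)
Lemma cond_le_join a b (s : seq pin) x y : wf_pins s -> (size s <= Zmax)%N ->
  Gam K x -> Gam K y -> (2 * cnt s y <= D y)%N ->
  (4 * cnt s x <= 2 * D x + 4 * (2 * Zmax))%N ->
  reached (E_uv a b) s a x side_length (R0 + K) ->
  reached (E_uv a b) s b y side_length (R0 + K) ->
  cond_le (E_uv a b) (n^-1 * n^-1)
    [set w | ~ reach (wcm_matching w) (wcm_len_at w) (wcm_u w) (wcm_v w)
        (2 * side_length + tf) (2 * (R0 + K) + 1)] s ((1 - sigmaf) ^+ rf).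
Proof.
move=> ws szs Gx Gy cy cx cax cby.
have Dx := lastdeg Gx; have Dy := lastdeg Gy.
have -> : (1 - sigmaf) ^+ rf = 0 + (1 - sigmaf) ^+ rf by rewrite add0r.
apply: (cond_le_tries (t := tf) (x := y) (product_event_uv G a b)) => //.
- by move: cy Dy; clear; move: (count_at _ _) (D y) => c e; lia.
- by move: ZN szs; clear; move: N (size s) => k l; lia.
move=> s' h ws' ss szs' hs hy.
exists [pred g : H | g \notin h :: used s' & owner g == x]; split.
- by move=> g /= /andP[].
- have uU : uniq (h :: used s') by rewrite cons_uniq hs ws'.1.
  have cE := card_free_at x uU.
  have cs' := extends_count x ss.
  have c1 : (count_at (h :: used s') x <= cnt s' x + 1)%N.
    by rewrite /count_at /= addnC leq_add2l leq_b1.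
  have T4 : (D x <= 4 * #|[pred g : H | g \notin h :: used s' & owner g == x]|)%N.
    move: cE cs' c1 cx Dx szs szs'; clear.
    move: (count_at (h :: used s') x) (cnt s' x) (cnt s x) (D x) => c2 c3 c4 c5.
    by move: #|_| (size s) (size s') => k l l'; lia.
  have := lasthit Gx; rewrite -ler_pdivlMr // => /le_trans; apply.
  rewrite mulrAC ler_wpM2r ?length_law_ge0 // ler_pdivrMr // -natrM ler_nat mulnC //.
- move=> g /= /andP[_ /eqP gx] ws''; apply: cond_le0 => w Ew evs; apply.
  have Ew' := Ew; case: Ew' => Mw [-> ->].
  have evs' : pinned G s w by apply: extends_pinned (extends_cons _ ss) evs.
  have yx : reached (E_uv a b) ((h, g, short tf) :: s') b x (side_length + tf) (R0 + K + 1).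
    by rewrite -gx; apply: reached_cons; rewrite hy; apply: reached_extends cby.
  have r1 := cax w Ew evs'; have r2 := reach_sym Mw (yx w Ew evs).
  apply: reach_le (reach_trans r1 r2).
  + by rewrite addrA -mulr2n mulr_natl.
  + by rewrite addnA mul2n -addnn.
Qed.

(** The exploration starts from the first vertex; then the second one is
    revealed and explored, and the last vertices of both sides are joined. *)
Lemma small_not_reached :
  (2 * (R0 + \sum_(0 <= i < K) r i) <= Zmax)%N ->
  small mu (matched G `&` [set w |
     ~ reach (wcm_matching w) (wcm_len_at w) (wcm_u w) (wcm_v w)
        (2 * side_length + tf) (2 * (R0 + K) + 1)])
    (2 * side_failure + Zmax%:R / n + (1 - sigmaf) ^+ rf).
Proof.
move=> szZ; set Bad := [set w | ~ _].
have n0 : n != 0 by rewrite pnatr_eq0.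
have [/andP[sf0 sf1]] := conj sigmaf01 isT => _.
have f0 : 0 <= (1 - sigmaf) ^+ rf by rewrite exprn_ge0 // subr_ge0.
set q := 2 * side_failure + _ + _.
have wf0 : wf_pins ([::] : seq pin) by [].
apply: (@small_le _ _ _ _ _ _ (\sum_(a < m.+1) (q * n^-1))); [exact: subset_refl| |].
  rewrite sumr_const card_ord -[leLHS]mulr_natl.
  by move: (n) n0 => x x0; apply/eq_ler; field.
apply: (small_bigcup (F := fun a => E_u a `&` pinned G ([::] : seq pin) `&` Bad)).
  by move=> w [Mw Bw]; exists (wcm_u w).
move=> a _.
have -> : q * n^-1 = q * (n^-1 * pin_weight X ([::] : seq pin)) by rewrite /= mulr1.
have qE : q = (Zmax%:R / n + side_failure + (1 - sigmaf) ^+ rf) + side_failure.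
  by rewrite /q; ring.
rewrite qE; apply: (cond_le_side (product_event_u G a) (a := a)) => //.
- by apply: addr_ge0 f0; apply: addr_ge0 side_failure_ge0; exact: divr_ge0.
- by rewrite add0n; move: szZ; clear; lia.
- exact: leq_trans (D2 a).
move=> s' x ws' ss' szs' Gx cx cax.
rewrite add0n in szs'.
have szZ' : (size s' <= Zmax)%N by move: szs' szZ; clear; lia.
apply: (@cond_le_trans _ _ _ _ _ _ _ _ _ _ (product_event_u G a) _ _
    (((1 - sigmaf) ^+ rf + side_failure) + (size s')%:R / n)); last first.
  have : (size s')%:R / n <= Zmax%:R / n by rewrite ler_wpM2r ?invr_ge0 // ler_nat.
  by move: (_ / n) (Zmax%:R / n) => u v; lra.
apply: cond_le_reveal => //; first exact: addr_ge0 f0 side_failure_ge0.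
move=> b cb; apply: (cond_le_side (product_event_uv G a b) (a := b)) => //.
  by move: szs' szZ; clear; lia.
move=> s'' y ws'' ss'' szs'' Gy cy cby.
have EE : forall w, E_uv a b w -> E_u a w by move=> w [Mw [ua _]].
apply: (@cond_le_trans _ _ _ _ _ _ _ _ _ _ (product_event_uv G a b) _ _ ((1 - sigmaf) ^+ rf)) => //.
apply: (cond_le_join (x := x) (y := y)) => //.
- by move: szs'' szs' szZ; clear; lia.
- have := extends_count x ss''; move: cx szs'' szs' szZ; clear.
  by move: (count_at _ _) (count_at _ _) (D x) => c1 c2 c3; lia.
- by apply: (reached_extends ss'') => w Ew; apply: cax; exact: EE.
Qed.

End Connection.

(** * Paths as walk events *)

Section Reversal.
Context {R : realType} {m : nat} {d : 'I_m.+1 -> nat}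
  (M : {ffun half_edge d -> half_edge d}) (len : {set half_edge d} -> R).
Hypothesis invM : M \in perfect_matchings d.
Local Notation H := (half_edge d).

Definition vertices (p : seq H) : seq 'I_m.+1 := [seq owner (M h) | h <- p].

Let MK h : M (M h) = h.
Proof. by have /involutionsP/(_ h)[] : M \in involutions H by []. Qed.

Lemma vertices_rev a b p : is_walk M a b p ->
  b :: vertices (rev (map M p)) = rev (a :: vertices p).
Proof.
elim: p a => [|h p IH] a /=; first by move=> /eqP ->.
move=> /andP[/eqP ha /IH E].
rewrite [RHS]rev_cons -E.
by rewrite /vertices /= rev_cons map_rcons /= MK ha.
Qed.

Lemma is_path_rev a b p : is_path M a b p -> is_path M b a (rev (map M p)).
Proof.
move=> /andP[wp up]; rewrite /is_path is_walk_rev //=.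
by move: up; rewrite -(rev_uniq (a :: _)) -(vertices_rev wp).
Qed.

Lemma vertex_rev a b p x l : is_walk M a b p -> (l <= size p)%N ->
  nth x (b :: vertices (rev (map M p))) l = nth x (a :: vertices p) (size p - l).
Proof.
move=> wp lp; by rewrite (vertices_rev wp) nth_rev /= size_map.
Qed.

End Reversal.

Section PathWalks.
Context {R : realType} {m : nat} {d : 'I_m.+1 -> nat} {dO : measure_display}
  {Omega : measurableType dO} {Q : probability Omega R} {X : {RV Q >-> R}}
  (G : weighted_cm d X).

Local Notation H := (half_edge d).
Local Notation N := #|half_edge d|.
Local Notation D := (cm_degree d).
Local Notation n := (m.+1%:R : R).
Local Notation mu := (wcm_prob G).

(** The vertices of a path are distinct, so that each step leaves through a
    half-edge not used before. *)
Lemma walks_of_path (w : wcm_space G) (M := wcm_matching w) (B : set R) h0 :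
  M \in perfect_matchings d ->
  forall p x y U cs, is_walk M x y p -> uniq (x :: vertices M p) ->
  (forall g, g \in U -> M g \in U) ->
  (forall g, g \in U -> owner g \notin vertices M p) ->
  (size cs <= size p)%N ->
  (forall j, (j < size cs)%N -> nth xpredT cs j (nth x (vertices M p) j)) ->
  (cs != [::] -> B (wcm_len_at w (edge_of M (nth h0 p (size cs).-1)))) ->
  walks (G := G) B U x cs w.
Proof.
move=> invM; have MK h : M (M h) = h.
  by have /involutionsP/(_ h)[] : M \in involutions H by [].
elim=> [|h p IH] x y U [|c cs] //= /andP[/eqP hx wp] /andP[xp up] clU disU sz cj Bl.
exists h; have MhU : M h \notin U.
  by apply: contraTN isT => /disU; rewrite inE eqxx.
have hU : h \notin U by apply: contra MhU; exact: clU.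
split => //.
- exact: (cj 0%N).
- by case: (cs) Bl => [|c' cs'] Bl //; exact: Bl.
apply: (IH _ y) => //.
- move=> g; rewrite !inE => /or3P[/eqP ->|/eqP ->|/clU ->]; last by rewrite !orbT.
    by rewrite eqxx orbT.
  by rewrite MK eqxx.
- move=> g; rewrite !inE => /or3P[/eqP ->|/eqP ->|/disU].
  + by rewrite hx; move: xp; rewrite inE negb_or => /andP[].
  + by case/andP: up.
  + by rewrite inE negb_or => /andP[].
- move=> j jlt; have := cj j.+1 jlt; rewrite /= (set_nth_default (owner (M h))) //.
  by rewrite size_map; apply: leq_trans jlt _; rewrite -ltnS.
- by case: (cs) Bl => [|c' cs'].
Qed.

Lemma walk_bound_rcons (B : set R) cs c :
  walk_bound d X B (rcons cs c) =
  (\prod_(c' <- cs) (2 / N%:R * pairs_at d c')) * (2 / N%:R * (half_edges_at d c * length_law X B)).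
Proof.
elim: cs => [|c' cs IH]; first by rewrite big_nil /= mul1r.
rewrite big_cons rcons_cons /= -/(walk_bound d X B (rcons cs c)) IH.
by case: (cs) => [|? ?] /=; rewrite -!mulrA.
Qed.

Local Notation E_u a := (matched G `&` [set w | wcm_u w = a]).
Local Notation E_uv a b := (matched G `&` [set w | wcm_u w = a /\ wcm_v w = b]).

(** Averaging the starting degree over the vertices gives the factor N / n. *)
Lemma small_walks_uniform (U : wcm_space G -> 'I_m.+1) (B : set R) cs :
  (forall a, product_event (G := G) (matched G `&` [set w | U w = a]) n^-1) ->
  measurable B -> cs != [::] -> (4 * size cs <= N)%N ->
  small mu (matched G `&` [set w | walks B [::] (U w) cs w])
    (N%:R / n * walk_bound d X B cs).
Proof.
move=> bU mB cs0 szN.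
apply: (@small_le _ _ _ _ _ _ (\sum_(a < m.+1) (n^-1 * 1 * (D a)%:R * walk_bound d X B cs)));
  [exact: subset_refl| |].
  rewrite -mulr_suml ler_wpM2r ?walk_bound_ge0 // -mulr_sumr mulr1 mulrC.
  by rewrite ler_wpM2r ?invr_ge0 // -natr_sum card_half_edge.
apply: (small_bigcup (F := fun a => matched G `&` [set w | U w = a] `&` pinned G [::] `&`
    walks B (used [::]) a cs)).
  by move=> w [Mw wk]; exists (U w).
by move=> a _; apply: small_walks.
Qed.

(** Summing over both endpoints replaces each of their degrees by N. *)
Lemma small_walks_between (cs : seq (pred 'I_m.+1)) : (4 * (size cs).+1 <= N)%N -> (0 < N)%N ->
  small mu (matched G `&` [set w | walks setT [::] (wcm_u w) (rcons cs (pred1 (wcm_v w))) w])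
    (N%:R / n * n^-1 * (\prod_(c <- cs) (2 / N%:R * pairs_at d c)) * 2).
Proof.
move=> szN N0.
have NR : (N%:R : R) != 0 by rewrite pnatr_eq0 -lt0n.
apply: (@small_le _ _ _ _ _ _ (\sum_(a < m.+1) \sum_(b < m.+1)
   (n^-1 * n^-1 * 1 * (D a)%:R * walk_bound d X setT (rcons cs (pred1 b)))));
  [exact: subset_refl| |].
  have wE b : walk_bound d X setT (rcons cs (pred1 b)) =
     (\prod_(c <- cs) (2 / N%:R * pairs_at d c)) * (2 / N%:R) * (D b)%:R.
    have hb : half_edges_at d (pred1 b) = (D b)%:R :> R.
      by rewrite /half_edges_at -card_owner; congr (_%:R); apply: eq_card => h; rewrite !inE.
    by rewrite walk_bound_rcons length_law_setT mulr1 hb mulrA.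
  have sD : \sum_(b < m.+1) (D b)%:R = N%:R :> R by rewrite -natr_sum card_half_edge.
  set W := _ * (2 / N%:R) in wE.
  rewrite (eq_bigr (fun a => n^-1 * n^-1 * (D a)%:R * (W * N%:R))); last first.
    move=> a _; rewrite -sD mulr_sumr mulr_sumr; apply: eq_bigr => b _.
    by rewrite wE; ring.
  rewrite -mulr_suml -mulr_sumr sD /W; apply/eq_ler.
  have : n != 0 by rewrite pnatr_eq0.
  by move: (n) => x x0; field; rewrite x0 NR.
apply: (small_bigcup (F := fun a => matched G `&` [set w | wcm_u w = a] `&`
   [set w | walks setT [::] (wcm_u w) (rcons cs (pred1 (wcm_v w))) w])).
  by move=> w [Mw wk]; exists (wcm_u w).
move=> a _.
apply: (small_bigcup (F := fun b => E_uv a b `&` pinned G [::] `&`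
    walks setT (used [::]) a (rcons cs (pred1 b)))).
  move=> w [[Mw ua] wk]; exists (wcm_v w) => //; split; last by rewrite -ua.
  by split.
move=> b _; apply: small_walks => //; first exact: product_event_uv.
- by case: (cs).
- by rewrite size_rcons.
Qed.

Hypothesis nonneg : length_law X `]-oo, 0[%classic = 0.

(** A union bound over the finitely many possible edges. *)
Lemma small_negative_length :
  small mu (matched G `&` [set w | exists h, wcm_len_at w (edge_of (wcm_matching w) h) < 0]) 0.
Proof.
apply: (@small_le _ _ _ _ _ _ (\sum_(i : H * H | i.1 != i.2) (0 : R)));
  [exact: subset_refl|by rewrite big1|].
apply: (small_bigcup (F := fun i => matched G `&` pinned G [:: (i.1, i.2, `]-oo, (0 : R)[%classic)])).
  move=> w [Mw [h lh]]; exists (h, wcm_matching w h) => /=.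
    by have /involutionsP/(_ h)[/eqP] : wcm_matching w \in involutions H by [];
      rewrite eq_sym.
  split => //; split => //; split => //=; by rewrite in_itv.
move=> [h g] /= hg; have [_ _ /(_ [:: (h, g, `]-oo, (0 : R)[%classic)])] := product_event_matched G.
rewrite /= nonneg !mul0r mulr0; apply; apply/wf_pins_cons; split => //.
by rewrite inE eq_sym.
Qed.

End PathWalks.

(** * Degree profiles that separate two vertices *)

Section Separation.
Context {R : realType} {m : nat} {d : 'I_m.+1 -> nat} {dO : measure_display}
  {Omega : measurableType dO} {Q : probability Omega R} {X : {RV Q >-> R}}
  (G : weighted_cm d X).

Local Notation H := (half_edge d).
Local Notation N := #|half_edge d|.
Local Notation D := (cm_degree d).
Local Notation n := (m.+1%:R : R).
Local Notation mu := (wcm_prob G).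

Variables (b ell : nat -> R) (K : nat).

Definition low j : pred 'I_m.+1 := [pred v | (D v)%:R <= b j].
Definition high j : pred 'I_m.+1 := [pred v | b j < (D v)%:R].

Definition low_upto i : seq (pred 'I_m.+1) := mkseq (fun j => low j.+1) i.-1.

(** A path of s edges read from both ends: its l-th vertex is restricted by the
    profile of the nearer end. *)
Definition low_both s : seq (pred 'I_m.+1) :=
  mkseq (fun l => low (minn l.+1 (s - l.+1))) s.-1.

(** The profile is first exceeded at distance i. *)
Definition escape i (x : 'I_m.+1) (w : wcm_space G) : Prop :=
  if i is 0 then high 0 x else walks setT [::] x (rcons (low_upto i) (high i)) w.

(** The profile holds, but the i-th edge is too short. *)
Definition quick i (x : 'I_m.+1) (w : wcm_space G) : Prop :=
  walks `]-oo, ell i[%classic [::] x (rcons (low_upto i) predT) w.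

Definition meet s (w : wcm_space G) : Prop :=
  walks setT [::] (wcm_u w) (rcons (low_both s) (pred1 (wcm_v w))) w.

Lemma size_low_upto i : size (low_upto i.+1) = i.
Proof. by rewrite size_mkseq. Qed.

(** The first vertex that exceeds the profile would end an escape. *)
Lemma path_low_degrees w x y p : w \in matched G -> is_path (wcm_matching w) x y p ->
  (forall i, (i <= K)%N -> ~ escape i x w) ->
  forall l, (l <= size p)%N -> (l <= K)%N -> low l (nth x (x :: vertices (wcm_matching w) p) l).
Proof.
rewrite inE => Mw /andP[wp up] nesc l; have [k kl] := ubnP l.
elim: k l kl => // k IH [|l] kl lp lK /=.
  by have := nesc 0%N (leq0n _); rewrite /= => /negP; rewrite -leNgt.
apply: contraPT isT => hl _; apply: (nesc l.+1 lK).
have p0 : (0 < size p)%N by apply: leq_trans lp.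
have [h0 _] : exists h : H, h \in p by case: (p) p0 => // h q _; exists h; rewrite mem_head.
apply: (walks_of_path (h0 := h0) Mw wp up) => //.
  by rewrite size_rcons size_low_upto.
move=> j; rewrite size_rcons size_low_upto ltnS => jl.
rewrite nth_rcons size_low_upto; case: ltngtP jl => // jl _.
  rewrite nth_mkseq //.
  by apply: (IH j.+1); move: jl kl lp lK; move: (size p); clear; lia.
by rewrite jl /high /= ltNge.
Qed.

Lemma path_edge_lengths w x y p h0 : w \in matched G -> is_path (wcm_matching w) x y p ->
  (forall i, (i <= K)%N -> ~ escape i x w) -> (forall i, (0 < i <= K)%N -> ~ quick i x w) ->
  forall l, (l < size p)%N -> (l < K)%N ->
  ell l.+1 <= wcm_len_at w (edge_of (wcm_matching w) (nth h0 p l)).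
Proof.
move=> Mw pp nesc nq l lp lK; have low_p := path_low_degrees Mw pp nesc.
have /andP[wp up] := pp; rewrite inE in Mw.
rewrite leNgt; apply/negP => short_l; apply: (nq l.+1) => //.
apply: (walks_of_path (h0 := h0) Mw wp up) => //.
- by rewrite size_rcons size_low_upto.
- move=> j; rewrite size_rcons size_low_upto ltnS => jl.
  rewrite nth_rcons size_low_upto; case: ltngtP jl => // jl _.
  rewrite nth_mkseq //.
  by apply: (low_p j.+1); move: jl lp lK; move: (size p); clear; lia.
- by rewrite size_rcons size_low_upto /= in_itv.
Qed.

Lemma path_length_take (w : wcm_space G) (p : seq H) h0 : (K <= size p)%N ->
  (forall l, (l < K)%N -> ell l.+1 <= wcm_len_at w (edge_of (wcm_matching w) (nth h0 p l))) ->
  \sum_(1 <= i < K.+1) ell i <= path_length (wcm_matching w) (wcm_len_at w) (take K p).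
Proof.
move=> Kp lenp; rewrite /path_length (big_nth h0) size_takel // big_add1 /=.
rewrite [leLHS]big_seq_cond [leRHS]big_seq_cond; apply: ler_sum => i.
by rewrite mem_index_iota andbT => /andP[_ iK]; rewrite nth_take //; exact: lenp.
Qed.

(** The first K edges at each end lie within the profile of that end, hence are at
    least as long as the ell_i, and the two ends do not overlap: a path with at
    most 2 K edges would be a meeting. *)
Lemma path_far w : w \in matched G -> wcm_u w <> wcm_v w ->
  (forall h, 0 <= wcm_len_at w (edge_of (wcm_matching w) h)) ->
  (forall i, (i <= K)%N -> ~ escape i (wcm_u w) w) ->
  (forall i, (i <= K)%N -> ~ escape i (wcm_v w) w) ->
  (forall i, (0 < i <= K)%N -> ~ quick i (wcm_u w) w) ->
  (forall i, (0 < i <= K)%N -> ~ quick i (wcm_v w) w) ->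
  (forall s, (0 < s <= 2 * K)%N -> ~ meet s w) ->
  forall p, wcm_is_path w p ->
  (2 * K < size p)%N /\ 2 * \sum_(1 <= i < K.+1) ell i <= wcm_path_length w p.
Proof.
move=> Mw uv len0 eu ev' qu qv nm p pp.
set M := wcm_matching w in pp *.
have Mw' : M \in perfect_matchings d by move: Mw; rewrite inE.
have pr := is_path_rev Mw' pp.
have lowu := path_low_degrees Mw pp eu.
have lowv := path_low_degrees Mw pr ev'.
have szr : size (rev (map M p)) = size p by rewrite size_rev size_map.
have /andP[wp up] := pp.
have size_p : (2 * K < size p)%N.
  rewrite ltnNge; apply/negP => sK; case: (posnP (size p)) => [/size0nil p0|p0].
    by apply: uv; move: wp; rewrite p0 /= => /eqP.
  (* a path with few edges is a walk within both profiles *)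
  apply: (nm (size p)); first by rewrite p0.
  have [h0 _] : exists h : H, h \in p by case: (p) p0 => // h q _; exists h; rewrite mem_head.
  apply: (walks_of_path (h0 := h0) Mw' wp up) => //.
    by rewrite size_rcons size_mkseq prednK.
  move=> j; rewrite size_rcons size_mkseq prednK // => jp.
  rewrite nth_rcons size_mkseq; case: ltngtP => [jlt|jgt|jE].
  - rewrite nth_mkseq //; case: (leqP (size p - j.+1) j.+1) => js.
      have := lowv (size p - j.+1)%N; rewrite (vertex_rev Mw' _ wp); last first.
        by rewrite leq_subr.
      rewrite subKn // szr leq_subr (set_nth_default (wcm_u w)) /= ?size_map //.
      apply => //.
      by move: sK js; move: (size p); clear; lia.
    by apply: (lowu j.+1 jp); move: sK js; move: (size p); clear; lia.
  - by move: jgt jp; move: (size p); clear; lia.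
  - have := vertex_rev Mw' (wcm_u w) wp (leq0n _); rewrite subn0 /= => ->.
    by rewrite jE -[in X in _ == X](prednK p0).
split => //; set L := \sum_(_ <= _ < _) _.
have [h0 _] : exists h : H, h \in p.
  by case: (p) size_p => // h q _; exists h; rewrite mem_head.
have lenu := path_edge_lengths h0 Mw pp eu qu.
have lenv := path_edge_lengths h0 Mw pr ev' qv.
have Kp : (K <= size p)%N by move: size_p; move: (size p); clear; lia.
have Kd : (K <= size (drop K p))%N by rewrite size_drop; move: size_p; move: (size p); clear; lia.
have pos q : 0 <= path_length M (wcm_len_at w) q by apply: sumr_ge0.
have l1 : L <= path_length M (wcm_len_at w) (take K p).
  by apply: (path_length_take (h0 := h0)) => // l lK; apply: lenu => //; apply: leq_trans Kp.
have l2 : L <= path_length M (wcm_len_at w) (take K (rev (map M p))).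
  apply: (path_length_take (h0 := h0)); rewrite ?szr // => l lK; apply: lenv => //.
  by rewrite szr; apply: leq_trans Kp.
rewrite /wcm_path_length -/M -(cat_take_drop K p) path_length_cat mulr_natl mulr2n.
apply: lerD l1 (le_trans l2 _).
rewrite -(path_length_rev _ Mw' (drop K p)) -{1}(cat_take_drop K p) map_cat rev_cat.
rewrite takel_cat ?size_rev ?size_map //.
rewrite -[in leRHS](cat_take_drop K (rev (map M (drop K p)))) path_length_cat.
by rewrite lerDl.
Qed.

End Separation.

Arguments low {R m} d b j.
Arguments high {R m} d b j.
Arguments low_upto {R m} d b i.
Arguments low_both {R m} d b s.
Arguments escape {R m d dO Omega Q X} G b i x w.
Arguments quick {R m d dO Omega Q X} G b ell i x w.
Arguments meet {R m d dO Omega Q X} G b s w.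

Section SeparationProbability.
Context {R : realType} {m : nat} {d : 'I_m.+1 -> nat} {dO : measure_display}
  {Omega : measurableType dO} {Q : probability Omega R} {X : {RV Q >-> R}}
  (G : weighted_cm d X).

Local Notation H := (half_edge d).
Local Notation N := #|half_edge d|.
Local Notation D := (cm_degree d).
Local Notation n := (m.+1%:R : R).
Local Notation mu := (wcm_prob G).

Variables (b ell : nat -> R) (K : nat).
Hypotheses (KN : (4 * (2 * K).+1 <= N)%N) (D1 : forall v, (1 <= D v)%N)
  (nonneg : length_law X `]-oo, 0[%classic = 0).

(** The expected number of continuations of a walk through the layer j. *)
Definition growth j : R := 2 / N%:R * pairs_at d (low d b j).
(** The expected number of ways for a step to exceed the profile. *)
Definition excess j : R := 2 / N%:R * half_edges_at d (high d b j).

Let N_gt0 : (0 < N)%N.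
Proof. by move: KN; clear; lia. Qed.

Lemma small_escape0 (U : wcm_space G -> 'I_m.+1) :
  (forall a, product_event (G := G) (matched G `&` [set w | U w = a]) n^-1) ->
  small mu (matched G `&` [set w | escape G b 0 (U w) w]) (N%:R / n * excess 0).
Proof.
move=> bU.
apply: (@small_le _ _ _ _ _ _ (\sum_(a < m.+1 | high d b 0 a) n^-1)); [exact: subset_refl| |].
  rewrite sumr_const_pred /excess.
  have NR : (N%:R : R) != 0 by rewrite pnatr_eq0 -lt0n.
  have n0 : n != 0 by rewrite pnatr_eq0.
  have -> : N%:R / n * (2 / N%:R * half_edges_at d (high d b 0)) =
    2 * half_edges_at d (high d b 0) / n.
    by move: (n) n0 => x x0; field; rewrite x0 NR.
  rewrite ler_wpM2r ?invr_ge0 //.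
  apply: (@le_trans _ _ (half_edges_at d (high d b 0))); last by rewrite mulr_natl mulr2n lerDl.
  rewrite ler_nat [leqRHS]card_by_owner -sum1_card big_mkcond /=; apply: leq_sum => v _.
  rewrite unfold_in; case: ifP => // hv; apply: leq_trans (D1 v) _.
  rewrite -card_owner; apply/subset_leq_card/fintype.subsetP => h; rewrite !inE.
  by move=> /eqP ->; rewrite eqxx andbT.
apply: (small_bigcup (F := fun a => matched G `&` [set w | U w = a] `&` pinned G [::])).
  by move=> w [Mw esc]; exists (U w).
move=> a _; have [_ _ /(_ [::])] := bU a; rewrite /= mulr1; exact.
Qed.

Lemma small_escape (U : wcm_space G -> 'I_m.+1) i :
  (forall a, product_event (G := G) (matched G `&` [set w | U w = a]) n^-1) ->
  (0 < i <= K)%N ->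
  small mu (matched G `&` [set w | escape G b i (U w) w])
    (N%:R / n * ((\prod_(1 <= j < i) growth j) * excess i)).
Proof.
case: i => // i bU /= iK.
have := small_walks_uniform bU (measurableT : measurable (setT : set R))
  (_ : rcons (low_upto d b i.+1) (high d b i.+1) != [::]).
rewrite walk_bound_rcons length_law_setT mulr1 big_map big_add1 /= /index_iota subn0; apply.
  by case: (low_upto _ _ _).
by apply: leq_trans KN; rewrite size_rcons size_low_upto; move: iK; clear; lia.
Qed.

Lemma small_quick (U : wcm_space G -> 'I_m.+1) i :
  (forall a, product_event (G := G) (matched G `&` [set w | U w = a]) n^-1) ->
  (0 < i <= K)%N ->
  small mu (matched G `&` [set w | quick G b ell i (U w) w])
    (N%:R / n * ((\prod_(1 <= j < i) growth j) * (2 * length_law X `]-oo, ell i[%classic))).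
Proof.
case: i => // i bU /= iK.
have mB : measurable (`]-oo, ell i.+1[%classic : set R) by exact: measurable_itv.
have := small_walks_uniform bU mB (_ : rcons (low_upto d b i.+1) predT != [::]).
have NR : (N%:R : R) != 0 by rewrite pnatr_eq0 -lt0n.
have -> : walk_bound d X `]-oo, ell i.+1[%classic (rcons (low_upto d b i.+1) predT) =
  (\prod_(1 <= j < i.+1) growth j) * (2 * length_law X `]-oo, ell i.+1[%classic).
  rewrite walk_bound_rcons big_map big_add1 /= /index_iota subn0; congr (_ * _).
  have -> : half_edges_at d predT = N%:R :> R.
    by rewrite /half_edges_at; congr (_%:R); apply: eq_card => h; rewrite !inE.
  by field.
apply; first by case: (low_upto _ _ _).
by apply: leq_trans KN; rewrite size_rcons size_low_upto; move: iK; clear; lia.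
Qed.

Lemma small_meet s : (0 < s <= 2 * K)%N ->
  small mu (matched G `&` [set w | meet G b s w])
    (N%:R / n * n^-1 * (\prod_(1 <= l < s) growth (minn l (s - l))) * 2).
Proof.
case: s => // s /= sK.
have := @small_walks_between _ _ _ _ _ _ _ G (low_both d b s.+1).
rewrite big_map big_add1 /= /index_iota subn0; apply => //.
by apply: leq_trans KN; rewrite size_mkseq; move: sK; clear; lia.
Qed.

Lemma small_same : small mu (matched G `&` [set w | wcm_u w = wcm_v w]) n^-1.
Proof.
apply: (@small_le _ _ _ _ _ _ (\sum_(a < m.+1) (n^-1 * n^-1))); [exact: subset_refl| |].
  rewrite sumr_const card_ord -[leLHS]mulr_natl; apply/eq_ler.
  have : n != 0 by rewrite pnatr_eq0.
  by move: (n) => x x0; field.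
apply: (small_bigcup (F := fun a => matched G `&` [set w | wcm_u w = a /\ wcm_v w = a] `&` pinned G [::])).
  by move=> w [Mw uv]; exists (wcm_u w).
move=> a _; have [_ _ /(_ [::])] := product_event_uv G a a; rewrite /= mulr1; exact.
Qed.

Definition side_bound : R :=
  N%:R / n * (excess 0 + \sum_(1 <= i < K.+1)
    (\prod_(1 <= j < i) growth j) * (excess i + 2 * length_law X `]-oo, ell i[%classic)).

Definition meet_bound : R :=
  \sum_(1 <= s < (2 * K).+1)
    N%:R / n * n^-1 * (\prod_(1 <= l < s) growth (minn l (s - l))) * 2.

Lemma small_side (U : wcm_space G -> 'I_m.+1) :
  (forall a, product_event (G := G) (matched G `&` [set w | U w = a]) n^-1) ->
  small mu (matched G `&` [set w | (exists2 i, (i <= K)%N & escape G b i (U w) w) \/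
     (exists2 i, (0 < i <= K)%N & quick G b ell i (U w) w)]) side_bound.
Proof.
move=> bU; rewrite /side_bound mulrDr mulr_sumr.
apply: (@small_le _ _ _ _ _ ((matched G `&` [set w | escape G b 0 (U w) w]) `|`
   (matched G `&` [set w | exists2 i, (1 <= i < K.+1)%N &
      escape G b i (U w) w \/ quick G b ell i (U w) w])) _ _ _ (lexx _)).
  move=> w [Mw [[[|i] iK ei]|[i iK qi]]]; first by left.
    by right; split => //; exists i.+1 => //; left.
  by right; split => //; exists i => //; right.
apply: smallU; first exact: small_escape0.
apply: (small_bigcup_nat (F := fun i => (matched G `&` [set w | escape G b i (U w) w]) `|`
   (matched G `&` [set w | quick G b ell i (U w) w]))).
  by move=> w [Mw [i iK [e|q]]]; exists i => //; [left|right].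
move=> i iK; rewrite mulrDr mulrDr; apply: smallU.
  exact: small_escape.
exact: small_quick.
Qed.

Lemma small_close_path : small mu (matched G `&` [set w | ~ forall p, wcm_is_path w p ->
    (2 * K < size p)%N /\ 2 * \sum_(1 <= i < K.+1) ell i <= wcm_path_length w p])
  (2 * side_bound + n^-1 + meet_bound).
Proof.
have su := small_side (product_event_u G); have sv := small_side (product_event_v G).
have sm : small mu (matched G `&` [set w | exists2 s, (1 <= s < (2 * K).+1)%N &
    meet G b s w]) meet_bound.
  apply: (small_bigcup_nat (F := fun s => matched G `&` [set w | meet G b s w])).
    by move=> w [Mw [s sK ms]]; exists s.
  by move=> s sK; exact: small_meet.
have sneg := small_negative_length G nonneg.
have := smallU (smallU (smallU (smallU su sv) small_same) sm) sneg.
apply: small_le; last by rewrite addr0 mulr_natl mulr2n.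
move=> w [Mw far]; apply: contrapT => none; apply: far => p pp.
apply: (path_far (b := b)) (pp) => //.
- by rewrite inE.
- by move=> uv; apply: none; left; left; right.
- move=> h; rewrite leNgt; apply/negP => lh; apply: none; right; split => //.
  by exists h.
- by move=> i iK ei; apply: none; left; left; left; left; split => //; left; exists i.
- by move=> i iK ei; apply: none; left; left; left; right; split => //; left; exists i.
- by move=> i iK ei; apply: none; left; left; left; left; split => //; right; exists i.
- by move=> i iK ei; apply: none; left; left; left; right; split => //; right; exists i.
- by move=> s sK ms; apply: none; left; right; split => //; exists s.
Qed.

End SeparationProbability.

Arguments growth {R m} d b j.
Arguments excess {R m} d b j.
Arguments side_bound {R m} d {dO Omega Q} X b ell K.
Arguments meet_bound {R m} d b K.

(** * Sums of powers of the degrees *)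

Section SlowVariation.
Context {R : realType}.

Lemma expR_gee1 (x : R) : 0 <= x -> 1 <= expR x.
Proof. by rewrite -expR0 ler_expR. Qed.

Lemma powR_lt1 (a e : R) : 1 < a -> e < 0 -> a `^ e < 1.
Proof.
move=> a1 e0; have a0 : 0 < a by apply: lt_trans a1.
by rewrite /powR gt_eqF // -expR0 ltr_expR nmulr_rlt0 // ln_gt0.
Qed.

(** As gamma < 1, the power gamma of ln x is negligible against ln x. *)
Lemma expR_powR_slow (C gamma delta : R) : 0 < C -> 0 < gamma < 1 -> 0 < delta ->
  exists2 C1 : R, 1 <= C1 & forall x, 1 <= x -> expR (C * ln x `^ gamma) <= C1 * x `^ delta.
Proof.
move=> C0 /andP[g0 g1] d0.
pose t0 := (C / delta) `^ (1 - gamma)^-1.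
have Cd : 0 < C / delta by rewrite divr_gt0.
have t00 : 0 < t0 by rewrite powR_gt0.
exists (expR (C * t0 `^ gamma)).
  by apply: expR_gee1; rewrite mulr_ge0 ?powR_ge0 // ltW.
move=> x x1; have lx : 0 <= ln x by rewrite ln_ge0.
have x0 : 0 < x by apply: lt_le_trans x1.
rewrite [x `^ delta]/powR gt_eqF // -expRD ler_expR.
have [tle|tgt] := leP (ln x) t0.
  apply: (@le_trans _ _ (C * t0 `^ gamma)); last by rewrite lerDl mulr_ge0 // ltW.
  by rewrite ler_pM2l //; apply: ge0_ler_powR; rewrite ?nnegrE // ltW.
have lx0 : 0 < ln x by apply: lt_trans tgt.
apply: (@le_trans _ _ (delta * ln x)); last by rewrite lerDr mulr_ge0 ?powR_ge0 // ltW.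
have -> : ln x `^ gamma = ln x * (ln x `^ (1 - gamma))^-1.
  have gE : gamma = 1 + - (1 - gamma) by ring.
  rewrite {1}gE powRD; last by rewrite (gt_eqF lx0) implybT.
  by rewrite powRN powRr1 // ltW.
have tg : t0 `^ (1 - gamma) <= ln x `^ (1 - gamma).
  by apply: ge0_ler_powR; rewrite ?nnegrE ?subr_ge0 // ltW.
have t0E : t0 `^ (1 - gamma) = C / delta.
  rewrite /t0 -powRrM mulVf; last by rewrite subr_eq0 (gt_eqF g1).
  by rewrite powRr1 // (ltW Cd).
rewrite mulrCA mulrC; apply: ler_wpM2r => //.
rewrite ler_pdivrMr; last exact: powR_gt0.
by rewrite mulrC -ler_pdivrMr // -t0E.
Qed.

End SlowVariation.

Section DegreeSums.
Context {R : realType} {m : nat} (d : 'I_m.+1 -> nat).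
Local Notation n := (m.+1%:R : R).

Definition count_above (x : R) : R := #|[pred v | x < (d v)%:R]|%:R.

Lemma emp_cdf_compl x : 1 - emp_cdf d x = count_above x / n.
Proof.
rewrite /emp_cdf /count_above; have n0 : n != 0 by rewrite pnatr_eq0.
apply/eqP; rewrite subr_eq -mulrDl eq_sym; apply/eqP.
rewrite -natrD; apply: (canLR (mulfK n0)); rewrite mul1r; congr (_%:R); symmetry.
rewrite -[LHS](card_ord m.+1) -(cardC [pred v | (d v)%:R <= x]) addnC; congr addn.
- by apply: eq_card => v; rewrite !inE -ltNge.
- by rewrite cardsE.
Qed.

(** The degrees are split into dyadic scales; the tail bound makes the
    contributions of the scales decrease geometrically. *)
Lemma dyadic_sum (p e C1 y z : R) (tau1 := p - e) : 0 <= p -> e < 0 -> 0 <= C1 -> 1 <= y ->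
  (forall x, y <= x -> x < z -> count_above x <= n * C1 * x `^ (- tau1)) ->
  \sum_(v | (y < (d v)%:R) && ((d v)%:R <= z)) (d v)%:R `^ p
    <= n * (2 `^ p * C1 / (1 - 2 `^ e)) * y `^ e.
Proof.
move=> p0 e0 C10 y1 tailb.
have y0 : 0 < y by apply: lt_le_trans y1.
have r0 : 0 <= 2 `^ e :> R by apply: powR_ge0.
have r1 : 2 `^ e < 1 :> R by apply: powR_lt1; rewrite // ltr1n.
have step J : \sum_(v | (y < (d v)%:R) && ((d v)%:R <= Num.min z (2 ^+ J * y))) (d v)%:R `^ p
    <= n * (2 `^ p * C1 * y `^ e) * \sum_(j < J) (2 `^ e) ^+ j.
  elim: J => [|J IH].
    rewrite big_ord0 mulr0 big1 // => v /andP[yd]; rewrite expr0 mul1r le_min => /andP[_].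
    by rewrite leNgt yd.
  rewrite (bigID (fun v => (d v)%:R <= 2 ^+ J * y)) /= big_ord_recr mulrDr.
  apply: lerD.
    apply: le_trans IH; rewrite big_mkcond [leRHS]big_mkcond /=; apply: ler_sum => v _.
    case: ifP => [/andP[/andP[-> /=]]|_]; last by case: ifP => // _; exact: powR_ge0.
    by rewrite !le_min => /andP[-> _] ->.
  have [zle|zgt] := leP z (2 ^+ J * y).
    rewrite big1; first by rewrite !mulr_ge0 // ?powR_ge0 // exprn_ge0.
    move=> v /andP[/andP[_]]; rewrite le_min => /andP[dz _].
    by rewrite (le_trans dz zle).
  have Jy : y <= 2 ^+ J * y by apply: ler_peMl; [exact: ltW|apply: exprn_ege1; rewrite ler1n].
  have Jy0 : 0 < 2 ^+ J * y by rewrite mulr_gt0 // exprn_gt0.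
  apply: (@le_trans _ _ (\sum_(v | 2 ^+ J * y < (d v)%:R) (2 ^+ J.+1 * y) `^ p)).
    rewrite big_mkcond [leRHS]big_mkcond /=; apply: ler_sum => v _.
    case: ifP => [/andP[/andP[_]]|_]; last by case: ifP => // _; exact: powR_ge0.
    rewrite le_min -ltNge => /andP[_ dle] ->.
    by apply: ge0_ler_powR; rewrite // nnegrE // mulr_ge0 ?exprn_ge0 // ltW.
  rewrite sumr_const_pred -/(count_above _).
  apply: (@le_trans _ _ (n * C1 * (2 ^+ J * y) `^ (- tau1) * (2 ^+ J.+1 * y) `^ p)).
    by rewrite ler_wpM2r ?powR_ge0 // tailb.
  have -> : (2 ^+ J.+1 * y) `^ p = 2 `^ p * (2 ^+ J * y) `^ p.
    by rewrite exprS -mulrA powRM // ?ltW.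
  have eJ : (2 `^ e) ^+ J * y `^ e = (2 ^+ J * y) `^ e :> R.
    rewrite powRM ?exprn_ge0 ?(ltW y0) //; congr (_ * _).
    by rewrite -powR_mulrn // -powRrM mulrC powRrM powR_mulrn.
  have pe : (2 ^+ J * y) `^ (- tau1) * (2 ^+ J * y) `^ p = (2 ^+ J * y) `^ e.
    by rewrite -powRD ?(gt_eqF Jy0) ?implybT // /tau1; congr (_ `^ _); ring.
  have -> : n * (2 `^ p * C1 * y `^ e) * (2 `^ e) ^+ (ord_max : 'I_J.+1) =
    n * (2 `^ p * C1) * ((2 `^ e) ^+ J * y `^ e) by rewrite /=; ring.
  by rewrite eJ -pe; apply/eq_ler; ring.
(* enough scales to cover all degrees up to z *)
pose J := (Num.truncn z).+1.
have Jz : z <= 2 ^+ J * y.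
  apply: (@le_trans _ _ (J%:R : R)); first exact/ltW/truncnS_gt.
  rewrite -[leLHS]mulr1 ler_pM // -natrX ler_nat; apply: ltnW; exact: ltn_expl.
have := step J; rewrite min_l // => /le_trans; apply.
have -> : n * (2 `^ p * C1 / (1 - 2 `^ e)) * y `^ e =
  n * (2 `^ p * C1 * y `^ e) * (1 - 2 `^ e)^-1 by ring.
apply: ler_wpM2l; first by rewrite !mulr_ge0 // powR_ge0.
rewrite -[leRHS]mul1r ler_pdivlMr ?subr_gt0 // mulrC -(opprB (2 `^ e)) mulNr.
by rewrite -subrX1 opprB gerBl exprn_ge0.
Qed.

End DegreeSums.

(** * Degree-biased shares *)

Section Share.
Context {R : realType} {m : nat} (d : 'I_m.+1 -> nat).
Local Notation n := (m.+1%:R : R).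

Definition degree_sum : R := (\sum_v d v)%:R.

(** The biased law puts the half-edges of a vertex of degree k at k - 1, and its
    increments miss the value at 0: hence the shift by two. *)
Definition share (a b : nat) : R :=
  (\sum_(v | (a.+2 <= d v < b.+2)%N) (d v)%:R) / degree_sum.

Lemma sum_by_degree (f : nat -> R) a b :
  \sum_(a <= k < b) f k * #|[set v | d v == k]%SET|%:R = \sum_(v | (a <= d v < b)%N) f (d v).
Proof.
under eq_bigr => k _.
  rewrite -sum1_card natr_sum mulr_sumr big_mkcond /=.
  under eq_bigr => v _ do rewrite inE mulr1.
  over.
rewrite exchange_big /= [RHS]big_mkcond /=; apply: eq_bigr => v _.
rewrite -big_mkcond /= (eq_bigl (fun k => k == d v)); last by move=> k; rewrite eq_sym.
by rewrite big_nat1_eq.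
Qed.

Lemma le_max_degree v : (d v <= max_degree d)%N.
Proof. exact: leq_bigmax. Qed.

Lemma mean_degreeE : mean_degree d = degree_sum / n :> R.
Proof.
rewrite /mean_degree -(big_mkord xpredT (fun k => k%:R * deg_pmf d k)).
rewrite /deg_pmf; under eq_bigr do rewrite mulrA.
rewrite -mulr_suml (sum_by_degree (fun k => k%:R)) /degree_sum natr_sum; congr (_ / _).
by apply: eq_bigl => v; rewrite ltnS le_max_degree.
Qed.

Hypothesis d2 : forall v, (2 <= d v)%N.

Lemma degree_sum_ge : n * 2 <= degree_sum.
Proof.
rewrite -natrM ler_nat -[X in (X * _ <= _)%N](card_ord m.+1) -sum_nat_const.
by apply: leq_sum => v _; exact: d2.
Qed.

Lemma degree_sum_gt0 : 0 < degree_sum.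
Proof. by apply: lt_le_trans degree_sum_ge; rewrite mulr_gt0. Qed.

Lemma biased_pmfE k : biased_pmf d k = k.+1%:R * #|[set v | d v == k.+1]%SET|%:R / degree_sum :> R.
Proof.
rewrite /biased_pmf /deg_pmf mean_degreeE.
have n0 : n != 0 by rewrite pnatr_eq0.
have S0 : degree_sum != 0 by rewrite gt_eqF // degree_sum_gt0.
by move: (n) n0 => x x0; field; rewrite x0 S0.
Qed.

Lemma biased_cdf_step y : biased_cdf d y.+1%:R - biased_cdf d y%:R = biased_pmf d y.+1 :> R.
Proof.
apply/eqP; rewrite subr_eq; apply/eqP; rewrite /biased_cdf addrC.
rewrite big_mkcond [X in _ = X + _]big_mkcond /=.
have -> : biased_pmf d y.+1 =
  \sum_(k < max_degree d) (if (k : nat) == y.+1 then biased_pmf d k else 0) :> R.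
  rewrite -big_mkcond big_ord1_eq; case: ltnP => // my.
  rewrite biased_pmfE (_ : #|_| = 0%N) ?mulr0 ?mul0r //.
  apply: eq_card0 => v; rewrite !inE; apply/negbTE.
  by rewrite neq_ltn ltnS (leq_trans (le_max_degree v)) // (leq_trans my).
rewrite -big_split /=; apply: eq_bigr => k _.
rewrite !ler_nat leq_eqVlt ltnS; case: eqP => [->|_] /=; last by rewrite addr0.
by rewrite ltnn add0r.
Qed.

Lemma share_biased a b : share a b = \sum_(a <= y < b) biased_pmf d y.+1.
Proof.
under eq_bigr do rewrite biased_pmfE.
rewrite -mulr_suml /share; congr (_ / _).
rewrite -(sum_by_degree (fun k => k%:R) a.+2 b.+2) big_add1 /= big_add1 /=.
by [].
Qed.

Lemma share_total b : (b >= max_degree d)%N ->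
  share 0 b = 1.
Proof.
move=> mb; rewrite /share (eq_bigl xpredT); last first.
  by move=> v; rewrite d2 /= ltnS (leq_trans (le_max_degree v)) // (leq_trans mb).
by rewrite -natr_sum divff // gt_eqF // degree_sum_gt0.
Qed.

Lemma share_dTV (F : R -> R) (x : R) a b : (a <= b)%N ->
  (dTV (biased_cdf d) F <= x%:E)%E ->
  `|share a b - \sum_(a <= y < b) (F y.+1%:R - F y%:R)| <= 2 * x.
Proof.
move=> ab dx; rewrite share_biased -sumrB.
apply: le_trans (ler_norm_sum _ _ _) _.
pose t y : R := `|biased_cdf d y.+1%:R - biased_cdf d y%:R - (F y.+1%:R - F y%:R)|.
have tE y : `|biased_pmf d y.+1 - (F y.+1%:R - F y%:R)| = t y by rewrite /t biased_cdf_step.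
under eq_bigr do rewrite tE.
apply: (@le_trans _ _ (\sum_(0 <= y < b) t y)).
  by rewrite [leRHS](big_cat_nat (leq0n a) ab) /= lerDr sumr_ge0 // => y _; exact: normr_ge0.
have : (\sum_(0 <= y < b) (t y)%:E <= \sum_(0 <= y <oo) (t y)%:E)%E.
  by apply: nneseries_lim_ge => y _ _; rewrite lee_fin; exact: normr_ge0.
rewrite -lee_fin -sumEFin => /le_trans; apply.
by move: dx; rewrite /dTV lee_pdivrMl.
Qed.

End Share.

(** * Consequences of the degree assumptions *)

Lemma near_le_powR (R : realType) (e c : R) : 0 < e ->
  \forall m \near \oo, c <= m.+1%:R `^ e.
Proof.
move=> e0; pose x := (Num.max c 0) `^ e^-1.
exists (Num.truncn x).+1 => // m /= xm.
have c0 : 0 <= Num.max c 0 by rewrite le_max lexx orbT.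
apply: (@le_trans _ _ (Num.max c 0)); first by rewrite le_max lexx.
have -> : Num.max c 0 = x `^ e by rewrite /x -powRrM mulVf ?gt_eqF // powRr1.
apply: ge0_ler_powR; rewrite ?nnegrE ?powR_ge0 //; first exact: ltW.
apply: le_trans (ltW (truncnS_gt x)) _; rewrite ler_nat; exact: leqW.
Qed.

Lemma near_powRN_le (R : realType) (e c : R) : 0 < e -> 0 < c ->
  \forall m \near \oo, m.+1%:R `^ (- e) <= c.
Proof.
move=> e0 c0; have := near_le_powR c^-1 e0; apply: filterS => m.
rewrite powRN => h; rewrite -[leRHS]invrK lef_pV2 // posrE ?invr_gt0 // powR_gt0.
Qed.

Section HalfEdgeSums.
Context {R : realType} {m : nat} (d : 'I_m.+1 -> nat).

Lemma sum_owner (c : pred 'I_m.+1) (f : 'I_m.+1 -> R) :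
  \sum_(g : half_edge d | c (owner g)) f (owner g) = \sum_(v | c v) (cm_degree d v)%:R * f v.
Proof.
rewrite (partition_big (fun g : half_edge d => owner g) c) //=; apply: eq_bigr => v cv.
rewrite -card_owner -sumr_const_pred.
apply: eq_big => [g|g /andP[_ /eqP ->]] //.
by case: eqP => [->|]; rewrite ?andbF // cv.
Qed.

Lemma half_edges_atE (c : pred 'I_m.+1) :
  half_edges_at d c = \sum_(v | c v) (cm_degree d v)%:R :> R.
Proof.
rewrite /half_edges_at -[LHS]mulr1 -sumr_const_pred (sum_owner c (fun=> 1)).
by apply: eq_bigr => v _; rewrite mulr1.
Qed.

Lemma pairs_atE (c : pred 'I_m.+1) :
  pairs_at d c = \sum_(v | c v) (cm_degree d v)%:R ^+ 2 :> R.
Proof. by rewrite /pairs_at (sum_owner c (fun v => (cm_degree d v)%:R)). Qed.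

Lemma cm_degree_ge v : (d v <= cm_degree d v)%N.
Proof. exact: leq_addr. Qed.

Hypothesis d2 : forall v, (2 <= d v)%N.

Lemma cm_degree_leS v : (cm_degree d v <= (d v).+1)%N.
Proof. by rewrite -[(d v).+1]addn1 leq_add2l leq_b1. Qed.

Lemma cm_degree_le2 v : (cm_degree d v <= 2 * d v)%N.
Proof. by have := cm_degree_leS v; have := d2 v; lia. Qed.

Lemma card_half_edge_ge : m.+1%:R * 2 <= #|half_edge d|%:R :> R.
Proof.
apply: le_trans (degree_sum_ge d2) _; rewrite card_half_edge ler_nat.
by apply: leq_sum => v _; exact: cm_degree_ge.
Qed.

Lemma card_half_edge_le : #|half_edge d|%:R <= 2 * degree_sum d :> R.
Proof.
rewrite card_half_edge -natrM ler_nat big_distrr /=.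
by apply: leq_sum => v _; exact: cm_degree_le2.
Qed.

End HalfEdgeSums.

Section DegreeBounds.
Context {R : realType}.
Variables (tau : R) (d : forall m, 'I_m.+1 -> nat) (alpha kappa : R) (FB : R -> R).
Arguments d : clear implicits.
Hypotheses (tau23 : 2 < tau < 3) (d2 : forall m v, (2 <= d m v)%N) (kappa0 : 0 < kappa) (alpha0 : 0 < alpha)
  (tvB : forall m, (dTV (biased_cdf (d m)) FB <= (m.+1%:R `^ (- kappa))%:E)%E)
  (tail : forall delta : R, 0 < delta -> exists2 C1 : R, 1 <= C1 &
     forall m x, 1 <= x < m.+1%:R `^ alpha ->
       m.+1%:R * C1^-1 * x `^ (- (tau - 1 + delta)) <= count_above (d m) x
         <= m.+1%:R * C1 * x `^ (- (tau - 1 - delta))).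

(** Both shares are close to the one given by the limit. *)
Lemma share_compare m m' a b : (a <= b)%N ->
  share (d m) a b <= share (d m') a b + 2 * m.+1%:R `^ (- kappa) + 2 * m'.+1%:R `^ (- kappa).
Proof.
move=> ab.
have h k : `|share (d k) a b - \sum_(a <= y < b) (FB y.+1%:R - FB y%:R)|
    <= 2 * k.+1%:R `^ (- kappa).
  by apply: share_dTV ab _ => //; exact: d2.
have := h m; have := h m'; rewrite !ler_norml.
by move: (share _ _ _) (share _ _ _) (\sum_(_ <= _ < _) _) => x y z; lra.
Qed.

(** For one fixed n, the degrees up to some constant carry all the half-edges.
    Hence they carry at least half of them for all large n, and this is at most
    a multiple of n. *)
Lemma degree_sum_linear : exists2 c : R, 0 < c &
  \forall m \near \oo, degree_sum (d m) <= c * m.+1%:R.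
Proof.
have small_kappa : \forall m \near \oo, m.+1%:R `^ (- kappa) <= (8^-1 : R).
  by apply: near_powRN_le; rewrite // invr_gt0.
have [m0 _ m0P] := small_kappa; pose B := max_degree (d m0).
exists (2 * B.+2%:R) => //; exists m0 => // m /= mm.
have hm := m0P m mm; have hm0 := m0P m0 (leqnn _).
have S0 := degree_sum_gt0 (R := R) (d2 (m := m)).
have := share_compare m0 m (leq0n B).
rewrite (share_total (d2 (m := m0))) // => sh.
have sh2 : 2^-1 <= share (d m) 0 B :> R by move: sh hm hm0; lra.
have : share (d m) 0 B <= B.+2%:R * m.+1%:R / degree_sum (d m) :> R.
  rewrite /share ler_pM2r ?invr_gt0 //.
  apply: (@le_trans _ _ (\sum_(v < m.+1) (B.+2%:R : R))); last first.
    by rewrite sumr_const card_ord mulr_natr.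
  rewrite big_mkcond /=; apply: ler_sum => v _; case: ifP => // /andP[_ h].
  by rewrite ler_nat ltnW.
by move/(le_trans sh2); rewrite ler_pdivlMr // ler_pdivrMl // mulrA.
Qed.

(** The power law holds up to n^alpha only, and there may be larger degrees. But
    the share of the half-edges at degrees above y hardly differs from the one
    for a much larger number n' of vertices, for which the power law covers all
    the degrees that occur for n. *)
Lemma tail_sum (delta : R) : 0 < delta -> delta < tau - 2 ->
  exists2 c : R, 0 < c & \forall m \near \oo, forall y, 1 <= y <= m.+1%:R `^ kappa ->
    \sum_(v | y < (d m v)%:R) (d m v)%:R <= c * m.+1%:R * y `^ (- (tau - 2 - delta)).
Proof.
move=> dl0 dl1; have [C1 C11 tb] := tail dl0.
have [c c0 lin] := degree_sum_linear.
pose e : R := - (tau - 2 - delta).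
have e0 : e < 0 by rewrite oppr_lt0 subr_gt0.
have C10 : 0 <= C1 by apply: le_trans C11.
pose c2 : R := 2 `^ 1 * C1 / (1 - 2 `^ e).
have c20 : 0 <= c2.
  by rewrite /c2 !mulr_ge0 ?powR_ge0 // invr_ge0 subr_ge0 ltW // powR_lt1 // ltr1n.
exists (c * (c2 + 4)); first by rewrite mulr_gt0 // ltr_wpDl.
apply: filterS lin => m Sm y /andP[y1 yk].
have y0 : 0 < y by apply: lt_le_trans y1.
have S0 := degree_sum_gt0 (R := R) (d2 (m := m)).
have ty : (0 < Num.truncn y)%N by rewrite truncn_gt0.
pose a := (Num.truncn y).-1; pose B := maxn (max_degree (d m)) a.
have yE k : (y < k%:R) = (a.+2 <= k)%N.
  by rewrite /a prednK // truncn_lt_nat // ltW.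
have sE : share (d m) a B = (\sum_(v | y < (d m v)%:R) (d m v)%:R) / degree_sum (d m) :> R.
  rewrite /share; congr (_ / _); apply: eq_bigl => v; rewrite -yE.
  rewrite [X in _ && X](_ : _ = true) ?andbT //.
  by rewrite ltnS (leq_trans (le_max_degree (d m) v)) // -addn1 (leq_trans (leq_maxl _ a)) // leq_addr.
(* an index so large that the power law covers the degrees up to B + 2 *)
have [m' [Bm' mm']] : exists m', B.+2%:R <= m'.+1%:R `^ alpha /\ m'.+1%:R `^ (- kappa) <= m.+1%:R `^ (- kappa) :> R.
  have e1 := near_le_powR (B.+2%:R : R) alpha0.
  have e2 : \forall k \near \oo, k.+1%:R `^ (- kappa) <= m.+1%:R `^ (- kappa) :> R.
    by apply: near_powRN_le => //; exact: powR_gt0.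
  have [k0 _ kP] := filterI e1 e2; exists k0; exact: kP (leqnn _).
have n0 : 0 < m'.+1%:R :> R by [].
have sh' : share (d m') a B <= c2 * y `^ e.
  have Sm' := degree_sum_ge (R := R) (d2 (m := m')).
  have S'0 := degree_sum_gt0 (R := R) (d2 (m := m')).
  rewrite /share ler_pdivrMr //.
  apply: (@le_trans _ _ (m'.+1%:R * c2 * y `^ e)); last first.
    rewrite -mulrA mulrC; apply: ler_wpM2l; first exact: mulr_ge0 c20 (powR_ge0 _ _).
    by apply: le_trans Sm'; rewrite ler_peMr // ler1n.
  apply: le_trans (dyadic_sum (d := d m') (p := 1) (e := e) (C1 := C1) (y := y) (z := B.+2%:R) _ e0 C10 y1 _) => //.
    rewrite big_mkcond [leRHS]big_mkcond /=; apply: ler_sum => v _.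
    rewrite yE ler_nat; case: ifP => [/andP[-> dB]|_]; last by case: ifP => // _; exact: powR_ge0.
    by rewrite (ltnW dB) powRr1.
  move=> x yx xB.
  have xr : 1 <= x < m'.+1%:R `^ alpha by rewrite (le_trans y1 yx) (lt_le_trans xB).
  have /andP[_ h] := tb m' x xr; apply: le_trans h _.
  by apply/eq_ler; congr (_ * _ `^ _); rewrite /e; ring.
have nk : m.+1%:R `^ (- kappa) <= y `^ e.
  apply: (@le_trans _ _ (y^-1)).
    by rewrite powRN lef_pV2 // posrE // powR_gt0.
  have -> : y^-1 = y `^ (- 1) by rewrite powRN powRr1 // ltW.
  by rewrite ler_powR // /e lerN2; move/andP: tau23 => [_]; move: dl0; lra.
have := share_compare m m' (leq_maxr (max_degree (d m)) a : (a <= B)%N).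
rewrite sE ler_pdivrMr // => h; apply: le_trans h _.
rewrite -/e; have -> : c * (c2 + 4) * m.+1%:R * y `^ e = (c2 + 4) * y `^ e * (c * m.+1%:R) by ring.
have sh0 : 0 <= share (d m') a B :> R.
  by rewrite /share divr_ge0 ?sumr_ge0 // ltW // degree_sum_gt0 //; exact: d2.
apply: ler_pM; [|exact: ltW| |exact: Sm].
  by apply: addr_ge0; [apply: addr_ge0 sh0 _|]; rewrite mulr_ge0 // powR_ge0.
by move: sh' mm' nk; set sh := share _ _ _; lra.
Qed.

(** The second moment truncated at b is compared with the moment of order
    tau - 1 - 2 delta, which is bounded. *)
Lemma truncated_second_moment (delta : R) : 0 < delta -> 2 * delta <= tau - 1 ->
  exists2 c : R, 0 < c & forall m b, 1 <= b < m.+1%:R `^ alpha ->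
    \sum_(v | (d m v)%:R <= b) (d m v)%:R ^+ 2 <= c * m.+1%:R * b `^ (3 - tau + 2 * delta).
Proof.
move=> dl0 dl1; have [C1 C11 tb] := tail dl0.
have /andP[t2 t3] := tau23.
have C10 : 0 < C1 by apply: lt_le_trans C11.
have e0 : - delta < 0 by rewrite oppr_lt0.
pose p := tau - 1 - 2 * delta.
have p0 : 0 <= p by rewrite /p subr_ge0.
pose c := 2 `^ p * C1 / (1 - 2 `^ (- delta)).
have c0 : 0 < c.
  rewrite /c divr_gt0 ?mulr_gt0 ?powR_gt0 // subr_gt0 powR_lt1 // ltr1n //.
exists c => // m b /andP[b1 ba].
have b0 : 0 < b by apply: lt_le_trans b1.
apply: (@le_trans _ _ (\sum_(v | (1 < (d m v)%:R :> R) && ((d m v)%:R <= b))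
    (d m v)%:R `^ p * b `^ (3 - tau + 2 * delta))).
  rewrite big_mkcond [leRHS]big_mkcond /=; apply: ler_sum => v _.
  rewrite ltr1n d2 /=; case: ifP => // db.
  have dv0 : 0 < (d m v)%:R :> R by rewrite ltr0n; exact: ltnW (d2 v).
  have -> : (d m v)%:R ^+ 2 = (d m v)%:R `^ p * (d m v)%:R `^ (3 - tau + 2 * delta) :> R.
    rewrite -powRD ?(gt_eqF dv0) ?implybT // -powR_mulrn ?(ltW dv0) //.
    by congr (_ `^ _); rewrite /p; ring.
  rewrite ler_wpM2l ?powR_ge0 //; apply: ge0_ler_powR; rewrite ?nnegrE // ?(ltW b0) //.
  by move: t3 dl0; lra.
rewrite -mulr_suml ler_wpM2r ?powR_ge0 //.
apply: le_trans (dyadic_sum (d := d m) p0 e0 (ltW C10) (lexx 1) _) _.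
  move=> x x1 xb; have xr : 1 <= x < m.+1%:R `^ alpha by rewrite x1 (lt_trans xb).
  have /andP[_ h] := tb m x xr; apply: le_trans h _.
  by apply/eq_ler; congr (_ * _ `^ _); rewrite /p; ring.
by rewrite powR1 mulr1 mulrC.
Qed.

Let N_gt0 m : 0 < #|half_edge (d m)|%:R :> R.
Proof. by apply: lt_le_trans (card_half_edge_ge (d2 (m := m))); rewrite mulr_gt0. Qed.

Let two_div_N m : 2 / #|half_edge (d m)|%:R <= m.+1%:R^-1 :> R.
Proof.
rewrite ler_pdivrMr // ler_pdivlMl // mulrC [leLHS]mulrC.
exact: card_half_edge_ge (d2 (m := m)).
Qed.

Lemma card_half_edge_linear : exists2 c : R, 0 < c &
  \forall m \near \oo, #|half_edge (d m)|%:R <= c * m.+1%:R.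
Proof.
have [c c0 lin] := degree_sum_linear; exists (2 * c); first by rewrite mulr_gt0.
apply: filterS lin => m Sm; apply: le_trans (card_half_edge_le (d2 (m := m))) _.
by rewrite -mulrA ler_wpM2l.
Qed.

Lemma growth_bound (delta : R) : 0 < delta -> 2 * delta <= tau - 1 ->
  exists2 c : R, 0 < c & forall m b, 1 <= b < m.+1%:R `^ alpha ->
    2 / #|half_edge (d m)|%:R * pairs_at (d m) [pred v | (cm_degree (d m) v)%:R <= b]
      <= c * b `^ (3 - tau + 2 * delta).
Proof.
move=> dl0 dl1; have [c c0 H] := truncated_second_moment dl0 dl1.
exists (4 * c); first by rewrite mulr_gt0.
move=> m b bb; have n0 : 0 < m.+1%:R :> R by [].
apply: (@le_trans _ _ (m.+1%:R^-1 * (4 * (c * m.+1%:R * b `^ (3 - tau + 2 * delta))))).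
  apply: ler_pM => //; first by rewrite /pairs_at sumr_ge0.
  rewrite pairs_atE; apply: (@le_trans _ _ (4 * \sum_(v | (d m v)%:R <= b) (d m v)%:R ^+ 2)).
    rewrite mulr_sumr big_mkcond [leRHS]big_mkcond /=; apply: ler_sum => v _.
    case: ifP => [Db|_]; last by case: ifP => // _; rewrite mulr_ge0 // exprn_ge0.
    rewrite (le_trans _ Db) ?ler_nat ?cm_degree_ge // -!natrX -natrM ler_nat.
    by have := cm_degree_le2 (d2 (m := m)) v; move: (cm_degree _ _) (d m v); clear => k l; nia.
  by rewrite ler_wpM2l // H.
by apply/eq_ler; move: (b `^ _) => x; field; rewrite gt_eqF.
Qed.

Lemma excess_bound (delta : R) : 0 < delta -> delta < tau - 2 ->
  exists2 c : R, 0 < c & \forall m \near \oo, forall b : R, 2 <= b <= m.+1%:R `^ kappa ->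
    2 / #|half_edge (d m)|%:R * half_edges_at (d m) [pred v | b < (cm_degree (d m) v)%:R]
      <= c * b `^ (- (tau - 2 - delta)).
Proof.
move=> dl0 dl1; have [c c0 H] := tail_sum dl0 dl1.
pose e := - (tau - 2 - delta); exists (2 * c * 2^-1 `^ e).
  by rewrite !mulr_gt0 // powR_gt0 // invr_gt0.
apply: filterS H => m H b /andP[b2 bk]; have n0 : 0 < m.+1%:R :> R by [].
have b0 : 0 < b by apply: lt_le_trans b2.
have hb : 1 <= b / 2 <= m.+1%:R `^ kappa.
  rewrite ler_pdivlMr // mul1r b2 /= (le_trans _ bk) // ler_pdivrMr //.
  by move: b0; lra.
have := H _ hb; rewrite -/e => Hb.
apply: (@le_trans _ _ (m.+1%:R^-1 * (2 * (c * m.+1%:R * (b / 2) `^ e)))); last first.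
  rewrite powRM ?invr_ge0 ?(ltW b0) //; apply/eq_ler; move: (b `^ _) (2^-1 `^ _) => x z.
  by field; rewrite gt_eqF.
apply: ler_pM => //.
rewrite half_edges_atE.
apply: (@le_trans _ _ (2 * \sum_(v | b / 2 < (d m v)%:R) (d m v)%:R)); last first.
  by rewrite ler_wpM2l.
rewrite mulr_sumr big_mkcond [leRHS]big_mkcond /=; apply: ler_sum => v _.
have D2 := cm_degree_le2 (d2 (m := m)) v.
case: ifP => [bD|_]; last by case: ifP => // _; rewrite mulr_ge0.
rewrite ltr_pdivrMr // (lt_le_trans bD) -?natrM ?ler_nat //.
by rewrite mulnC.
Qed.

(** Each of the vertices above x has at least x half-edges. *)
Lemma half_edges_lower (delta : R) : 0 < delta ->
  exists2 c : R, 0 < c & forall m x, 1 <= x < m.+1%:R `^ alpha ->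
    c * m.+1%:R * x `^ (- (tau - 2 + delta))
      <= half_edges_at (d m) [pred v | x < (d m v)%:R].
Proof.
move=> dl0; have [C1 C11 tb] := tail dl0.
have C10 : 0 < C1 by apply: lt_le_trans C11.
exists C1^-1; first by rewrite invr_gt0.
move=> m x xr; have /andP[h _] := tb m x xr.
have x0 : 0 < x by case/andP: xr => x1 _; apply: lt_le_trans x1.
apply: (@le_trans _ _ (x * count_above (d m) x)).
  have -> : x `^ (- (tau - 2 + delta)) = x * x `^ (- (tau - 1 + delta)).
    rewrite -{2}(powRr1 (ltW x0)) -powRD ?(gt_eqF x0) ?implybT //.
    by congr (_ `^ _); ring.
  rewrite mulrCA ler_wpM2l ?(ltW x0) //; apply: le_trans h.
  by rewrite [_ * C1^-1]mulrC.
rewrite half_edges_atE mulrC /count_above -sumr_const_pred; apply: ler_sum => v xv.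
by apply: ltW; apply: lt_le_trans xv _; rewrite ler_nat cm_degree_ge.
Qed.

End DegreeBounds.

(** The slowly varying corrections are absorbed into the exponents. *)
Lemma power_law_tail_powers (R : realType) (tau : R) (d : forall m, 'I_m.+1 -> nat) :
  power_law_tail tau d -> exists2 alpha : R, 2^-1 < alpha &
  forall delta : R, 0 < delta -> exists2 C1 : R, 1 <= C1 &
     forall m x, 1 <= x < m.+1%:R `^ alpha ->
       m.+1%:R * C1^-1 * x `^ (- (tau - 1 + delta)) <= count_above (d m) x
         <= m.+1%:R * C1 * x `^ (- (tau - 1 - delta)).
Proof.
move=> [gamma [C [alpha [g01 C0 ha H]]]]; exists alpha => // delta dl0.
have [C1 C11 slow] := expR_powR_slow C0 g01 dl0; exists C1 => // m x xr.
have C10 : 0 < C1 by apply: lt_le_trans C11.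
have x1 : 1 <= x by case/andP: xr.
have x0 : 0 < x by apply: lt_le_trans x1.
have n0 : 0 < m.+1%:R :> R by [].
have := H m x xr; rewrite emp_cdf_compl ler_pdivlMr // ler_pdivrMr // => /andP[lo hi].
have sx := slow x x1; set y := C * _ in lo hi sx.
set P := (x `^ (tau - 1))^-1 in lo hi; set W := x `^ delta in sx.
have P0 : 0 <= P by rewrite invr_ge0 powR_ge0.
have W0 : 0 < W by apply: powR_gt0.
have E1 : x `^ (- (tau - 1 + delta)) = P * W^-1.
  by rewrite opprD powRD ?(gt_eqF x0) ?implybT // !powRN.
have E2 : x `^ (- (tau - 1 - delta)) = P * W.
  by rewrite opprB addrC powRD ?(gt_eqF x0) ?implybT // powRN.
apply/andP; split.
  apply: le_trans lo; rewrite E1.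
  have -> : m.+1%:R * C1^-1 * (P * W^-1) = P * (C1 * W)^-1 * m.+1%:R.
    by rewrite invfM; ring.
  rewrite ler_wpM2r // ler_wpM2l // expRN lef_pV2 // posrE ?expR_gt0 //.
  exact: mulr_gt0.
apply: le_trans hi _; rewrite E2.
have -> : m.+1%:R * C1 * (P * W) = P * (C1 * W) * m.+1%:R by ring.
by rewrite ler_wpM2r // ler_wpM2l.
Qed.

(** * Quantiles of the edge lengths *)

Section Quantile.
Context {R : realType} {dO : measure_display} {Omega : measurableType dO}
  {Q : probability Omega R} (L : {RV Q >-> R}).
Hypothesis L_ge0 : {ae Q, forall w, 0 <= L w}.

Lemma length_law_neg : length_law L `]-oo, 0[%classic = 0.
Proof.
have [B [mB QB LB]] := L_ge0.
rewrite /length_law /distribution /pushforward; suff -> : Q (L @^-1` `]-oo, 0[) = 0%E by [].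
apply/eqP; rewrite eq_le measure_ge0 andbT -QB; apply: le_measure; rewrite ?inE //.
  by rewrite -[X in measurable X]setTI; exact: measurable_funPT.
move=> w /=; rewrite in_itv /= => Lw; apply: LB => /= L0.
by move: Lw; rewrite ltNge L0.
Qed.

Local Notation F := (cdf L).
Local Notation GI := (generalised_inverse F).

Lemma cdf_length_law t : F t = (length_law L (short t))%:E.
Proof. by rewrite length_lawE //; exact: measurable_short. Qed.

Lemma length_law_mono (A B : set R) : measurable A -> measurable B -> A `<=` B -> length_law L A <= length_law L B.
Proof. by move=> mA mB AB; rewrite -lee_fin !length_lawE //; apply: le_measure; rewrite ?inE. Qed.

Lemma cdf_neg t : t < 0 -> F t = 0%E.
Proof.
move=> t0; rewrite cdf_length_law; congr (_%:E); apply/eqP; rewrite eq_le length_law_ge0 andbT.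
rewrite -length_law_neg; apply: length_law_mono; [exact: measurable_short|exact: measurable_itv|].
by move=> y; rewrite /short /= !in_itv /= => yt; apply: le_lt_trans yt t0.
Qed.

Let level x := [set y | (x%:E <= F y)%E].

Lemma level_lbound (x : R) : 0 < x -> lbound (level x) 0.
Proof.
move=> x0 y /=; rewrite /level /= => xF; rewrite leNgt; apply/negP => y0.
by move: xF; rewrite cdf_neg // lee_fin leNgt x0.
Qed.

Lemma level_nonempty (x : R) : x < 1 -> level x !=set0.
Proof.
move=> x1; have cv := @cvg_cdfy1 _ _ _ _ L.
have xe : (x%:E < 1)%E by rewrite lte_fin.
have [M [_ HM]] := cv _ (open_ereal_gt' xe); exists (M + 1); rewrite /level /=.
by apply/ltW/HM; rewrite ltrDl.
Qed.

Lemma quantile_ge0 (x : R) : 0 < x -> x < 1 -> 0 <= GI x.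
Proof. by move=> x0 x1; apply: lb_le_inf (level_nonempty x1) (level_lbound x0). Qed.

Lemma quantile_mono (x y : R) : 0 < x -> x <= y -> y < 1 -> GI x <= GI y.
Proof.
move=> x0 xy y1; apply: lb_le_inf; first exact: level_nonempty.
move=> z /= yz; apply: ge_inf.
  by exists 0; exact: level_lbound.
by rewrite /= (le_trans _ yz) // lee_fin.
Qed.

(** Right continuity of the distribution function. *)
Lemma length_law_quantile (x : R) : 0 < x -> x < 1 -> x <= length_law L (short (GI x)).
Proof.
move=> x0 x1; rewrite -lee_fin -cdf_length_law.
have hinf : has_inf (level x).
  by split; [exact: level_nonempty|exists 0; exact: level_lbound].
have rc := @cdf_right_continuous _ _ _ _ L (GI x).
rewrite -(cvg_lim _ rc) //; apply: lime_ge; first by apply/cvg_ex; exists (F (GI x)).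
near=> t.
have tG : GI x < t by near: t; exact: nbhs_right_gt.
have e0 : 0 < t - GI x by rewrite subr_gt0.
have [e /= xe et] := inf_adherent e0 hinf.
apply: le_trans xe _; apply: cdf_nondecreasing; apply: ltW.
by move: et; rewrite -/(GI x) addrC subrK.
Unshelve. all: by end_near.
Qed.

Lemma length_law_below_quantile (x : R) : 0 < x -> length_law L `]-oo, GI x[%classic <= x.
Proof.
move=> x0; rewrite -lee_fin length_lawE; last exact: measurable_itv.
(* below the quantile, the level x is not attained *)
pose A n : set R := short (GI x - n.+1%:R^-1).
have AE : `]-oo, GI x[%classic = \bigcup_n A n.
  apply/seteqP; split => y /=; rewrite in_itv /=.
    move=> yG; have e0 : 0 < GI x - y by rewrite subr_gt0.
    have [k _ kP] := near_infty_natSinv_lt (PosNum e0).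
    exists k => //; rewrite /A /short /= in_itv /=.
    have h : k.+1%:R^-1 < GI x - y := kP k (leqnn _).
    by rewrite lerBrDr addrC -lerBrDr ltW.
  move=> [k _]; rewrite /A /short /= in_itv /= => /le_lt_trans; apply.
  by rewrite ltrBlDr ltrDl invr_gt0.
have mA n : measurable (A n) by exact: measurable_short.
rewrite AE; have := nondecreasing_cvg_mu (mu := distribution Q L) mA (bigcup_measurable (fun n _ => mA n)).
have hA : {homo A : n m / (n <= m)%N >-> (n <= m)%O}.
  move=> i j ij; apply/subsetPset => y; rewrite /A /short /= !in_itv /= => /le_trans; apply.
  by rewrite lerD2l lerN2 lef_pV2 ?posrE // ler_nat.
move/(_ hA) => cA; rewrite -(cvg_lim _ cA) //; apply: lime_le.
  by apply/cvg_ex; eexists; exact: cA.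
apply: nearW => k /=; rewrite -/(cdf L _) leNgt; apply/negP => xF.
have : GI x <= GI x - k.+1%:R^-1.
  by apply: ge_inf; [exists 0; exact: level_lbound|exact: ltW].
by rewrite leNgt ltrBlDr ltrDl invr_gt0 ltr0Sn.
Qed.

(** The levels decay doubly exponentially, so their logarithms are the natural
    parameter. *)
Definition quantile (y : R) : R := GI (expR (- y)).

Lemma quantile_nonneg (y : R) : 0 < y -> 0 <= quantile y.
Proof. by move=> y0; apply: quantile_ge0; rewrite ?expR_gt0 // -expR0 ltr_expR oppr_lt0. Qed.

Lemma quantile_decr (y z : R) : 0 < y -> y <= z -> quantile z <= quantile y.
Proof.
move=> y0 yz; apply: quantile_mono; rewrite ?expR_gt0 //.
  by rewrite ler_expR lerN2.
by rewrite -expR0 ltr_expR oppr_lt0.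
Qed.

Hypothesis explosion_free :
  (\sum_(1 <= k <oo) (generalised_inverse (cdf L) (expR (- expR k%:R)))%:E = +oo)%E.

(** Cauchy condensation: quantiles are monotone in the level, and each power of q
    is followed by a bounded number of powers of e before the next one. *)
Lemma quantile_sum_unbounded (q : R) : 1 < q -> forall B : R, exists J, B < \sum_(0 <= j < J) quantile (q ^+ j).
Proof.
move=> q1 B; apply: contrapT => /forallNP bd.
have q0 : 0 < q by apply: lt_trans q1.
pose p := (Num.truncn (ln q)).+1.
have qp : q <= expR p%:R.
  by rewrite -[leLHS]lnK ?posrE // ler_expR; exact/ltW/truncnS_gt.
pose h k := quantile (expR k%:R).
have h0 k : 0 <= h k by apply: quantile_nonneg; exact: expR_gt0.
have blocks J : \sum_(0 <= k < J * p) h k <= p%:R * \sum_(0 <= j < J) quantile (q ^+ j).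
  rewrite big_nat_mul mulr_sumr; apply: ler_sum => j _.
  apply: (@le_trans _ _ (\sum_(j * p <= k < j.+1 * p) quantile (q ^+ j))); last first.
    by rewrite sumr_const_nat mulSn addnK mulr_natl.
  rewrite big_nat [leRHS]big_nat; apply: ler_sum => k /andP[jk _].
  apply: quantile_decr; first exact: exprn_gt0.
  apply: (@le_trans _ _ (expR p%:R ^+ j)); first by rewrite lerXn2r ?nnegrE ?expR_ge0 // ltW.
  by rewrite -expRM_natl ler_expR -natrM ler_nat.
have bound n : \sum_(1 <= k < n) h k <= p%:R * B.
  apply: (@le_trans _ _ (\sum_(0 <= k < n * p) h k)).
    case: n => [|n]; first by rewrite big_geq // mul0n big_geq.
    rewrite (@big_cat_nat _ _ _ n.+1 0 (n.+1 * p)) //=; last by rewrite leq_pmulr.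
    rewrite (@big_ltn _ _ _ 0 n.+1) // -addrA addrCA lerDl addr_ge0 //.
    by rewrite sumr_ge0.
  apply: le_trans (blocks n) _; rewrite ler_wpM2l //.
  by have := bd n; move/negP; rewrite -leNgt.
suff : (\sum_(1 <= k <oo) (generalised_inverse (cdf L) (expR (- expR k%:R)))%:E <= (p%:R * B)%:E)%E.
  by rewrite explosion_free leye_eq.
apply: lime_le.
  apply: is_cvg_nneseries => k _ _; rewrite lee_fin; exact: h0.
apply: nearW => n; rewrite sumEFin lee_fin; exact: bound.
Qed.

End Quantile.

Section BlockSums.
Context {R : realType} (f : nat -> R).
Hypothesis f_decr : forall i j, (i <= j)%N -> f j <= f i.

(** In each block of k + 1 indices only the last one is skipped, where a
    nonincreasing sequence is the smallest. *)
Lemma sum_skip_ge (k c J : nat) : (0 < k)%N ->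
  k%:R / k.+1%:R * \sum_(0 <= j < J * k.+1) f (c + j) <= \sum_(0 <= i < J * k) f (c + (i + i %/ k)).
Proof.
move=> k0; rewrite !big_nat_mul mulr_sumr; apply: ler_sum => j _.
have e1 : \sum_(j * k.+1 <= i < j.+1 * k.+1) f (c + i) = \sum_(0 <= r < k.+1) f (c + (r + j * k.+1)).
  by rewrite -{1}[(j * k.+1)%N]add0n big_addn mulSn addnK.
have e2 : \sum_(j * k <= i < j.+1 * k) f (c + (i + i %/ k)) = \sum_(0 <= r < k) f (c + (r + j * k.+1)).
  rewrite -{1}[(j * k)%N]add0n big_addn mulSn addnK big_nat [RHS]big_nat.
  apply: eq_bigr => r /andP[_ rk]; congr (f (_ + _)).
  by rewrite divnDr ?dvdn_mull // mulnK // (divn_small rk) mulnS; lia.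
rewrite e1 e2 big_nat_recr //=; set S := \sum_(_ <= _ < _) _; set x := f _.
have kx : k%:R * x <= S.
  have -> : k%:R * x = \sum_(0 <= r < k) x by rewrite sumr_const_nat subn0 mulr_natl.
  rewrite /S big_nat [leRHS]big_nat; apply: ler_sum => r /andP[_ rk].
  by apply: f_decr; rewrite leq_add2l leq_add2r ltnW.
rewrite mulrAC ler_pdivrMr ?ltr0n // -natr1; move: kx.
by move: (k%:R) => y; lra.
Qed.

Hypothesis f_ge0 : forall i, 0 <= f i.

(** In each block of k indices only one is repeated; the incomplete last block
    accounts for the additive constant. *)
Lemma sum_repeat_le (k K : nat) : (0 < k)%N ->
  \sum_(0 <= i < K) f (i - i %/ k.+1)
    <= (1 + k%:R^-1) * \sum_(0 <= j < K %/ k.+1 * k) f j + k.+1%:R * f 0%N.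
Proof.
move=> k0; set J := (K %/ k.+1)%N.
have JK : (J * k.+1 <= K)%N by exact: leq_trunc_div.
rewrite (@big_cat_nat _ _ _ (J * k.+1) 0 K) //=; apply: lerD; last first.
  apply: (@le_trans _ _ (\sum_(J * k.+1 <= i < K) f 0%N)).
    by apply: ler_sum => i _; exact: f_decr.
  rewrite sumr_const_nat -[leLHS]mulr_natl ler_wpM2r // ler_nat.
  by rewrite leq_subLR /J {1}(divn_eq K k.+1) leq_add2l ltnW // ltn_pmod.
rewrite !big_nat_mul mulr_sumr; apply: ler_sum => j _.
have e1 : \sum_(j * k <= i < j.+1 * k) f i = \sum_(0 <= r < k) f (r + j * k).
  by rewrite -{1}[(j * k)%N]add0n big_addn mulSn addnK.
have e2 : \sum_(j * k.+1 <= i < j.+1 * k.+1) f (i - i %/ k.+1) = \sum_(0 <= r < k.+1) f (r + j * k).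
  rewrite -{1}[(j * k.+1)%N]add0n big_addn mulSn addnK big_nat [RHS]big_nat.
  apply: eq_bigr => r /andP[_ rk]; congr f.
  by rewrite divnDr ?dvdn_mull // mulnK // (divn_small rk) mulnS; lia.
rewrite e1 e2 big_nat_recr //=; set S := \sum_(_ <= _ < _) _; set x := f _.
have kx : k%:R * x <= S.
  have -> : k%:R * x = \sum_(0 <= r < k) x by rewrite sumr_const_nat subn0 mulr_natl.
  rewrite /S big_nat [leRHS]big_nat; apply: ler_sum => r /andP[_ rk].
  by apply: f_decr; rewrite leq_add2r ltnW.
by rewrite mulrDl mul1r lerD2l ler_pdivlMl ?ltr0n.
Qed.

End BlockSums.

(** * Doubly exponential growth *)

Section Growth.
Context {R : realType}.

Lemma bernoulli (x : R) i : 1 <= x -> 1 + i%:R * (x - 1) <= x ^+ i.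
Proof.
move=> x1; elim: i => [|i IH]; first by rewrite expr0 mul0r addr0.
rewrite exprS; apply: (@le_trans _ _ (x * (1 + i%:R * (x - 1)))).
  rewrite -natr1 -subr_ge0.
  have -> : x * (1 + i%:R * (x - 1)) - (1 + (i%:R + 1) * (x - 1)) = i%:R * (x - 1) ^+ 2 by ring.
  by rewrite mulr_ge0 // sqr_ge0.
by rewrite ler_wpM2l // (le_trans ler01).
Qed.

(** Doubly exponential decay is summable, with its first term dominating. *)
Lemma sum_expR_double (a x : R) n : 0 < a -> 1 <= x -> expR (- (a * (x - 1))) <= 2^-1 ->
  \sum_(0 <= i < n) expR (- (a * x ^+ i)) <= 2 * expR (- a).
Proof.
move=> a0 x1; set r := expR (- (a * (x - 1))) => r2.
have r0 : 0 < r by apply: expR_gt0.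
have term i : expR (- (a * x ^+ i)) <= expR (- a) * r ^+ i.
  rewrite /r -expRM_natl -expRD ler_expR -subr_ge0.
  have -> : - a + i%:R * - (a * (x - 1)) - - (a * x ^+ i) = a * (x ^+ i - (1 + i%:R * (x - 1))) by ring.
  by rewrite mulr_ge0 ?(ltW a0) // subr_ge0 bernoulli.
apply: (@le_trans _ _ (\sum_(0 <= i < n) expR (- a) * r ^+ i)); first exact: ler_sum.
rewrite -mulr_sumr mulrC ler_wpM2r ?expR_ge0 //.
suff H k : \sum_(0 <= i < k) r ^+ i <= 2 - 2 * r ^+ k.
  by apply: le_trans (H n) _; rewrite gerBl mulr_ge0 // exprn_ge0 // ltW.
elim: k => [|k IH]; first by rewrite big_geq // expr0; lra.
rewrite big_nat_recr //= exprS.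
have rk : 0 <= r ^+ k by rewrite exprn_ge0 // ltW.
have : r * r ^+ k <= 2^-1 * r ^+ k by rewrite ler_wpM2r.
by move: IH; lra.
Qed.

Lemma near_le_loglog (q c : R) : 1 < q ->
  \forall m \near \oo, c <= ln (ln m.+1%:R) / ln q.
Proof.
move=> q1; have lq : 0 < ln q by rewrite ln_gt0.
have := near_le_powR (expR (expR (c * ln q))) (ltr01 : 0 < 1 :> R).
apply: filterS => m; rewrite powRr1 // => h.
have h1 : expR (c * ln q) <= ln m.+1%:R.
  by rewrite -[leLHS]expRK ler_ln ?posrE ?expR_gt0.
rewrite ler_pdivlMr // -[leLHS]expRK ler_ln ?posrE ?expR_gt0 //.
by apply: lt_le_trans h1; exact: expR_gt0.
Qed.

Lemma powR_loglog (q : R) (x : R) : 1 < q -> 1 < x -> q `^ (ln (ln x) / ln q) = ln x.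
Proof.
move=> q1 x1; have lq : 0 < ln q by rewrite ln_gt0.
have lx : 0 < ln x by rewrite ln_gt0.
rewrite /powR gt_eqF ?(lt_trans ltr01) // mulrVK ?unitfE ?gt_eqF //.
by rewrite lnK.
Qed.

Lemma near_le_nat (c : R) : \forall m \near \oo, c <= m.+1%:R.
Proof. by have := near_le_powR c (ltr01 : 0 < 1 :> R); apply: filterS => m; rewrite powRr1. Qed.

Lemma near_le_ln (c : R) : \forall m \near \oo, c <= ln m.+1%:R :> R.
Proof.
have := near_le_nat (expR c); apply: filterS => m h.
by rewrite -[leLHS]expRK ler_ln ?posrE ?expR_gt0.
Qed.

Lemma near_le_expn (q c : R) : 1 < q -> \forall j \near \oo, c <= q ^+ j.
Proof.
move=> q1; have q0 : 0 < q - 1 by rewrite subr_gt0.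
exists (Num.truncn (c / (q - 1))).+1 => // j /= cj.
apply: (@le_trans _ _ (1 + j%:R * (q - 1))); last exact: bernoulli (ltW q1).
apply: (@le_trans _ _ (j%:R * (q - 1))); last by rewrite lerDr.
rewrite -ler_pdivrMr //; apply: le_trans (ltW (truncnS_gt _)) _.
by rewrite ler_nat.
Qed.

End Growth.

Section ProfileSums.
Context {R : realType} (A x g kap : R).
Hypotheses (A0 : 0 < A) (x1 : 1 < x) (g0 : 0 <= g) (kapE : kap * (x - 1) = g).

Let B j := A * x ^+ j.

Let kap0 : 0 <= kap.
Proof. by rewrite -(pmulr_lge0 _ (_ : 0 < x - 1)) ?kapE // subr_gt0. Qed.

(** Geometric sums are dominated by their last term, and kap is chosen to make
    the bound telescope. *)
Lemma profile_sum i : \sum_(1 <= j < i.+1) g * B j <= kap * B i.+1.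
Proof.
elim: i => [|i IH].
  by rewrite big_geq // mulr_ge0 // mulr_ge0 ?(ltW A0) // exprn_ge0 // ltW // (lt_trans ltr01).
rewrite big_nat_recr //=; apply: (@le_trans _ _ (kap * B i.+1 + g * B i.+1)).
  by rewrite lerD2r.
by rewrite -kapE /B [x ^+ i.+2]exprS; apply/eq_ler; ring.
Qed.

Lemma profile_sum_both K s : (s <= 2 * K)%N ->
  \sum_(1 <= l < s) g * B (minn l (s - l)) <= 2 * (kap * B K.+1).
Proof.
move=> sK.
have gB j : 0 <= g * B j.
  by rewrite mulr_ge0 // mulr_ge0 ?(ltW A0) // exprn_ge0 // ltW // (lt_trans ltr01).
pose y j := if (j <= K)%N then g * B j else 0.
have y0 j : 0 <= y j by rewrite /y; case: ifP.
have ysum : \sum_(1 <= l < s) y l <= kap * B K.+1.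
  case: (posnP s) => [->|s0].
    rewrite big_geq // mulr_ge0 // mulr_ge0 ?(ltW A0) // exprn_ge0 //.
    by rewrite ltW // (lt_trans ltr01).
  apply: (@le_trans _ _ (\sum_(1 <= l < s + K.+1) y l)).
    rewrite [leRHS](@big_cat_nat _ _ _ s) ?leq_addr //= lerDl.
    by apply: sumr_ge0 => l _; exact: y0.
  rewrite (@big_cat_nat _ _ _ K.+1) ?leq_addl //= [X in _ + X]big1_seq.
    rewrite addr0; apply: le_trans (profile_sum K); rewrite big_nat [leRHS]big_nat.
    by apply: ler_sum => l /andP[_ lK]; rewrite /y -ltnS lK.
  by move=> l; rewrite mem_index_iota => /andP[_ /andP[Kl _]]; rewrite /y leqNgt Kl.
apply: (@le_trans _ _ (\sum_(1 <= l < s) (y l + y (s - l)%N))).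
  rewrite big_nat [leRHS]big_nat; apply: ler_sum => l /andP[l1 ls].
  rewrite /minn; case: ltnP => h.
    have lK : (l <= K)%N by move: h sK; clear; lia.
    by rewrite {1}/y lK lerDl.
  have lK : (s - l <= K)%N by move: h sK; clear; lia.
  by rewrite {2}/y lK lerDr.
rewrite big_split /= mulr_natl mulr2n; apply: lerD => //.
rewrite big_nat_rev /= big_nat; under eq_bigr => l /andP[l1 ls].
  have -> : (s - (1 + s - l.+1) = l)%N by move: l1 ls; clear; lia.
  over.
by rewrite -big_nat.
Qed.

End ProfileSums.

(** * Estimates for the separating profile *)

Section SeparationEstimate.
Context {R : realType} {m : nat} {d : 'I_m.+1 -> nat} {dO : measure_display}
  {Omega : measurableType dO} {Q : probability Omega R} {L : {RV Q >-> R}}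
  (G : weighted_cm d L).
Hypothesis L_ge0 : {ae Q, forall w, 0 <= L w}.
Local Notation N := #|half_edge d|.
Local Notation n := (m.+1%:R : R).
Variables (A x sig delta c c1 c2 : R) (K : nat).
Let B j := A * x ^+ j.
Let b j := expR (B j).
Let ell i := quantile L (2 * B i).
Let g : R := 1 - sig + 3 * delta.
Let kap := sig - 3 * delta.
Hypotheses (x1 : 1 < x) (sig01 : 0 < sig < 1) (dl0 : 0 < delta)
  (kap0 : 0 < kap) (kapE : kap * (x - 1) = g) (A1 : 1 <= A) (Ax : 1 <= A * (x - 1))
  (c1A : c1 <= expR (delta * A)) (c2A : c2 <= expR (delta * A))
  (hA : expR (- (delta * A * (x - 1))) <= 2^-1)
  (Nn : N%:R <= c * n) (KN : (4 * (2 * K).+1 <= N)%N) (D1 : forall v, (1 <= cm_degree d v)%N)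
  (growthP : forall j, (j <= K)%N -> growth d b j <= c1 * b j `^ (1 - sig + 2 * delta))
  (excessP : forall j, (j <= K)%N -> excess d b j <= c2 * b j `^ (- (sig - delta)))
  (BK : B K.+1 <= 8^-1 * ln n).

Let A0 : 0 < A. Proof. exact: lt_le_trans A1. Qed.

Let x0 : 0 < x. Proof. exact: lt_trans x1. Qed.

Let B_ge j : A <= B j.
Proof. by rewrite /B ler_peMr ?(ltW A0) // exprn_ege1 // ltW. Qed.

Let B_gt0 j : 0 < B j.
Proof. exact: lt_le_trans (B_ge j). Qed.

Let g0 : 0 <= g.
Proof. by rewrite /g; move: sig01 dl0 => /andP[_]; lra. Qed.

Let b_powR j s : b j `^ s = expR (s * B j).
Proof. by rewrite /b -expRM mulrC. Qed.

Lemma growth_le j : (j <= K)%N -> growth d b j <= expR (g * B j).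
Proof.
move=> jK; apply: le_trans (growthP jK) _; rewrite b_powR.
apply: (@le_trans _ _ (expR (delta * A) * expR ((1 - sig + 2 * delta) * B j))).
  by rewrite ler_wpM2r ?expR_ge0.
rewrite -expRD ler_expR /g -subr_ge0.
have -> : (1 - sig + 3 * delta) * B j - (delta * A + (1 - sig + 2 * delta) * B j) =
  delta * (B j - A) by ring.
by rewrite mulr_ge0 ?(ltW dl0) // subr_ge0.
Qed.

Lemma excess_le j : (j <= K)%N -> excess d b j <= expR (- (sig - 2 * delta) * B j).
Proof.
move=> jK; apply: le_trans (excessP jK) _; rewrite b_powR.
apply: (@le_trans _ _ (expR (delta * A) * expR (- (sig - delta) * B j))).
  by rewrite ler_wpM2r ?expR_ge0.
rewrite -expRD ler_expR -subr_ge0.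
have -> : - (sig - 2 * delta) * B j - (delta * A + - (sig - delta) * B j) =
  delta * (B j - A) by ring.
by rewrite mulr_ge0 ?(ltW dl0) // subr_ge0.
Qed.

Let growth_ge0 j : 0 <= growth d b j.
Proof. by rewrite /growth mulr_ge0 ?divr_ge0 // /pairs_at sumr_ge0. Qed.

Lemma growth_prod i : (i <= K)%N -> \prod_(1 <= j < i.+1) growth d b j <= expR (kap * B i.+1).
Proof.
move=> iK; apply: (@le_trans _ _ (\prod_(1 <= j < i.+1) expR (g * B j))).
  rewrite big_nat [leRHS]big_nat; apply: ler_prod => j /andP[_ ji].
  by rewrite growth_ge0 growth_le // (leq_trans _ iK).
by rewrite -expR_sum ler_expR; exact: (profile_sum A0 x1 g0 kapE).
Qed.

Let c_ge0 : 0 <= c.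
Proof. by rewrite -(pmulr_lge0 _ (ltr0Sn R m)); apply: le_trans Nn. Qed.

Let Nn_c : N%:R / n <= c.
Proof. by rewrite ler_pdivrMr. Qed.

(** There are about exp (kap B_i) walks of i steps within the profile. Since
    kap = sig - 3 delta, this is less than both the inverse of the probability
    of leaving the profile and the inverse of that of an edge shorter than
    ell_i. *)
Lemma side_bound_le : side_bound d L b ell K <= c * (6 * expR (- (delta * A))).
Proof.
rewrite /side_bound; apply: ler_pM Nn_c _; first by rewrite divr_ge0.
  rewrite addr_ge0 //.
    by rewrite /excess mulr_ge0 ?divr_ge0 // /half_edges_at.
  apply: sumr_ge0 => i _; rewrite mulr_ge0 ?prodr_ge0 // addr_ge0 //.
    by rewrite /excess mulr_ge0 ?divr_ge0 // /half_edges_at.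
  by rewrite mulr_ge0 // length_law_ge0.
apply: (@le_trans _ _ (3 * \sum_(0 <= i < K.+1) expR (- (delta * A * x ^+ i)))); last first.
  have -> : 6 * expR (- (delta * A)) = 3 * (2 * expR (- (delta * A))) by ring.
  by rewrite ler_wpM2l // sum_expR_double // ?mulr_gt0 // ltW.
have Be i : delta * A * x ^+ i = delta * B i by rewrite /B mulrA.
rewrite [X in _ <= 3 * X]big_ltn // mulrDr mulr_sumr; apply: lerD.
  rewrite expr0 mulr1; apply: le_trans (excess_le (leq0n K)) _.
  apply: (@le_trans _ _ (expR (- (delta * A)))).
    rewrite ler_expR /B expr0 mulr1 -subr_ge0.
    have -> : - (delta * A) - - (sig - 2 * delta) * A = kap * A by rewrite /kap; ring.
    by rewrite mulr_ge0 // ltW.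
  by have := expR_ge0 (- (delta * A)); move: (expR _) => z; lra.
rewrite big_nat [leRHS]big_nat; apply: ler_sum => i /andP[i1 iK]; rewrite Be.
have iK' : (i <= K)%N by [].
have pi : \prod_(1 <= j < i) growth d b j <= expR (kap * B i).
  by case: (i) i1 iK' => // i' _ iK'; apply: growth_prod; exact: ltnW.
have ei := excess_le iK'.
have li : length_law L `]-oo, ell i[%classic <= expR (- (2 * B i)).
  by apply: length_law_below_quantile => //; exact: expR_gt0.
apply: (@le_trans _ _ (expR (kap * B i) * (expR (- (sig - 2 * delta) * B i) + 2 * expR (- (2 * B i))))).
  apply: ler_pM => //; first by rewrite prodr_ge0.
    rewrite addr_ge0 //; last by rewrite mulr_ge0 // length_law_ge0.
    by rewrite /excess mulr_ge0 ?divr_ge0 // /half_edges_at.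
  by rewrite lerD // ler_wpM2l.
have -> : expR (kap * B i) * (expR (- (sig - 2 * delta) * B i) + 2 * expR (- (2 * B i))) =
  expR (kap * B i + - (sig - 2 * delta) * B i) + 2 * expR (kap * B i + - (2 * B i)).
  by rewrite !expRD; ring.
have -> : kap * B i + - (sig - 2 * delta) * B i = - (delta * B i) by rewrite /kap; ring.
have : expR (kap * B i + - (2 * B i)) <= expR (- (delta * B i)).
  rewrite ler_expR -subr_ge0.
  have -> : - (delta * B i) - (kap * B i + - (2 * B i)) = (2 - kap - delta) * B i by ring.
  rewrite mulr_ge0 ?(ltW (B_gt0 _)) // /kap; move: sig01 dl0 => /andP[_]; lra.
by move: (expR _) (expR _) => y z; lra.
Qed.

(** A walk within both profiles passes at most n^(1/4) in expected number through
    the layers, while hitting the second vertex costs a factor n. *)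
Lemma meet_bound_le : meet_bound d b K <= 4 * c * n `^ (- 2^-1).
Proof.
have n0 : 0 < n by [].
have KB : K%:R <= B K.+1.
  apply: (@le_trans _ _ (A * (1 + K.+1%:R * (x - 1)))); last first.
    by rewrite /B ler_wpM2l ?(ltW A0) // bernoulli // ltW.
  rewrite mulrDr mulr1 mulrCA; apply: (@le_trans _ _ (K.+1%:R * (A * (x - 1)))).
    by rewrite -[leLHS]mulr1 ler_pM // ler_nat.
  by rewrite lerDr ltW.
have kap1 : kap <= 1 by rewrite /kap; move: sig01 dl0 => /andP[_]; lra.
have term s : (1 <= s < (2 * K).+1)%N ->
  N%:R / n * n^-1 * (\prod_(1 <= l < s) growth d b (minn l (s - l))) * 2
    <= c * n^-1 * expR (2 * B K.+1) * 2.
  move=> /andP[s1 sK]; rewrite ler_wpM2r //; apply: ler_pM.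
  - by rewrite mulr_ge0 ?divr_ge0.
  - by rewrite prodr_ge0.
  - by rewrite ler_wpM2r ?invr_ge0.
  apply: (@le_trans _ _ (\prod_(1 <= l < s) expR (g * B (minn l (s - l))))).
    rewrite big_nat [leRHS]big_nat; apply: ler_prod => l /andP[l1 ls].
    have mK : (minn l (s - l) <= K)%N by move: l1 ls sK; clear; lia.
    by rewrite growth_ge0 growth_le.
  rewrite -expR_sum ler_expR.
  apply: le_trans (profile_sum_both A0 x1 g0 kapE (_ : (s <= 2 * K)%N)) _ => //.
  by rewrite ler_wpM2l // -/(B K.+1) ler_piMl // ltW.
rewrite /meet_bound big_nat; apply: le_trans (ler_sum _ (fun s h => term s h)) _.
rewrite -big_nat sumr_const_nat subSS subn0 -[leLHS]mulr_natl natrM.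
have eB : expR (B K.+1) <= n `^ 8^-1.
  by rewrite /powR gt_eqF // ler_expR.
have KeB : K%:R <= n `^ 8^-1.
  apply: le_trans eB; apply: le_trans KB _.
  by apply: le_trans (expR_ge1Dx _); rewrite lerDr.
have e2 : expR (2 * B K.+1) <= n `^ 4^-1.
  rewrite /powR gt_eqF // ler_expR.
  have -> : 4^-1 * ln n = 2 * (8^-1 * ln n) by field.
  by rewrite ler_wpM2l.
apply: (@le_trans _ _ (4 * c * (n `^ 8^-1 * (n^-1 * n `^ 4^-1)))).
  have -> : 2 * K%:R * (c * n^-1 * expR (2 * B K.+1) * 2) =
    4 * c * (K%:R * (n^-1 * expR (2 * B K.+1))) by ring.
  rewrite ler_wpM2l ?mulr_ge0 //; apply: ler_pM => //.
  by rewrite ler_wpM2l ?invr_ge0.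
rewrite ler_wpM2l ?mulr_ge0 //.
have -> : n^-1 = n `^ (- 1) by rewrite powRN powRr1.
have nn : n != 0 by rewrite gt_eqF.
rewrite -!powRD ?nn ?implybT //; apply: ler_powR; first by rewrite ler1n.
lra.
Qed.

End SeparationEstimate.

(** * The lower bound *)

Lemma powR_gt1 (R : realType) (a e : R) : 1 < a -> 0 < e -> 1 < a `^ e.
Proof.
move=> a1 e0; have a0 : 0 < a by apply: lt_trans a1.
by rewrite /powR gt_eqF // -expR0 ltr_expR mulr_gt0 // ln_gt0.
Qed.

Section TypicalDistance.
Context {R : realType} {dO : measure_display} {Omega : measurableType dO}
  {Q : probability Omega R} (L : {RV Q >-> R}) (tau : R).
Hypotheses (tau23 : 2 < tau < 3) (L_ge0 : {ae Q, forall w, 0 <= L w}).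

Let q := (tau - 2)^-1.

Definition loglog (x : R) : R := ln (ln x) / ln q.

Lemma sig01 : 0 < tau - 2 < 1.
Proof. by move: tau23 => /andP[a b]; apply/andP; split; lra. Qed.

Lemma q_gt1 : 1 < q.
Proof. by have /andP[s0 s1] := sig01; rewrite /q invf_gt1. Qed.

Lemma q_gt0 : 0 < q.
Proof. exact: lt_trans q_gt1. Qed.

Lemma ln_q_gt0 : 0 < ln q.
Proof. by rewrite ln_gt0 // q_gt1. Qed.

Lemma abs_ln_sig : `|ln (tau - 2)| = ln q.
Proof.
have /andP[s0 s1] := sig01.
by rewrite /q lnV ?posrE // ler0_norm // ln_le0 // ltW.
Qed.

Lemma typical_hopsE n : typical_hops tau n = 2 * loglog n%:R.
Proof. by rewrite /typical_hops abs_ln_sig /loglog mulrA. Qed.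

Lemma typical_distE n : typical_dist tau (cdf L) n =
  \sum_(1 <= i < (Num.truncn (loglog n%:R)).+1) quantile L (q ^+ i).
Proof. by rewrite /typical_dist abs_ln_sig. Qed.

Lemma quantile_q_decr i j : (i <= j)%N -> quantile L (q ^+ j) <= quantile L (q ^+ i).
Proof.
move=> ij; apply: quantile_decr => //; first by rewrite exprn_gt0 // q_gt0.
by rewrite ler_eXn2l // q_gt1.
Qed.

Lemma quantile_q_ge0 i : 0 <= quantile L (q ^+ i).
Proof. by apply: quantile_nonneg => //; rewrite exprn_gt0 // q_gt0. Qed.

Hypothesis explosion_free :
  (\sum_(1 <= k <oo) (generalised_inverse (cdf L) (expR (- expR k%:R)))%:E = +oo)%E.

Lemma near_le_typical_dist (B : R) : \forall m \near \oo, B <= typical_dist tau (cdf L) m.+1.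
Proof.
have [J JB] := quantile_sum_unbounded L_ge0 explosion_free q_gt1 (B + quantile L (q ^+ 0)).
have := near_le_loglog J%:R q_gt1; apply: filterS => m mJ.
rewrite typical_distE; set K := Num.truncn _.
have JK : (J <= K)%N by rewrite /K truncn_ge_nat ?(le_trans _ mJ).
have : \sum_(0 <= j < J) quantile L (q ^+ j) <= \sum_(0 <= j < K.+1) quantile L (q ^+ j).
  rewrite [leRHS](@big_cat_nat _ _ _ J) ?leqW //= lerDl.
  by apply: sumr_ge0 => i _; exact: quantile_q_ge0.
by rewrite [leRHS]big_ltn //; move: JB; lra.
Qed.

End TypicalDistance.

Section LowerBound.
Context {R : realType}.
Variables (tau : R) (d : forall m, 'I_m.+1 -> nat) (alpha kappa : R) (FB : R -> R).
Arguments d : clear implicits.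
Hypotheses (tau23 : 2 < tau < 3) (d2 : forall m v, (2 <= d m v)%N) (kappa0 : 0 < kappa)
  (alpha2 : 2^-1 < alpha)
  (tvB : forall m, (dTV (biased_cdf (d m)) FB <= (m.+1%:R `^ (- kappa))%:E)%E)
  (tail : forall delta : R, 0 < delta -> exists2 C1 : R, 1 <= C1 &
     forall m x, 1 <= x < m.+1%:R `^ alpha ->
       m.+1%:R * C1^-1 * x `^ (- (tau - 1 + delta)) <= count_above (d m) x
         <= m.+1%:R * C1 * x `^ (- (tau - 1 - delta))).
Context {dO : measure_display} {Omega : measurableType dO}
  {Q : probability Omega R} (L : {RV Q >-> R}) (G : forall m : nat, weighted_cm (d m) L).
Hypotheses (L_ge0 : {ae Q, forall w, 0 <= L w})
  (explosion_free :
  (\sum_(1 <= k <oo) (generalised_inverse (cdf L) (expR (- expR k%:R)))%:E = +oo)%E).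

Let q := (tau - 2)^-1.
Let q1 : 1 < q := q_gt1 tau23.
Let sig := tau - 2.

Lemma eight_steps_le (K : nat) (e z : R) : K.+1%:R <= 8^-1 * e -> 4 <= e -> e <= z ->
  4 * (2 * K).+1%:R <= z * 2.
Proof. by rewrite -[K.+1%:R]natr1 -[(2 * K).+1%:R]natr1 natrM; move: (K%:R : R) => a; lra. Qed.

(** A factor is lost by thinning, another one by the boundary terms C. *)
Lemma loss_two_factors (eps p S T C : R) : 0 < eps -> 0 <= p -> 1 - eps / 2 <= p ->
  0 <= S -> 0 <= T -> T <= S + C -> C <= eps / 2 * T -> (1 - eps) * T <= p * S.
Proof.
move=> e0 p0 pe S0 T0 TS Ce; have [e2|e2] := lerP 1 eps.
  by apply: (@le_trans _ _ 0); [rewrite mulr_le0_ge0 // subr_le0|rewrite mulr_ge0].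
apply: (@le_trans _ _ ((1 - eps / 2) * ((1 - eps / 2) * T))).
  by rewrite mulrA ler_wpM2r //; nra.
have e3 : 0 <= 1 - eps / 2 by lra.
by apply: ler_pM; rewrite ?mulr_ge0 //; lra.
Qed.

(** The profile grows at the rate x = q^(1 + 1/k), so that k of its layers
    correspond to k + 1 layers of the sum a_n. The exponent delta leaves room for
    the errors in the power law, and K is about the last index for which the
    profile remains below a small power of n. *)
Lemma near_small_close_path (eps eta : R) : 0 < eps -> 0 < eta ->
  \forall m \near \oo, small (wcm_prob (G m)) (matched (G m) `&` [set w | ~ forall p,
     wcm_is_path w p -> (1 - eps) * typical_hops tau m.+1 <= (size p)%:R /\
     (1 - eps) * (2 * typical_dist tau (cdf L) m.+1) <= wcm_path_length w p]) eta.
Proof.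
move=> eps0 eta0.
have alpha0 : 0 < alpha by apply: lt_trans alpha2; rewrite invr_gt0.
have alpha8 : 8^-1 < alpha by apply: lt_trans alpha2; lra.
have /andP[s0 s1] := sig01 tau23; rewrite -/sig in s0 s1.
have q0 : 0 < q by exact: lt_trans q1.
pose k := (Num.truncn (2 / eps)).+1.
have k0 : (0 < k)%N by [].
have kR : 0 < k%:R :> R by rewrite ltr0n.
have keps : 1 - eps / 2 <= k%:R / k.+1%:R.
  rewrite ler_pdivlMr // -[k.+1%:R]natr1.
  have : 2 < k%:R * eps by rewrite -ltr_pdivrMr // truncnS_gt.
  by move: (k%:R) kR => z z0; nra.
pose x := q `^ (1 + k%:R^-1).
have x0 : 0 < x by apply: powR_gt0.
have sx : 1 < sig * x.
  rewrite /x powRD ?(gt_eqF q0) ?implybT // powRr1 ?(ltW q0) // mulrA.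
  rewrite /q -/sig divff ?gt_eqF // mul1r.
  by apply: powR_gt1; rewrite ?invr_gt0.
have x1 : 1 < x by nra.
pose delta := (sig * x - 1) / (3 * x).
have dl0 : 0 < delta by rewrite divr_gt0 ?mulr_gt0 // subr_gt0.
have dlE : 3 * delta * x = sig * x - 1 by rewrite /delta; field; rewrite gt_eqF.
pose kap := sig - 3 * delta.
have kap0 : 0 < kap.
  by rewrite /kap subr_gt0; have : (sig - 3 * delta) * x = 1 by [rewrite mulrBl dlE; ring]; nra.
have kapE : kap * (x - 1) = 1 - sig + 3 * delta.
  by rewrite /kap mulrBr mulrBl dlE; ring.
have dl1 : delta < sig by move: kap0; rewrite /kap; lra.
have dl2 : 2 * delta <= tau - 1 by move: dl1 s1; rewrite /sig; lra.
have [c c_gt0 Nlin] := card_half_edge_linear d2 kappa0 tvB.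
have [c1 c1_gt0 growthP] := growth_bound tau23 d2 tail dl0 dl2.
have [c2 c2_gt0 excessP] := excess_bound tau23 d2 kappa0 alpha0 tvB tail dl0 dl1.
(* the scale A at which the profile starts *)
have [c0 [A1 Ax [c1A c2A] hA hE]] : exists c0 : nat, [/\ 1 <= q ^+ c0, 1 <= q ^+ c0 * (x - 1),
    c1 <= expR (delta * q ^+ c0) /\ c2 <= expR (delta * q ^+ c0),
    expR (- (delta * q ^+ c0 * (x - 1))) <= 2^-1 &
    2 * (c * (6 * expR (- (delta * q ^+ c0)))) <= eta / 2].
  have x10 : 0 < x - 1 by rewrite subr_gt0.
  have e1 := near_le_expn (1 / (x - 1)) q1.
  have e2 := near_le_expn (ln c1 / delta) q1.
  have e3 := near_le_expn (ln c2 / delta) q1.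
  have e4 := near_le_expn (ln 2 / (delta * (x - 1))) q1.
  have e5 := near_le_expn (ln (24 * c / eta) / delta) q1.
  have [j0 _ jP] := filterI e1 (filterI e2 (filterI e3 (filterI e4 e5))).
  exists j0; have [h1 [h2 [h3 [h4 h5]]]] := jP j0 (leqnn _).
  split.
  - by rewrite exprn_ege1 // ltW.
  - by rewrite -ler_pdivrMr.
  - split; first by rewrite -[leLHS]lnK ?posrE // ler_expR [leRHS]mulrC -ler_pdivrMr.
    by rewrite -[leLHS]lnK ?posrE // ler_expR [leRHS]mulrC -ler_pdivrMr.
  - rewrite expRN lef_pV2 ?posrE ?expR_gt0 // -[leLHS]lnK ?posrE // ler_expR.
    by rewrite mulrAC [leRHS]mulrC -ler_pdivrMr // mulr_gt0.
  - have : 24 * c / eta <= expR (delta * q ^+ j0).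
      by rewrite -[leLHS]lnK ?posrE ?divr_gt0 ?mulr_gt0 // ler_expR [leRHS]mulrC -ler_pdivrMr.
    rewrite expRN ler_pdivrMr // => h.
    have E0 := expR_gt0 (delta * q ^+ j0).
    move: h E0; move: (expR _) => z h z0.
    have -> : 2 * (c * (6 * z^-1)) = (24 * c) / z / 2 by field; rewrite gt_eqF.
    by rewrite ler_pM2r ?invr_gt0 // ler_pdivrMr // [leRHS]mulrC.
have [c3 qc3] : exists c3 : nat, Num.max 8 kappa^-1 <= q ^+ c3.
  by have [j0 _ jP] := near_le_expn (Num.max 8 kappa^-1) q1; exists j0; exact: jP (leqnn _).
have [c4 qc4] : exists c4 : nat, 2 <= q ^+ c4.
  by have [j0 _ jP] := near_le_expn 2 q1; exists j0; exact: jP (leqnn _).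
(* the layers of the sum that are lost at its two ends *)
pose C0 := (c0 + c3 + 2)%N.
pose f j := quantile L (q ^+ j).
pose Cd : R := ((c0 + c4 + 2) + (C0 + k.+2))%:R * f 0%N.
have n1 := near_le_loglog (C0%:R : R) q1.
have n2 := near_le_loglog (2 / eps * (C0 + k.+2)%:R : R) q1.
have n3 := near_le_typical_dist tau23 L_ge0 explosion_free (2 / eps * Cd).
have n4 : \forall m \near \oo, m.+1%:R `^ (-1) <= eta / 4 :> R.
  by apply: near_powRN_le; rewrite // divr_gt0.
have n5 : \forall m \near \oo, m.+1%:R `^ (- 2^-1) <= eta / (16 * c) :> R.
  by apply: near_powRN_le; rewrite ?invr_gt0 // divr_gt0 // mulr_gt0.
have n6 := near_le_ln (4 : R).
near=> m.
have Nn : #|half_edge (d m)|%:R <= c * m.+1%:R by near: m.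
have exP (e : R) : 2 <= e <= m.+1%:R `^ kappa ->
    2 / #|half_edge (d m)|%:R * half_edges_at (d m) [pred v | e < (cm_degree (d m) v)%:R]
      <= c2 * e `^ (- (sig - delta)).
  by move: e; near: m.
have m1 : C0%:R <= loglog tau m.+1%:R by near: m.
have m2 : 2 / eps * (C0 + k.+2)%:R <= loglog tau m.+1%:R by near: m.
have m3 : 2 / eps * Cd <= typical_dist tau (cdf L) m.+1 by near: m.
have m4 : m.+1%:R `^ (-1) <= eta / 4 :> R by near: m.
have m5 : m.+1%:R `^ (- 2^-1) <= eta / (16 * c) :> R by near: m.
have m6 : 4 <= ln m.+1%:R :> R by near: m.
pose kk := Num.truncn (loglog tau m.+1%:R).
have ll0 : 0 <= loglog tau m.+1%:R by apply: le_trans m1.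
have kk1 : kk%:R <= loglog tau m.+1%:R by have /andP[] := truncn_itv ll0.
have kk2 : loglog tau m.+1%:R < kk.+1%:R by exact: truncnS_gt.
have Ckk : (C0 <= kk)%N by rewrite /kk truncn_ge_nat.
pose J := ((kk - C0) %/ k.+1)%N.
have J1 : (J * k.+1 <= kk - C0)%N by exact: leq_trunc_div.
have J2 : (kk - C0 < (J * k.+1 + k.+1))%N by rewrite addnC -mulSn; exact: ltn_ceil.
pose K := (J * k)%N.
pose b := fun j : nat => expR (q ^+ c0 * x ^+ j).
pose ell := fun i : nat => quantile L (2 * (q ^+ c0 * x ^+ i)).
have xle i a : (i <= k * a)%N -> x ^+ i <= q ^+ (i + a).
  move=> ia; rewrite -(powR_mulrn i (ltW x0)) -(powR_mulrn (i + a) (ltW q0)) /x -powRrM.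
  rewrite ler_powR ?(ltW q1) // mulrDl mul1r natrD lerD2l.
  by rewrite mulrC ler_pdivrMr // -natrM ler_nat mulnC.
have n_gt0 : 0 < m.+1%:R :> R by [].
have qkk : q ^+ kk <= ln m.+1%:R.
  rewrite -(powR_loglog q1 (_ : 1 < m.+1%:R)) -?powR_mulrn ?(ltW q0) //.
    by rewrite ler_powR ?(ltW q1).
  by rewrite -ltr_ln ?posrE // ln1 (lt_le_trans _ m6).
have qc30 : 0 < q ^+ c3 by rewrite exprn_gt0.
have Bq : q ^+ c3 * (q ^+ c0 * x ^+ K.+1) <= ln m.+1%:R.
  apply: le_trans qkk; rewrite mulrA -exprD.
  apply: (@le_trans _ _ (q ^+ (c3 + c0) * q ^+ (K.+1 + J.+1))).
    rewrite ler_wpM2l ?exprn_ge0 ?(ltW q0) // xle // /K.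
    by rewrite mulnS [(J * k)%N]mulnC -add1n leq_add2r.
  rewrite -exprD ler_eXn2l //; move: J1 Ckk; rewrite /K /C0.
  by move: (J) (k) (c0) (c3) (kk); clear; move=> a b c1 c2 e; rewrite mulnS; lia.
have [q8 qkap] : 8 <= q ^+ c3 /\ kappa^-1 <= q ^+ c3 by apply/andP; rewrite -ge_max.
have Bpos i : 0 < q ^+ c0 * x ^+ i by rewrite mulr_gt0 ?exprn_gt0.
have BK : q ^+ c0 * x ^+ K.+1 <= 8^-1 * ln m.+1%:R.
  rewrite ler_pdivlMl //; apply: le_trans Bq.
  by rewrite ler_wpM2r ?(ltW (Bpos _)).
have BK' : q ^+ c0 * x ^+ K.+1 <= kappa * ln m.+1%:R.
  rewrite -ler_pdivrMl //; apply: le_trans Bq.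
  by rewrite ler_wpM2r ?(ltW (Bpos _)).
have Bmono j : (j <= K)%N -> q ^+ c0 * x ^+ j <= q ^+ c0 * x ^+ K.+1.
  move=> jK; rewrite ler_wpM2l ?exprn_ge0 ?(ltW q0) // ler_eXn2l //.
  exact: leq_trans jK (leqnSn _).
have Bge1 j : 1 <= q ^+ c0 * x ^+ j.
  by apply: le_trans A1 _; rewrite ler_peMr ?exprn_ge0 ?(ltW q0) // exprn_ege1 // ltW.
have Kln : K.+1%:R <= 8^-1 * ln m.+1%:R :> R.
  apply: le_trans BK.
  apply: (@le_trans _ _ (q ^+ c0 * (1 + K.+1%:R * (x - 1)))).
    rewrite mulrDr mulr1 mulrCA -[leLHS]add0r; apply: lerD; first by rewrite exprn_ge0 ?(ltW q0).
    by rewrite ler_peMr.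
  by rewrite ler_wpM2l ?exprn_ge0 ?(ltW q0) // bernoulli // ltW.
have KN : (4 * (2 * K).+1 <= #|half_edge (d m)|)%N.
  rewrite -(ler_nat R); apply: le_trans (card_half_edge_ge (d2 (m := m))).
  have : ln m.+1%:R <= m.+1%:R :> R by rewrite -[leRHS]lnK ?posrE // (le_trans _ (expR_ge1Dx _)) // lerDr.
  by rewrite natrM; exact: (eight_steps_le Kln m6).
have D1 v : (1 <= cm_degree (d m) v)%N.
  by apply: leq_trans (cm_degree_ge _ v); apply: leq_trans (d2 v).
have growthK j : (j <= K)%N -> growth (d m) b j <= c1 * b j `^ (1 - sig + 2 * delta).
  move=> jK; have -> : 1 - sig + 2 * delta = 3 - tau + 2 * delta by rewrite /sig; ring.
  apply: growthP; rewrite /b; apply/andP; split.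
    by rewrite -expR0 ler_expR (ltW (Bpos _)).
  rewrite /powR gt_eqF // ltr_expR; apply: le_lt_trans (le_trans (Bmono _ jK) BK) _.
  by rewrite ltr_pM2r ?(lt_le_trans _ m6).
have excessK j : (j <= K)%N -> excess (d m) b j <= c2 * b j `^ (- (sig - delta)).
  move=> jK; apply: (exP (b j)); rewrite /b; apply/andP; split.
    by apply: le_trans (expR_ge1Dx _); rewrite -[2]/(1 + 1) lerD2l.
  by rewrite /powR gt_eqF // ler_expR (le_trans (Bmono _ jK)).
have sig01' : 0 < sig < 1 by apply/andP.
have sb := side_bound_le L_ge0 x1 sig01' dl0 kap0 kapE A1 c1A c2A hA Nn growthK excessK.
have mb := meet_bound_le x1 sig01' dl0 kapE A1 Ax c1A Nn growthK BK.
have sn := small_close_path (G m) b ell KN D1 (length_law_neg L_ge0).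
apply: small_le sn; last first.
  have e1 : meet_bound (d m) b K <= eta / 4.
    apply: le_trans mb _; rewrite mulrC -ler_pdivlMr ?mulr_gt0 //.
    apply: le_trans m5 _; apply/eq_ler; field.
    by rewrite gt_eqF.
  move: m4; rewrite powR_inv1 // => m4.
  have e2 : 2 * side_bound (d m) L b ell K <= eta / 2.
    by apply: le_trans hE; rewrite ler_pM2l.
  by apply: le_trans (lerD (lerD e2 m4) e1) _; apply/eq_ler; move: (eta) => z; field.
move=> w [Mw far]; split=> //; apply: contra_not far => far p pp.
have [sp lp] := far p pp; clear far; split.
  rewrite typical_hopsE //; apply: (@le_trans _ _ (2 * K)%:R); last by rewrite ler_nat ltnW.
  rewrite mulrCA natrM ler_pM2l // /K mulnC natrM.
  have -> : k%:R * J%:R = k%:R / k.+1%:R * (J * k.+1)%:R :> R.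
    rewrite natrM; have : k.+1%:R != 0 :> R by rewrite pnatr_eq0.
    by move: (k.+1%:R) => z z0; field.
  apply: (@loss_two_factors _ _ _ _ (C0 + k.+2)%:R) => //.
    apply: le_trans (ltW kk2) _; rewrite -natrD ler_nat.
    by move: J2 Ckk; move: (J * k.+1)%N => z; clear; lia.
  by rewrite -ler_pdivrMl ?divr_gt0 // invf_div.
apply: le_trans lp; rewrite mulrCA ler_pM2l //.
pose c' := (c0 + c4 + 2)%N.
apply: (@le_trans _ _ (k%:R / k.+1%:R * \sum_(0 <= j < J * k.+1) f (c' + j)%N)); last first.
  apply: le_trans (sum_skip_ge _ _ _ _) _ => //.
    by move=> i j; exact: quantile_q_decr.
  rewrite big_add1 /=; apply: ler_sum => i _; rewrite /f /ell.
  apply: quantile_decr => //; first by rewrite mulr_gt0.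
  rewrite /c' [(c0 + c4)%N]addnC -!addnA exprD.
  apply: ler_pM => //; first exact: ltW.
  rewrite exprD ler_wpM2l ?exprn_ge0 ?(ltW q0) //.
  have -> : (2 + (i + i %/ k) = i.+1 + (i %/ k).+1)%N by rewrite addSnnS addnS addSn addnS.
  by apply: xle; rewrite mulnC ltn_ceil.
have f0 i : 0 <= f i by exact: quantile_q_ge0.
have ff i : f i <= f 0%N by exact: quantile_q_decr.
have T0 : 0 <= typical_dist tau (cdf L) m.+1.
  by rewrite typical_distE //; apply: sumr_ge0 => i _; exact: f0.
apply: (@loss_two_factors _ _ _ _ Cd) => //.
  by apply: sumr_ge0 => i _; exact: f0.
  rewrite typical_distE // -/kk.
  apply: (@le_trans _ _ (\sum_(0 <= i < c' + J * k.+1 + (C0 + k.+2)) f i)).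
    have h1 : (kk.+1 <= c' + J * k.+1 + (C0 + k.+2))%N.
      by move: J2 Ckk; move: (J * k.+1)%N => z; clear; lia.
    rewrite [leRHS](@big_cat_nat _ _ _ kk.+1) //= [X in _ <= X + _]big_ltn //.
    by rewrite -addrA addrCA lerDl addr_ge0 // sumr_ge0.
  rewrite (@big_cat_nat _ _ _ (c' + J * k.+1)) ?leq_addr //= (@big_cat_nat _ _ _ c') ?leq_addr //=.
  have h2 : \sum_(c' <= i < c' + J * k.+1) f i = \sum_(0 <= j < J * k.+1) f (c' + j)%N.
    by rewrite -{1}[c']add0n big_addn addKn; apply: eq_bigr => i _; rewrite addnC.
  have bd a e : \sum_(a <= i < e) f i <= (e - a)%:R * f 0%N.
    apply: (@le_trans _ _ (\sum_(a <= i < e) f 0%N)); first exact: ler_sum.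
    by rewrite sumr_const_nat mulr_natl.
  rewrite h2 /Cd natrD mulrDl.
  have := bd 0%N c'; have := bd (c' + J * k.+1)%N (c' + J * k.+1 + (C0 + k.+2))%N.
  rewrite addKn subn0 /c' => b1 b2; rewrite addrA [X in X + _]addrC -addrA -[leRHS]addrA lerD2l //.
  exact: lerD.
by rewrite -ler_pdivrMl ?divr_gt0 // invf_div.
Unshelve. all: by end_near.
Qed.

End LowerBound.

(** * Estimates for the climb to high degrees *)

Lemma expr_1B_le (R : realType) (s : R) r : s <= 1 -> (1 - s) ^+ r <= expR (- (s * r%:R)).
Proof.
move=> s1; rewrite -mulNr mulrC expRM_natl; apply: lerXn2r; rewrite ?nnegrE ?subr_ge0 ?expR_ge0 //.
exact: expR_ge1Dx.
Qed.

Lemma truncn_ge_half (R : realType) (x : R) : 1 <= x -> x / 2 <= (Num.truncn x)%:R.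
Proof.
move=> x1; have x0 : 0 <= x by apply: le_trans x1.
have t1 : (1 <= Num.truncn x)%N by rewrite truncn_ge_nat.
have h : 1 <= (Num.truncn x)%:R :> R by rewrite ler1n.
by have := truncnS_gt x; rewrite -[(Num.truncn x).+1%:R]natr1; move: h; lra.
Qed.

Section ClimbEstimate.
Context {R : realType} {m : nat} {d : 'I_m.+1 -> nat} {dO : measure_display}
  {Omega : measurableType dO} {Q : probability Omega R} {L : {RV Q >-> R}}
  (G : weighted_cm d L).
Hypothesis L_ge0 : {ae Q, forall w, 0 <= L w}.
Local Notation N := #|half_edge d|.
Local Notation n := (m.+1%:R : R).
Local Notation F t := (length_law L (short t)).
Variables (A An rho sig delta c0 c1 t0 eps1 : R) (K R0 : nat).
Let B j := An * rho ^+ j.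
Let y j := expR (B j).
Let Gam j := [pred v | y j < (d v)%:R].
Let r j := Num.truncn (y j / 4).
Let t j := quantile L (delta * B j).
Let Z := (2 * (R0 + \sum_(0 <= i < K) r i))%N.
Hypotheses (rho1 : 1 < rho) (sig0 : 0 < sig) (dl0 : 0 < delta)
  (dlE : 4 * rho * delta = 1 - rho * sig) (A3 : 3 <= A) (AAn : A <= An) (AnA : An <= A * rho)
  (c00 : 0 < c0) (c01 : c0 <= c1) (d2 : forall v, (2 <= d v)%N) (Nn : N%:R <= c1 * n)
  (cA : 16 * c1 / c0 <= expR (delta * A))
  (lower : forall x : R, 1 <= x <= y K ->
     c0 * n * x `^ (- (sig + delta)) <= half_edges_at d [pred v | x < (d v)%:R])
  (Zlow : (5 * (2 * Z).+1)%:R <= c0 / 2 * n * expR (- (sig + delta) * B K))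
  (Zy : (8 * Z + 4)%:R <= y K / 2) (y32 : 32 <= y K) (yn : y K <= n)
  (t00 : 0 <= t0) (Ft0 : 2^-1 <= F t0) (Ft0' : 1 - F t0 <= eps1 / 2)
  (ZN : ((2 * Z).+1 * 2)%:R / N%:R <= eps1 / 2).

Let A0 : 0 < A. Proof. exact: lt_le_trans A3. Qed.
Let An0 : 0 < An. Proof. exact: lt_le_trans AAn. Qed.
Let rho0 : 0 < rho. Proof. exact: lt_trans rho1. Qed.
Let c10 : 0 < c1. Proof. exact: lt_le_trans c01. Qed.

Let B_ge j : A <= B j.
Proof. by apply: le_trans AAn _; rewrite /B ler_peMr ?(ltW An0) // exprn_ege1 // ltW. Qed.

Let B_gt0 j : 0 < B j. Proof. exact: lt_le_trans (B_ge j). Qed.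

Let BS j : B j.+1 = rho * B j.
Proof. by rewrite /B exprS mulrCA. Qed.

Let B_mono i j : (i <= j)%N -> B i <= B j.
Proof. by move=> ij; rewrite /B ler_wpM2l ?(ltW An0) // ler_eXn2l. Qed.

Let y4 j : 4 <= y j.
Proof.
apply: le_trans (expR_ge1Dx _); have -> : 4 = 1 + 3 :> R by ring.
by rewrite lerD2l; apply: le_trans A3 (B_ge j).
Qed.

Let y_gt0 j : 0 < y j. Proof. exact: expR_gt0. Qed.

Let N2 : n * 2 <= N%:R. Proof. exact: card_half_edge_ge. Qed.

Let N0 : 0 < N%:R :> R. Proof. by apply: lt_le_trans N2; rewrite mulr_gt0. Qed.

Let es : rho * (sig + delta) <= 1.
Proof.
have h : 0 < rho * delta by rewrite mulr_gt0.
by move: dlE h; rewrite -mulrA mulrDr; lra.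
Qed.

Let s_gt0 : 0 < sig + delta. Proof. exact: addr_gt0. Qed.

Let sigma i := c0 / (2 * c1) * expR (- ((rho * (sig + delta) + delta) * B i)).
Let sigma0 := c0 / (4 * c1) * expR (- A).
Let rf := Num.truncn (y K / 32).
Let sigmaf := y K / (8 * N%:R).

Let ratio_le a : 1 <= a -> 0 < c0 / (a * c1) <= 1.
Proof.
move=> a1; have a0 : 0 < a by apply: lt_le_trans a1.
rewrite divr_gt0 ?mulr_gt0 //= ler_pdivrMr ?mulr_gt0 // mul1r.
by apply: le_trans c01 _; rewrite ler_peMl // ltW.
Qed.

(** The exploration uses few of the half-edges that lead to the layer i. *)
Lemma spare_half_edges i : (i <= K)%N ->
  c0 / 2 * n * expR (- (sig + delta) * B i) <= half_edges_at d (Gam i) - (5 * (2 * Z).+1)%:R.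
Proof.
move=> iK; have low := lower (x := y i).
have yi : 1 <= y i <= y K.
  by rewrite ler_expR B_mono // andbT (le_trans _ (y4 i)) // ler1n.
have {low} := low yi; rewrite /powR gt_eqF // [ln _]expRK => low.
have mono : expR (- (sig + delta) * B K) <= expR (- (sig + delta) * B i).
  by rewrite ler_expR !mulNr lerN2 ler_wpM2l ?(ltW s_gt0) // B_mono.
have h : (5 * (2 * Z).+1)%:R <= c0 / 2 * n * expR (- (sig + delta) * B i).
  by apply: le_trans Zlow _; rewrite ler_wpM2l // mulr_ge0 // divr_ge0 // ltW.
rewrite lerBrDr; apply: le_trans (lerD (lexx _) h) _; apply: le_trans low.
by apply/eq_ler; field.
Qed.

(** Two independent requirements: the degree of the partner, with the exponent
    rho (sig + delta) in terms of y_i, and the length, with the exponent delta. *)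
Lemma hit_prob_climb i : (i < K)%N -> hit_prob d L Z (Gam i.+1) (t i) (sigma i).
Proof.
move=> iK; have /andP[q0 q1] := ratio_le (ler1n _ 2); split.
- rewrite /sigma mulr_ge0 ?(ltW q0) ?expR_ge0 //=.
  apply: mulr_ile1; rewrite ?(ltW q0) ?expR_ge0 // -expR0 ler_expR oppr_le0.
  by rewrite mulr_ge0 ?(ltW (B_gt0 i)) // addr_ge0 ?(ltW dl0) // mulr_ge0 ?(ltW rho0) ?(ltW s_gt0).
- have db : 0 < delta * B i by rewrite mulr_gt0.
  have Fi : expR (- (delta * B i)) <= F (t i).
    by apply: length_law_quantile; rewrite ?expR_gt0 // -expR0 ltr_expR oppr_lt0.
  apply: le_trans (ler_pM _ (expR_ge0 _) (spare_half_edges iK) Fi); last first.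
    by rewrite mulr_ge0 ?expR_ge0 // mulr_ge0 // divr_ge0 // ltW.
  rewrite /sigma BS; have -> : - (sig + delta) * (rho * B i) = - (rho * (sig + delta) * B i) by ring.
  have -> : - ((rho * (sig + delta) + delta) * B i) = - (rho * (sig + delta) * B i) + - (delta * B i) by ring.
  rewrite expRD; move: (expR_ge0 (- (rho * (sig + delta) * B i))) (expR_ge0 (- (delta * B i))).
  move: (expR _) (expR _) => e2 e1 e10 e20.
  apply: (@le_trans _ _ (c0 / (2 * c1) * (e1 * e2) * (c1 * n))).
    by rewrite ler_wpM2l // mulr_ge0 ?(ltW q0) // mulr_ge0.
  by apply/eq_ler; field; rewrite gt_eqF.
- move=> v /= yv; have : 2 < (d v)%:R :> R.
    by apply: lt_trans yv; apply: lt_le_trans (y4 i.+1); rewrite ltr_nat.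
  by rewrite ltr_nat => h; apply: leq_trans (cm_degree_ge d v).
Qed.

Lemma hit_prob_first : hit_prob d L Z (Gam 0) t0 sigma0.
Proof.
have /andP[q0 q1] := ratio_le (ler1n _ 4); split.
- rewrite /sigma0 mulr_ge0 ?(ltW q0) ?expR_ge0 //=.
  by apply: mulr_ile1; rewrite ?(ltW q0) ?expR_ge0 // -expR0 ler_expR oppr_le0 ltW.
- apply: le_trans (ler_pM _ _ (spare_half_edges (leq0n K)) Ft0) => //; last first.
    by rewrite mulr_ge0 ?expR_ge0 // mulr_ge0 // divr_ge0 // ltW.
  have : expR (- A) <= expR (- (sig + delta) * B 0).
    rewrite ler_expR mulNr lerN2 /B expr0 mulr1.
    apply: (@le_trans _ _ ((sig + delta) * (A * rho))); first by rewrite ler_wpM2l // ltW.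
    by rewrite mulrCA [_ * rho]mulrC ler_piMr // ltW.
  rewrite /sigma0; move: (expR _) (expR _) (expR_ge0 (- A)) => e2 e1 e10 e12.
  apply: (@le_trans _ _ (c0 / (4 * c1) * e1 * (c1 * n))).
    by rewrite ler_wpM2l // mulr_ge0 // ltW.
  have -> : c0 / (4 * c1) * e1 * (c1 * n) = c0 / 2 * n / 2 * e1 by field; rewrite gt_eqF.
  have -> : c0 / 2 * n * e2 / 2 = c0 / 2 * n / 2 * e2 by ring.
  by rewrite ler_wpM2l // !mulr_ge0 ?invr_ge0 // ltW.
- move=> v /= yv; have : 2 < (d v)%:R :> R.
    by apply: lt_trans yv; apply: lt_le_trans (y4 0); rewrite ltr_nat.
  by rewrite ltr_nat => h; apply: leq_trans (cm_degree_ge d v).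
Qed.

(** There are y_i / 4 tries, each with success probability of order
    y_i^-(rho sig + rho delta + delta), and the choice of delta leaves a factor
    y_i^(2 delta), of which a half absorbs the constants. *)
Lemma climb_failure_le i : (i < K)%N -> (1 - sigma i) ^+ r i <= expR (- (delta * B i)).
Proof.
move=> iK; have [/andP[_ s1] _ _] := hit_prob_climb iK.
apply: le_trans (expr_1B_le _ s1) _; rewrite ler_expR lerN2.
apply: (@le_trans _ _ (expR (delta * B i))).
  by apply: le_trans (expR_ge1Dx _); rewrite lerDr.
have yi : 1 <= y i / 4 by rewrite ler_pdivlMr // mul1r.
have ri := truncn_ge_half yi.
have s0 : 0 <= sigma i by rewrite mulr_ge0 ?expR_ge0 // divr_ge0 ?mulr_ge0 // ltW.
apply: le_trans (ler_wpM2l s0 ri); rewrite /sigma /y.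
have -> : c0 / (2 * c1) * expR (- ((rho * (sig + delta) + delta) * B i)) * (expR (B i) / 4 / 2)
  = c0 / (16 * c1) * (expR (- ((rho * (sig + delta) + delta) * B i)) * expR (B i)).
  by field; rewrite gt_eqF.
rewrite -expRD; apply: (@le_trans _ _ (c0 / (16 * c1) * (expR (delta * A) * expR (delta * B i)))).
  rewrite mulrA ler_peMl ?expR_ge0 //.
  rewrite -(@ler_pM2l _ (16 * c1 / c0)) ?divr_gt0 ?mulr_gt0 // mulr1.
  by apply: le_trans cA _; apply/eq_ler; field; rewrite !gt_eqF.
rewrite ler_wpM2l ?divr_ge0 ?mulr_ge0 ?(ltW c00) ?(ltW c10) // -expRD ler_expR.
apply: (@le_trans _ _ (2 * delta * B i)).
  have -> : 2 * delta * B i = delta * B i + delta * B i by ring.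
  by rewrite lerD2r ler_wpM2l // ltW.
rewrite -subr_ge0.
have -> : - ((rho * (sig + delta) + delta) * B i) + B i - 2 * delta * B i =
  (1 - rho * sig - rho * delta - 3 * delta) * B i by ring.
rewrite -dlE mulr_ge0 ?(ltW (B_gt0 i)) //.
have -> : 4 * rho * delta - rho * delta - 3 * delta = 3 * delta * (rho - 1) by ring.
by rewrite !mulr_ge0 ?(ltW dl0) // subr_ge0 ltW.
Qed.

(** Joining two vertices of degree at least y_K succeeds in one try with
    probability of order y_K / n, and there are of order y_K tries. *)
Lemma small_not_climbed : small (wcm_prob G) (matched G `&` [set w | ~
    reach (wcm_matching w) (wcm_len_at w) (wcm_u w) (wcm_v w)
      (2 * (t0 *+ R0 + \sum_(0 <= i < K) t i) + t0) (2 * (R0 + K) + 1)])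
  (2 * ((1 - sigma0) ^+ R0 + eps1 *+ R0 + \sum_(0 <= i < K) expR (- (delta * B i)))
    + Z%:R / n + 512 * c1 * n / y K ^+ 2).
Proof.
have D2 v : (2 <= cm_degree d v)%N by apply: leq_trans (cm_degree_ge d v).
have yrf : rf%:R <= y K / 32 by rewrite truncn_le // divr_ge0 // ltW.
have Zrf : (8 * (Z + rf) + 4)%:R <= y K.
  rewrite mulnDr -addnA [(8 * rf + 4)%N]addnC addnA natrD.
  apply: le_trans (lerD Zy _) _; first by rewrite natrM; apply: ler_wpM2l yrf.
  have -> : y K / 2 + 8 * (y K / 32) = 3 / 4 * y K by field.
  by rewrite ler_piMl ?(ltW (y_gt0 K)) // ler_pdivrMr // mul1r ler_nat.
have n0 : (0 : R) < n by [].
have ZN4 : (4 * (Z + rf) <= N)%N.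
  rewrite -(ler_nat R); apply: le_trans N2; apply: (@le_trans _ _ n); last by rewrite ler_peMr // ler1n.
  apply: le_trans yn; apply: le_trans Zrf; rewrite ler_nat.
  by move: (Z + rf)%N => z; clear; lia.
have yN : y K / (8 * N%:R) * (8 * N%:R) = y K by rewrite divfK // gt_eqF // mulr_gt0.
have sf0 : 0 < sigmaf by rewrite divr_gt0 // mulr_gt0.
have sf1 : sigmaf <= 1.
  rewrite ler_pdivrMr ?mulr_gt0 // mul1r; apply: le_trans yn _.
  by apply: le_trans (le_trans _ N2) _; rewrite ?ler_peMr ?ler_peMl ?ler1n // ltW.
have ge_dv i v : Gam i v -> y i <= (cm_degree d v)%:R.
  by move=> /= yv; apply: le_trans (ltW yv) _; rewrite ler_nat cm_degree_ge.
have rj i v : Gam i v -> (4 * r i <= cm_degree d v)%N.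
  move=> /ge_dv yv; rewrite -(ler_nat R); apply: le_trans yv; rewrite natrM.
  by rewrite -ler_pdivlMl // mulrC truncn_le // divr_ge0 // ltW.
have := @small_not_reached _ _ _ _ _ _ _ G D2 Z Gam t sigma r K R0 t0 sigma0 eps1 _ t00
  hit_prob_first (fun i iK => hit_prob_climb iK) (fun i v _ => rj i v) _ rf t0 sigmaf ZN4 _
  _ _ (leqnn _).
have h1 : (4 * Z <= N)%N by apply: leq_trans ZN4; rewrite leq_mul2l leq_addr orbT.
have h2 : ((2 * Z).+1 * 2)%:R / N%:R + (1 - F t0) <= eps1.
  by rewrite [leRHS](splitr eps1); apply: lerD.
have h3 : 0 <= sigmaf <= 1 by rewrite (ltW sf0) sf1.
have h4 v : Gam K v -> (8 * (Z + rf) + 4 <= cm_degree d v)%N.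
  by move=> /ge_dv yv; rewrite -(ler_nat R); apply: le_trans yv.
have h5 v : Gam K v -> sigmaf * N%:R * 4 <= (cm_degree d v)%:R * F t0.
  move=> /ge_dv yv; have -> : sigmaf * N%:R * 4 = y K / 2.
    by rewrite /sigmaf; field; rewrite gt_eqF.
  by apply: ler_pM; rewrite ?invr_ge0 // ltW.
move=> /(_ h1 h2 h3 h4 h5); apply: small_le => //.
apply: lerD; first apply: lerD => //.
  rewrite ler_pM2l // /side_failure lerD2l big_nat [leRHS]big_nat.
  by apply: ler_sum => i /andP[_ iK]; exact: climb_failure_le.
apply: le_trans (expr_1B_le _ sf1) _.
have rf2 : y K / 64 <= rf%:R.
  have y1 : 1 <= y K / 32 by rewrite ler_pdivlMr // mul1r.
  by apply: le_trans (truncn_ge_half y1); apply/eq_ler; field.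
have srf : y K ^+ 2 / (512 * c1 * n) <= sigmaf * rf%:R.
  apply: (@le_trans _ _ (y K / (8 * (c1 * n)) * (y K / 64))).
    by apply/eq_ler; field; rewrite !gt_eqF.
  apply: ler_pM rf2; rewrite ?divr_ge0 ?mulr_ge0 // ?(ltW c10) ?(ltW (y_gt0 K)) //.
  by rewrite ler_pM2l // lef_pV2 ?posrE ?mulr_gt0 // ler_pM2l.
have P0 : 0 < y K ^+ 2 / (512 * c1 * n) by rewrite divr_gt0 ?exprn_gt0 ?mulr_gt0.
rewrite -[leRHS]invrK invf_div expRN lef_pV2 ?posrE ?expR_gt0 //.
by apply: le_trans srf _; apply: le_trans (expR_ge1Dx _); rewrite lerDr.
Qed.

End ClimbEstimate.

(** * The upper bound *)

Lemma geometric_bracket (R : realType) (A rho X : R) : 0 < A -> 1 < rho -> A <= X ->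
  exists K, A * rho ^+ K <= X < A * rho ^+ K.+1.
Proof.
move=> A0 rho1 AX.
have ex : exists j, X < A * rho ^+ j.
  have [j _ jP] := near_le_expn (X / A + 1) rho1; exists j.
  by rewrite mulrC -ltr_pdivrMr //; apply: lt_le_trans (jP j (leqnn j)); rewrite ltrDl.
pose K := ex_minn ex; have [] : X < A * rho ^+ K /\ forall j, X < A * rho ^+ j -> (K <= j)%N.
  by rewrite /K; case: ex_minnP.
case: K => [|K] h minK; first by move: h; rewrite expr0 mulr1 ltNge AX.
by exists K; rewrite h andbT leNgt; apply/negP => /minK; rewrite ltnn.
Qed.

(** The degrees explored are at most the power 1 / rho of the last one, since the
    last layer is left unexplored; the number of layers is logarithmic in them. *)
Lemma explored_half_edges_le (R : realType) (An rho e : R) (K R0 : nat) : 1 <= An -> 1 < rho -> 0 < e ->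
  (2 * (R0 + \sum_(0 <= i < K) Num.truncn (expR (An * rho ^+ i) / 4)) + 1)%:R
    <= (2 * R0%:R + 1 + (2 * e * (rho - 1))^-1) * expR ((rho^-1 + e) * (An * rho ^+ K)).
Proof.
move=> An1 rho1 e0; have An0 : 0 < An by apply: lt_le_trans An1.
have rho0 : 0 < rho by apply: lt_trans rho1.
have r10 : 0 < rho - 1 by rewrite subr_gt0.
pose X := An * rho ^+ K; rewrite -/X.
have X0 : 0 < X by rewrite mulr_gt0 // exprn_gt0.
have E1 : 1 <= expR ((rho^-1 + e) * X).
  by rewrite expR_gee1 // mulr_ge0 ?(ltW X0) // addr_ge0 ?(ltW e0) // invr_ge0 ltW.
have KX : K%:R <= X / (rho - 1).
  rewrite ler_pdivlMr //; apply: le_trans (_ : rho ^+ K <= _).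
    by apply: le_trans (bernoulli K (ltW rho1)); rewrite lerDr.
  by rewrite /X ler_peMl // exprn_ge0 // ltW.
have Xe : X <= expR (e * X) / e.
  by rewrite ler_pdivlMr // mulrC; apply: le_trans (expR_ge1Dx _); rewrite lerDr.
have S : (\sum_(0 <= i < K) Num.truncn (expR (An * rho ^+ i) / 4))%:R <= K%:R * (expR (X / rho) / 4).
  rewrite natr_sum; apply: (@le_trans _ _ (\sum_(0 <= i < K) expR (X / rho) / 4)).
    rewrite big_nat [leRHS]big_nat; apply: ler_sum => i /andP[_ iK].
    apply: (@le_trans _ _ (expR (An * rho ^+ i) / 4)); first by rewrite truncn_le // divr_ge0 // expR_ge0.
    rewrite ler_pM2r ?invr_gt0 // ler_expR /X ler_pdivlMr // -mulrA -exprSr.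
    by rewrite ler_wpM2l ?(ltW An0) // ler_eXn2l.
  by rewrite sumr_const_nat subn0 mulr_natl.
have S' : (\sum_(0 <= i < K) Num.truncn (expR (An * rho ^+ i) / 4))%:R <=
    (2 * e * (rho - 1))^-1 / 2 * expR ((rho^-1 + e) * X).
  apply: le_trans S _.
  apply: (@le_trans _ _ (expR (e * X) / e / (rho - 1) * (expR (X / rho) / 4))).
    rewrite ler_wpM2r ?divr_ge0 ?expR_ge0 //; apply: le_trans KX _.
    by rewrite ler_wpM2r // invr_ge0 ltW.
  rewrite [(_ + e) * X]mulrDl expRD [rho^-1 * X]mulrC; apply/eq_ler.
  by field; rewrite !gt_eqF.
move: S'; move: (\sum_(0 <= i < K) _)%N => W S'.
have -> : (2 * (R0 + W) + 1)%:R = 2 * R0%:R + 1 + 2 * W%:R :> R by rewrite natrD natrM natrD; ring.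
rewrite [leRHS]mulrDl; apply: lerD.
  by rewrite ler_peMr // addr_ge0 // mulr_ge0.
have -> : (2 * e * (rho - 1))^-1 * expR ((rho^-1 + e) * X) =
  2 * ((2 * e * (rho - 1))^-1 / 2 * expR ((rho^-1 + e) * X)) by field; rewrite !gt_eqF.
by rewrite ler_pM2l.
Qed.

Lemma rho_exponent_lt1 (R : realType) (a b : R) : 4 * b = 1 - a -> 0 < b -> a + b < 1.
Proof. by lra. Qed.

Lemma length_budget (R : realType) (eps i a S x y z : R) : i <= eps / 2 -> 0 <= a ->
  S <= (1 + i) * a + y -> 2 * x + z + 2 * y <= eps * a -> 2 * (x + S) + z <= (1 + eps) * (2 * a).
Proof.
move=> ie a0 Sa C; have : i * a <= eps / 2 * a by rewrite ler_wpM2r.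
by move: Sa C; rewrite mulrDl mul1r; lra.
Qed.

(** Rounding: the layer i of the climb lies beyond the layer i - i / (k + 1) of
    the sum, up to one. *)
Lemma skip_index_le (R : realType) (k i : nat) :
  (i - i %/ k.+1)%:R <= 1 + k%:R / k.+1%:R * i%:R :> R.
Proof.
have k0 : 0 < k.+1%:R :> R by [].
rewrite -(ler_pM2r k0) mulrDl mul1r mulrAC divfK ?gt_eqF // -!natrM -natrD ler_nat.
have := ltn_ceil i (ltn0Sn k); rewrite mulnBl leq_subLR mulSn.
by move: (i %/ k.+1 * k.+1)%N => a; rewrite mulnS mulnC; lia.
Qed.

Section UpperBound.
Context {R : realType}.
Variables (tau : R) (d : forall m, 'I_m.+1 -> nat) (alpha kappa : R) (FB : R -> R).
Arguments d : clear implicits.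
Hypotheses (tau23 : 2 < tau < 3) (d2 : forall m v, (2 <= d m v)%N) (kappa0 : 0 < kappa)
  (alpha2 : 2^-1 < alpha)
  (tvB : forall m, (dTV (biased_cdf (d m)) FB <= (m.+1%:R `^ (- kappa))%:E)%E)
  (tail : forall delta : R, 0 < delta -> exists2 C1 : R, 1 <= C1 &
     forall m x, 1 <= x < m.+1%:R `^ alpha ->
       m.+1%:R * C1^-1 * x `^ (- (tau - 1 + delta)) <= count_above (d m) x
         <= m.+1%:R * C1 * x `^ (- (tau - 1 - delta))).
Context {dO : measure_display} {Omega : measurableType dO}
  {Q : probability Omega R} (L : {RV Q >-> R}) (G : forall m : nat, weighted_cm (d m) L).
Hypotheses (L_ge0 : {ae Q, forall w, 0 <= L w})
  (explosion_free :
  (\sum_(1 <= k <oo) (generalised_inverse (cdf L) (expR (- expR k%:R)))%:E = +oo)%E).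

Let q := (tau - 2)^-1.
Let q1 : 1 < q := q_gt1 tau23.
Let sig := tau - 2.

(** The climb grows at the rate rho = q^(k / (k + 1)), so that each block of k
    layers in the sum a_n corresponds to k + 1 layers of the climb. It ends at
    degree n^beta; the starting scale lies between A and A rho, adjusted to n. *)
Lemma near_small_no_typical_path (eps eta : R) : 0 < eps -> 0 < eta ->
  \forall m \near \oo, small (wcm_prob (G m)) (matched (G m) `&` [set w | ~ exists p,
     [/\ wcm_is_path w p,
         wcm_path_length w p <= (1 + eps) * (2 * typical_dist tau (cdf L) m.+1) &
         (size p)%:R <= (1 + eps) * typical_hops tau m.+1]]) eta.
Proof.
move=> eps0 eta0.
have /andP[s0 s1] := sig01 tau23; rewrite -/sig in s0 s1.
have q0 : 0 < q by exact: lt_trans q1.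
have sq : sig * q = 1 by rewrite /q -/sig divff // gt_eqF.
pose k := (Num.truncn (2 / eps)).+1.
have k0 : (0 < k)%N by [].
have kR : 0 < k%:R :> R by rewrite ltr0n.
have kRV : 0 < k%:R^-1 :> R by rewrite invr_gt0.
have keps : k%:R^-1 <= eps / 2.
  rewrite -[leRHS]invrK lef_pV2 ?posrE ?invr_gt0 ?divr_gt0 // invf_div.
  exact/ltW/truncnS_gt.
pose theta : R := k%:R / k.+1%:R.
have theta0 : 0 < theta by rewrite divr_gt0.
have theta1 : theta < 1 by rewrite ltr_pdivrMr // mul1r ltr_nat.
pose rho := q `^ theta.
have rho1 : 1 < rho by apply: powR_gt1.
have rho0 : 0 < rho by apply: lt_trans rho1.
have srho : rho * sig < 1.
  rewrite mulrC -sq ltr_pM2l // /rho -[ltRHS]powRr1 ?(ltW q0) //.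
  by rewrite /powR gt_eqF // ltr_expR ltr_pM2r // ln_q_gt0.
pose delta := (1 - rho * sig) / (4 * rho).
have dl0 : 0 < delta by rewrite divr_gt0 ?mulr_gt0 // subr_gt0.
have dlE : 4 * rho * delta = 1 - rho * sig by rewrite /delta; field; rewrite gt_eqF.
have sd0 : 0 < sig + delta by rewrite addr_gt0.
have sd1 : sig + delta < 1.
  have h : 0 < rho * delta by rewrite mulr_gt0.
  have : rho * (sig + delta) < 1.
    rewrite [_ * (_ + _)]mulrDr; move: dlE; rewrite -[4 * rho * delta]mulrA => dlE.
    exact: rho_exponent_lt1 dlE h.
  by apply: le_lt_trans; rewrite ler_peMl // ltW.
have [c0 c0_gt0 lower] := half_edges_lower tail dl0.
have [c1' c1_gt0 Nlin] := card_half_edge_linear d2 kappa0 tvB.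
pose c1 := c1' + c0.
have c10 : 0 < c1 by rewrite addr_gt0.
pose s := rho^-1 + (sig + delta).
have s_gt0 : 0 < s by rewrite addr_gt0 // invr_gt0.
have s2 : s < 2 by rewrite /s -[2]/(1 + 1) ltrD // invf_lt1.
(* beta slightly above 1/2 makes the last layer meet the other side, while the
   layers below it use only a small part of the half-edges *)
have [beta [b1 b2 b3 b4]] : exists beta : R, [/\ 2^-1 < beta, beta < alpha, beta < 1 & beta * s < 1].
  pose M := Num.min (Num.min alpha 1) s^-1.
  have M2 : 2^-1 < M.
    rewrite !lt_min alpha2 /= invf_lt1 // ltf_pV2 ?posrE // s2 andbT.
    by rewrite ltr1n.
  have [bM Mb] := midf_lt M2; exists ((2^-1 + M) / 2).
  have : (2^-1 + M) / 2 < M by [].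
  by rewrite {2}/M !lt_min => /andP[/andP[h1 h2] h3]; split; rewrite // -ltr_pdivlMr // div1r.
have beta0 : 0 < beta by apply: lt_trans b1.
(* n^z bounds the number of half-edges explored *)
have [z [z1 z2 z3]] : exists z, [/\ beta / rho < z, z < beta & z < 1 - beta * (sig + delta)].
  pose M := Num.min beta (1 - beta * (sig + delta)).
  have M2 : beta / rho < M.
    rewrite lt_min ltr_pdivrMr // ltr_pMr // rho1 /= ltrBrDr -mulrDr //.
  have [bM Mb] := midf_lt M2; exists ((beta / rho + M) / 2); move: Mb.
  by rewrite {1}/M lt_min => /andP[].
pose h := (z - beta / rho) / 2.
have h0 : 0 < h by rewrite divr_gt0 // subr_gt0.
(* the scale A at which the climb starts *)
have [A [A3 cA qA hA eA]] : exists A : R, [/\ 3 <= A, 16 * c1 / c0 <= expR (delta * A),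
    q ^+ 2 <= delta * A, expR (- (delta * A * (rho - 1))) <= 2^-1 &
    2 * expR (- (delta * A)) <= eta / 8].
  have r10 : 0 < rho - 1 by rewrite subr_gt0.
  have e1 := near_le_nat (3 : R).
  have e2 := near_le_nat (ln (16 * c1 / c0) / delta).
  have e3 := near_le_nat (q ^+ 2 / delta).
  have e4 := near_le_nat (ln 2 / (delta * (rho - 1))).
  have e5 := near_le_nat (ln (16 / eta) / delta).
  have [j0 _ jP] := filterI e1 (filterI e2 (filterI e3 (filterI e4 e5))).
  exists j0.+1%:R; have [h1 [h2 [h3 [h4 h5]]]] := jP j0 (leqnn _).
  split=> //.
  - by rewrite -[leLHS]lnK ?posrE ?divr_gt0 ?mulr_gt0 // ler_expR [leRHS]mulrC -ler_pdivrMr.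
  - by rewrite [leRHS]mulrC -ler_pdivrMr.
  - rewrite expRN lef_pV2 ?posrE ?expR_gt0 // -[leLHS]lnK ?posrE // ler_expR.
    by rewrite mulrAC [leRHS]mulrC -ler_pdivrMr // mulr_gt0.
  - rewrite expRN -ler_pdivlMl // -[leRHS]invrK lef_pV2 ?posrE ?expR_gt0 ?invr_gt0 ?mulr_gt0 ?divr_gt0 //.
    have -> : (2^-1 * (eta / 8))^-1 = 16 / eta by field; rewrite gt_eqF.
    by rewrite -[leLHS]lnK ?posrE ?divr_gt0 // ler_expR [leRHS]mulrC -ler_pdivrMr.
have A0 : 0 < A by apply: lt_le_trans A3.
pose sigma0 := c0 / (4 * c1) * expR (- A).
have sg0 : 0 < sigma0 by rewrite mulr_gt0 ?expR_gt0 // divr_gt0 // mulr_gt0.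
have sg1 : sigma0 <= 1.
  rewrite mulr_ile1 ?expR_ge0 ?divr_ge0 ?mulr_ge0 ?(ltW c0_gt0) ?(ltW c10) //.
    rewrite ler_pdivrMr ?mulr_gt0 // mul1r.
    apply: (@le_trans _ _ c1); first by rewrite lerDr ltW.
    by rewrite ler_peMl ?ler1n // ltW.
  by rewrite -expR0 ler_expR oppr_le0 ltW.
pose R0 := (Num.truncn (ln (16 / eta) / sigma0)).+1.
have R0P : (1 - sigma0) ^+ R0 <= eta / 16.
  apply: le_trans (expr_1B_le _ sg1) _.
  rewrite expRN -[leRHS]invrK lef_pV2 ?posrE ?expR_gt0 ?invr_gt0 ?divr_gt0 // invf_div.
  rewrite -[leLHS]lnK ?posrE ?divr_gt0 // ler_expR [leRHS]mulrC -ler_pdivrMr //.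
  exact/ltW/truncnS_gt.
pose eps1 := eta / 16 / R0%:R.
have eps10 : 0 < eps1 by rewrite !divr_gt0.
have R0e : eps1 *+ R0 = eta / 16 by rewrite -mulr_natr divfK // pnatr_eq0.
have [t0 [t00 Ft0 Ft0']] : exists t0 : R, [/\ 0 <= t0, 2^-1 <= length_law L (short t0) &
    1 - length_law L (short t0) <= eps1 / 2].
  pose u := Num.min 2^-1 (eps1 / 2).
  have u0 : 0 < u by rewrite lt_min invr_gt0 ltr0n divr_gt0.
  have [u1 u2] : u <= 2^-1 /\ u <= eps1 / 2 by apply/andP; rewrite -le_min.
  have uu : 0 < 1 - u by rewrite subr_gt0; apply: le_lt_trans u1 _; rewrite invf_lt1 ?ltr1n.
  have u3 : 1 - u < 1 by rewrite ltrBlDr ltrDl.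
  have lq := length_law_quantile L_ge0 uu u3.
  exists (generalised_inverse (cdf L) (1 - u)); split; first exact: quantile_ge0.
    by apply: le_trans lq; rewrite lerBrDr [leRHS](splitr 1) div1r lerD2l.
  by rewrite lerBlDr -lerBlDl; apply: le_trans lq; rewrite lerD2l lerN2.
pose f j := quantile L (q ^+ j).
pose Cl : R := 2 * (t0 *+ R0) + t0 + 2 * (k.+1%:R * f 1%N).
pose C2 := 2 * R0%:R + 1 + (2 * (h / beta) * (rho - 1))^-1.
have n2 := near_le_powR C2 h0.
have n3 : \forall m \near \oo, 20 / c0 <= m.+1%:R `^ (1 - beta * (sig + delta) - z).
  by apply: near_le_powR; rewrite subr_gt0.
have n4 : \forall m \near \oo, 16 <= m.+1%:R `^ (beta - z).
  by apply: near_le_powR; rewrite subr_gt0.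
have n5 := near_le_powR 32 beta0.
have n6 : \forall m \near \oo, m.+1%:R `^ (- (1 - z)) <= Num.min (eps1 / 4) (eta / 4).
  by apply: near_powRN_le; rewrite ?subr_gt0 ?(lt_trans z2) // lt_min !divr_gt0.
have n7 : \forall m \near \oo, m.+1%:R `^ (- (2 * beta - 1)) <= eta / 4 / (512 * c1).
  apply: near_powRN_le; last by rewrite !divr_gt0 ?mulr_gt0 ?ltr0n.
  by rewrite subr_gt0 -ltr_pdivrMl // mulr1.
have n8 := near_le_ln (A / beta).
have n9 := near_le_loglog ((2 * R0 + 1)%:R / eps) q1.
have n10 := near_le_typical_dist tau23 L_ge0 explosion_free (Cl / eps).
near=> m.
have m1 : #|half_edge (d m)|%:R <= c1' * m.+1%:R by near: m.
have m2 : C2 <= m.+1%:R `^ h by near: m.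
have m3 : 20 / c0 <= m.+1%:R `^ (1 - beta * (sig + delta) - z) by near: m.
have m4 : 16 <= m.+1%:R `^ (beta - z) by near: m.
have m5 : 32 <= m.+1%:R `^ beta by near: m.
have m6 : m.+1%:R `^ (- (1 - z)) <= Num.min (eps1 / 4) (eta / 4) by near: m.
have m7 : m.+1%:R `^ (- (2 * beta - 1)) <= eta / 4 / (512 * c1) by near: m.
have m8 : A / beta <= ln m.+1%:R by near: m.
have m9 : (2 * R0 + 1)%:R / eps <= loglog tau m.+1%:R by near: m.
have m10 : Cl / eps <= typical_dist tau (cdf L) m.+1 by near: m.
have n_gt0 : 0 < m.+1%:R :> R by [].
have nP u v : m.+1%:R `^ (u + v) = m.+1%:R `^ u * m.+1%:R `^ v :> R.
  by apply: powRD; apply/implyP => _; rewrite pnatr_eq0.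
have ln0 : 0 < ln m.+1%:R :> R by apply: lt_le_trans m8; rewrite divr_gt0.
have AX : A <= beta * ln m.+1%:R by rewrite mulrC -ler_pdivrMr.
have [K /andP[K1 K2]] := geometric_bracket A0 rho1 AX.
pose An := beta * ln m.+1%:R / rho ^+ K.
have rK : 0 < rho ^+ K by rewrite exprn_gt0.
have AnK : An * rho ^+ K = beta * ln m.+1%:R by rewrite divfK // gt_eqF.
have AAn : A <= An by rewrite ler_pdivlMr.
have AnA : An <= A * rho by rewrite ler_pdivrMr // -mulrA -exprS ltW.
have yK u : expR (u * (An * rho ^+ K)) = m.+1%:R `^ (u * beta).
  by rewrite AnK /powR gt_eqF // mulrA.
have yK1 : expR (An * rho ^+ K) = m.+1%:R `^ beta by rewrite -[X in expR X]mul1r yK mul1r.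
pose Z := (2 * (R0 + \sum_(0 <= i < K) Num.truncn (expR (An * rho ^+ i) / 4)))%N.
have An1 : 1 <= An by apply: le_trans AAn; apply: le_trans A3; rewrite ler1n.
have Zz : (Z + 1)%:R <= m.+1%:R `^ z :> R.
  have hb : 0 < h / beta by rewrite divr_gt0.
  apply: le_trans (explored_half_edges_le K R0 An1 rho1 hb) _; rewrite yK -/C2.
  have -> : z = h + (rho^-1 + h / beta) * beta by rewrite /h; field; rewrite !gt_eqF.
  by rewrite nP ler_wpM2r // powR_ge0.
have Zlow : (5 * (2 * Z).+1)%:R <=
    c0 / 2 * m.+1%:R * expR (- (sig + delta) * (An * rho ^+ K)).
  rewrite yK -mulrA -[X in X * _ `^ _]powRr1 // -nP.
  have -> : 1 + - (sig + delta) * beta = (1 - beta * (sig + delta) - z) + z by ring.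
  apply: (@le_trans _ _ (10 * m.+1%:R `^ z)).
    apply: (@le_trans _ _ (10 * (Z + 1)%:R)); last by rewrite ler_pM2l.
    by rewrite -natrM ler_nat; move: (Z); clear; lia.
  rewrite nP mulrA ler_wpM2r ?powR_ge0 // -ler_pdivrMl ?divr_gt0 //.
  by apply: le_trans m3; apply/eq_ler; field; rewrite gt_eqF.
have Zy : (8 * Z + 4)%:R <= expR (An * rho ^+ K) / 2.
  rewrite yK1; apply: (@le_trans _ _ (8 * m.+1%:R `^ z)).
    apply: (@le_trans _ _ (8 * (Z + 1)%:R)); last by rewrite ler_pM2l.
    by rewrite -natrM ler_nat; move: (Z); clear; lia.
  have -> : m.+1%:R `^ beta = m.+1%:R `^ (beta - z) * m.+1%:R `^ z by rewrite -nP subrK.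
  rewrite mulrAC ler_wpM2r ?powR_ge0 // ler_pdivlMr //; apply: le_trans m4.
  by rewrite -natrM.
have zn : m.+1%:R `^ z / m.+1%:R = m.+1%:R `^ (- (1 - z)).
  by rewrite -{2}[m.+1%:R]powRr1 // -powRN -nP opprB.
have [m6a m6b] : m.+1%:R `^ (- (1 - z)) <= eps1 / 4 /\ m.+1%:R `^ (- (1 - z)) <= eta / 4.
  by apply/andP; rewrite -le_min.
have N2 := @card_half_edge_ge R _ _ (d2 (m := m)).
have N0 : 0 < #|half_edge (d m)|%:R :> R by apply: lt_le_trans N2; rewrite mulr_gt0.
have ZN : ((2 * Z).+1 * 2)%:R / #|half_edge (d m)|%:R <= eps1 / 2.
  apply: (@le_trans _ _ (4 * m.+1%:R `^ z / (m.+1%:R * 2))).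
    apply: ler_pM; rewrite ?invr_ge0 //.
      apply: (@le_trans _ _ (4 * (Z + 1)%:R)); last by rewrite ler_pM2l.
      by rewrite -natrM ler_nat; move: (Z); clear; lia.
    by rewrite lef_pV2 ?posrE ?mulr_gt0.
  have -> : 4 * m.+1%:R `^ z / (m.+1%:R * 2) = 2 * (m.+1%:R `^ z / m.+1%:R).
    have : m.+1%:R != 0 :> R by rewrite pnatr_eq0.
    by move: (m.+1%:R : R) => x x0; field.
  rewrite zn; apply: le_trans (ler_wpM2l _ m6a) _ => //.
  by apply/eq_ler; field.
have Zn : Z%:R / m.+1%:R <= eta / 4.
  apply: le_trans m6b; rewrite -zn ler_wpM2r ?invr_ge0 //; apply: le_trans Zz.
  by rewrite ler_nat leq_addr.
have Nn : #|half_edge (d m)|%:R <= c1 * m.+1%:R.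
  by apply: le_trans m1 _; rewrite ler_wpM2r // lerDl ltW.
have n1 : 1 < m.+1%:R :> R by rewrite -ltr_ln ?posrE // ln1.
have lowerK (x : R) : 1 <= x <= expR (An * rho ^+ K) ->
    c0 * m.+1%:R * x `^ (- (sig + delta)) <= half_edges_at (d m) [pred v | x < (d m v)%:R].
  move=> /andP[x1 xy]; apply: lower; rewrite x1 /=; apply: le_lt_trans xy _.
  by rewrite yK1 /powR gt_eqF // ltr_expR ltr_pM2r.
have y32 : 32 <= expR (An * rho ^+ K) by rewrite yK1.
have yn : expR (An * rho ^+ K) <= m.+1%:R.
  by rewrite yK1 -[leRHS]powRr1 // ler_powR ?(ltW n1) ?(ltW b3).
have c01 : c0 <= c1 by rewrite lerDr ltW.
have sc := small_not_climbed (G m) L_ge0 rho1 s0 dl0 dlE A3 AAn AnA c0_gt0 c01 (d2 (m := m)) Nn cA lowerK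
  Zlow Zy y32 yn t00 Ft0 Ft0' ZN.
have := smallU sc (small_negative_length (G m) (length_law_neg L_ge0)).
apply: small_le; last first.
  have An0 : 0 < An by apply: lt_le_trans An1.
  have dA : expR (- (delta * An * (rho - 1))) <= 2^-1.
    apply: le_trans hA; rewrite ler_expR lerN2 ler_wpM2r ?subr_ge0 ?(ltW rho1) //.
    by rewrite ler_wpM2l // ltW.
  have sE : \sum_(0 <= i < K) expR (- (delta * (An * rho ^+ i))) <= eta / 8.
    apply: le_trans eA; under eq_bigr do rewrite mulrA.
    apply: le_trans (sum_expR_double K (mulr_gt0 dl0 An0) (ltW rho1) dA) _.
    by rewrite ler_pM2l // ler_expR lerN2 ler_wpM2l // ltW.
  have nE : 512 * c1 * m.+1%:R / expR (An * rho ^+ K) ^+ 2 <= eta / 4.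
    have -> : 512 * c1 * m.+1%:R / expR (An * rho ^+ K) ^+ 2 =
        m.+1%:R `^ (- (2 * beta - 1)) * (512 * c1).
      rewrite -expRM_natl yK -[X in 512 * c1 * X]powRr1 // -mulrA -powRN -nP mulrC.
      by congr (_ `^ _ * _); ring.
    by rewrite -ler_pdivlMr ?mulr_gt0 ?ltr0n.
  rewrite addr0 R0e.
  apply: le_trans (lerD (lerD (ler_wpM2l _ (lerD (lerD R0P (lexx _)) sE)) Zn) nE) _ => //.
  by apply/eq_ler; move: (eta) => e; field.
move=> w [Mw far]; apply: contrapT => none; apply: far.
have pos h' : 0 <= wcm_len_at w (edge_of (wcm_matching w) h').
  by rewrite leNgt; apply/negP => lneg; apply: none; right; split=> //; exists h'.
have : reach (wcm_matching w) (wcm_len_at w) (wcm_u w) (wcm_v w)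
      (2 * (t0 *+ R0 + \sum_(0 <= i < K) quantile L (delta * (An * rho ^+ i))) + t0) (2 * (R0 + K) + 1).
  by apply: contrapT => nr; apply: none; left.
move=> /(reach_path pos) [p [pp lp sp]]; exists p.
have rK_le : rho ^+ K <= ln m.+1%:R.
  apply: (@le_trans _ _ (beta * ln m.+1%:R)); last by rewrite ler_piMl ?(ltW ln0) ?(ltW b3).
  rewrite -AnK ler_peMl // ltW //.
have tK : K%:R * theta <= loglog tau m.+1%:R.
  have : q `^ (theta * K%:R) <= q `^ loglog tau m.+1%:R.
    by rewrite powRrM powR_mulrn ?(ltW rho0) // /loglog powR_loglog.
  by rewrite /powR gt_eqF // ler_expR ler_pM2r ?ln_q_gt0 // mulrC.
have kk1 : 1 + k%:R^-1 = theta^-1 :> R.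
  by rewrite /theta invf_div -natr1 mulrDl divff ?gt_eqF // mul1r.
have ll0 : 0 <= loglog tau m.+1%:R by apply: le_trans m9; rewrite divr_ge0 // ltW.
split=> //.
  apply: le_trans lp _.
  have lenS : \sum_(0 <= i < K) quantile L (delta * (An * rho ^+ i)) <=
      (1 + k%:R^-1) * typical_dist tau (cdf L) m.+1 + k.+1%:R * f 1%N.
    pose g j := f j.+1.
    apply: (@le_trans _ _ (\sum_(0 <= i < K) g (i - i %/ k.+1)%N)).
      apply: ler_sum => i _; rewrite /g /f; apply: quantile_decr => //.
        by rewrite exprn_gt0.
      rewrite mulrA; apply: (@le_trans _ _ (q ^+ 2 * rho ^+ i)); last first.
        rewrite ler_wpM2r ?exprn_ge0 ?(ltW rho0) //; apply: le_trans qA _.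
        by rewrite ler_wpM2l // ltW.
      rewrite -!powR_mulrn ?(ltW q0) ?(ltW rho0) // -powRrM -powRD; last first.
        by apply/implyP => _; rewrite gt_eqF.
      apply: (ler_powR (ltW q1)); rewrite -[(_ - _).+1%:R]natr1.
      have -> : 2 + theta * i%:R = 1 + theta * i%:R + 1 by ring.
      by rewrite lerD2r; exact: skip_index_le.
    have gd i j : (i <= j)%N -> g j <= g i by move=> ij; apply: quantile_q_decr.
    have g0 i : 0 <= g i by apply: quantile_q_ge0.
    apply: le_trans (sum_repeat_le gd g0 K k0) _; rewrite lerD2r ler_wpM2l //.
    rewrite typical_distE // big_add1 /=.
    have Jkk : (K %/ k.+1 * k <= Num.truncn (loglog tau m.+1%:R))%N.
      rewrite truncn_ge_nat //; apply: le_trans tK.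
      have : (K %/ k.+1 * k.+1)%:R * theta <= K%:R * theta.
        by rewrite ler_wpM2r ?(ltW theta0) // ler_nat leq_trunc_div.
      by apply: le_trans; rewrite /theta !natrM mulrA mulrAC -!mulrA ler_wpM2l // mulVKf ?pnatr_eq0.
    rewrite [leRHS](@big_cat_nat _ _ _ (K %/ k.+1 * k)) //= lerDl.
    by apply: sumr_ge0 => i _; exact: g0.
  apply: length_budget keps _ lenS _.
    by rewrite typical_distE //; apply: sumr_ge0 => i _; exact: quantile_q_ge0.
  by rewrite -ler_pdivrMl // mulrC.
rewrite typical_hopsE //.
apply: (@le_trans _ _ (2 * (R0 + K) + 1)%:R); first by rewrite ler_nat.
have Kle : K%:R <= (1 + k%:R^-1) * loglog tau m.+1%:R by rewrite kk1 ler_pdivlMl // mulrC.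
have -> : (2 * (R0 + K) + 1)%:R = 2 * (R0%:R + K%:R) + 1 :> R by rewrite natrD natrM natrD.
apply: (length_budget keps ll0 (y := 0)); first by rewrite addr0.
have <- : (2 * R0 + 1)%:R = 2 * R0%:R + 1 + 2 * 0 :> R by rewrite mulr0 addr0 natrD natrM.
by rewrite -ler_pdivrMl // mulrC.
Unshelve. all: by end_near.
Qed.

End UpperBound.

(** * Measurability of the distances *)

Section CountableOperations.
Context {R : realType} {dT : measure_display} {T : measurableType dT} {I : countType}.

(** An infimum is at least x when all the countably many terms are. *)
Lemma measurable_fun_inf_over (A : I -> set T) (f : I -> T -> \bar R) :
  (forall i, measurable (A i)) -> (forall i, measurable_fun setT (f i)) ->
  measurable_fun setT (fun w => ereal_inf [set f i w | i in [set i | A i w]]).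
Proof.
move=> mA mf mT; apply: (measurability _ (ErealGenCInfty.measurableE R)) => //.
move=> _ [_ [x ->] <-].
have -> : setT `&` (fun w => ereal_inf [set f i w | i in [set i | A i w]]) @^-1` `[x%:E, +oo[ =
    [set w | forall i, (~` A i `|` [set w | x%:E <= f i w]%E) w].
  apply/seteqP; split=> w /=.
    rewrite in_itv /= andbT => -[_ xi] i; have [Ai|nAi] := pselect (A i w); last by left.
    by right; apply: le_trans xi _; apply: ereal_inf_lbound; exists i.
  move=> H; split=> //; rewrite in_itv /= andbT; apply: le_ereal_inf_tmp => _ [i Ai <-].
  by case: (H i).
apply: measurable_forall_count => i; apply: measurableU; first exact: measurableC.
rewrite -[X in measurable X]setTI; apply: measurable_lee => //; exact: measurable_cst.
Qed.

End CountableOperations.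

Section MeasurableDistances.
Context {R : realType} {m : nat} {d : 'I_m.+1 -> nat} {dO : measure_display}
  {Omega : measurableType dO} {Q : probability Omega R} {X : {RV Q >-> R}}
  (G : weighted_cm d X).
Local Notation H := (half_edge d).

(** The matching and the two vertices take finitely many values. *)
Lemma measurable_by_graph (P : {ffun H -> H} -> 'I_m.+1 -> 'I_m.+1 -> set (wcm_space G)) :
  (forall M a b, measurable (P M a b)) ->
  measurable [set w | P (wcm_matching w) (wcm_u w) (wcm_v w) w].
Proof.
move=> mP; have -> : [set w | P (wcm_matching w) (wcm_u w) (wcm_v w) w] =
    [set w | exists M, exists a, exists b,
      ([set w | wcm_matching w = M] `&` [set w | wcm_u w = a] `&` [set w | wcm_v w = b]
        `&` P M a b) w].
  apply/seteqP; split=> [w /= Pw|w /= [M [a [b [[[<- <-] <-]]]]]] //.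
  by exists (wcm_matching w), (wcm_u w), (wcm_v w).
apply: measurable_exists_count => M; apply: measurable_exists_count => a.
apply: measurable_exists_count => b; apply: measurableI => //; apply: measurableI.
  by apply: measurableI; [exact: wcm_measurable_matching|exact: wcm_measurable_u].
exact: wcm_measurable_v.
Qed.

Lemma measurable_is_path (p : seq H) : measurable [set w : wcm_space G | wcm_is_path w p].
Proof.
apply: (@measurable_by_graph (fun M a b => [set w | is_path M a b p])) => M a b.
have [pP|pP] := boolP (is_path M a b p).
  by rewrite (_ : [set w | _] = setT) //; apply/seteqP; split.
by rewrite (_ : [set w | _] = set0) //; apply/seteqP; split.
Qed.

Lemma measurable_path_length (p : seq H) :
  measurable_fun setT (fun w : wcm_space G => wcm_path_length w p).
Proof.
move=> mT B mB; rewrite setTI.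
apply: (@measurable_by_graph (fun M a b => [set w | B (path_length M (wcm_len_at w) p)])) => M a b.
have mf : measurable_fun setT (fun w : wcm_space G => \sum_(h <- p) wcm_len G (edge_of M h) w).
  by apply: measurable_sum => h; exact: measurable_funPT.
by have := mf mT B mB; rewrite setTI.
Qed.

Lemma measurable_dist_L : measurable_fun setT (fun w : wcm_space G => wcm_dist_L w).
Proof.
apply: (measurable_fun_inf_over (A := fun p w => wcm_is_path w p)
   (f := fun p w => (wcm_path_length w p)%:E)) => p; first exact: measurable_is_path.
by apply/measurable_EFinP; exact: measurable_path_length.
Qed.

Lemma measurable_dist_H : measurable_fun setT (fun w : wcm_space G => wcm_dist_H w).
Proof.
apply: (measurable_fun_inf_over
   (A := fun p w => wcm_is_path w p /\ (wcm_path_length w p)%:E = wcm_dist_L w)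
   (f := fun p w => (size p)%:R%:E)) => p; last exact: measurable_cst.
apply: measurableI; first exact: measurable_is_path.
rewrite -[X in measurable X]setTI; apply: measurable_eqe => //; last exact: measurable_dist_L.
by apply/measurable_EFinP; exact: measurable_path_length.
Qed.

Lemma measurable_dist_L_deviation (eps c : R) : measurable
  [set w : wcm_space G | (eps%:E < `|wcm_dist_L w * c%:E - 1|)%E].
Proof.
rewrite -[X in measurable X]setTI.
apply: (measurable_lte _ (f := cst eps%:E) (g := fun w => `|wcm_dist_L w * c%:E - 1|%E)) => //.
apply: measurableT_comp => //; apply: emeasurable_funB => //.
by apply: emeasurable_funM => //; exact: measurable_dist_L.
Qed.

Lemma measurable_dist_H_ge (x c : R) :
  measurable [set w : wcm_space G | (x%:E <= wcm_dist_H w * c%:E)%E].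
Proof.
rewrite -[X in measurable X]setTI.
apply: (measurable_lee _ (f := cst x%:E) (g := fun w => (wcm_dist_H w * c%:E)%E)) => //.
by apply: emeasurable_funM => //; exact: measurable_dist_H.
Qed.

Lemma measurable_exists_path (x y : R) : measurable [set w : wcm_space G |
  exists p, [/\ wcm_is_path w p, wcm_path_length w p <= x & (size p)%:R <= y]].
Proof.
apply: measurable_exists_count => p.
rewrite (_ : (fun _ => _) = [set w | wcm_is_path w p] `&` [set w | (wcm_path_length w p)%:E <= x%:E]%E
     `&` [set w | (size p)%:R <= y]); last first.
  by apply/seteqP; split=> w /=; rewrite lee_fin; [case|case=> -[]].
apply: measurableI; first apply: measurableI; first exact: measurable_is_path.
  rewrite -[X in measurable X]setTI.
  apply: (measurable_lee _ (f := fun w => (wcm_path_length w p)%:E) (g := cst x%:E)) => //.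
  by apply/measurable_EFinP; exact: measurable_path_length.
have [h|h] := boolP ((size p)%:R <= y).
  by rewrite (_ : [set w | _] = setT) //; apply/seteqP; split.
by rewrite (_ : [set w | _] = set0) //; apply/seteqP; split.
Qed.

Lemma dist_H_ge (x c : R) (w : wcm_space G) : 0 < c ->
  (forall p, wcm_is_path w p -> x <= (size p)%:R * c) -> (x%:E <= wcm_dist_H w * c%:E)%E.
Proof.
move=> c0 H; rewrite -lee_pdivrMr //; apply: le_ereal_inf_tmp => _ [p [pp _] <-].
by rewrite lee_pdivrMr // -EFinM lee_fin; exact: H.
Qed.

Lemma dist_L_deviation_le (eps a : R) (w : wcm_space G) : 0 < a ->
  (forall p, wcm_is_path w p -> (1 - eps) * a <= wcm_path_length w p) ->
  (exists2 p, wcm_is_path w p & wcm_path_length w p <= (1 + eps) * a) ->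
  (`|wcm_dist_L w * (a^-1)%:E - 1| <= eps%:E)%E.
Proof.
move=> a0 lo [p0 pp0 hi].
have l : (((1 - eps) * a)%:E <= wcm_dist_L w)%E.
  by apply: le_ereal_inf_tmp => _ [p pp <-]; rewrite lee_fin; exact: lo.
have u : (wcm_dist_L w <= ((1 + eps) * a)%:E)%E.
  apply: (@le_trans _ _ (wcm_path_length w p0)%:E); last by rewrite lee_fin.
  by apply: ereal_inf_lbound; exists p0.
case: (wcm_dist_L w) l u => [r| |] //=; rewrite !lee_fin => l u.
rewrite ler_norml lerBrDr lerBlDr.
by rewrite ler_pdivlMr // ler_pdivrMr // [- eps + 1]addrC [eps + 1]addrC l u.
Qed.

End MeasurableDistances.

(** * Convergence in probability *)

Section SmallLimits.
Context {R : realType} (dT : nat -> measure_display) (T : forall m, measurableType (dT m))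
  (mu : forall m, probability (T m) R) (S : forall m, set (T m)).
Arguments S : clear implicits.
Hypothesis mS : forall m, measurable (S m).

Lemma cvg_small0 : (forall eta : R, 0 < eta -> \forall m \near \oo, small (mu m) (S m) eta) ->
  (fun m => mu m (S m)) @ \oo --> (0 : \bar R)%E.
Proof.
move=> sm; apply/fine_cvgP; split; first by apply: nearW => m; exact: fin_num_measure.
apply/cvgrPdist_le => eta eta0; apply: filterS (sm _ eta0) => m [B [mB SB Be]] /=.
rewrite sub0r normrN ger0_norm ?fine_ge0 // -lee_fin fineK ?fin_num_measure //.
by apply: le_trans Be; apply: le_measure; rewrite ?inE.
Qed.

End SmallLimits.

Lemma cvg_small1 (R : realType) (dT : nat -> measure_display) (T : forall m, measurableType (dT m))
  (mu : forall m, probability (T m) R) (S : forall m, set (T m)) :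
  (forall m, measurable (S m)) ->
  (forall eta : R, 0 < eta -> \forall m \near \oo, small (mu m) (~` S m) eta) ->
  (fun m => mu m (S m)) @ \oo --> (1 : \bar R)%E.
Proof.
move=> mS sm; have mSC m : measurable (~` S m) by exact: measurableC.
have /fine_cvgP [_ c0] := cvg_small0 mSC sm.
apply/fine_cvgP; split; first by apply: nearW => m; exact: fin_num_measure.
have -> : fine \o (fun m => mu m (S m)) = (fun m => 1 - (fine \o (fun m => mu m (~` S m))) m).
  apply/funext => m /=; rewrite probability_setC //.
  rewrite -[in RHS](fineK (fin_num_measure (mu m) _ (mS m))) /=.
  by rewrite subKr.
by rewrite -[X in _ --> X]subr0; apply: cvgB => //; exact: cvg_cst.
Qed.

Theorem theorem2p4 (R : realType) (tau : R) (d : forall m : nat, 'I_m.+1 -> nat)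
  (dO : measure_display) (Omega : measurableType dO) (Q : probability Omega R)
  (L : {RV Q >-> R}) (G : forall m : nat, weighted_cm (d m) L)
  (tau_range : 2 < tau < 3)
  (tail : power_law_tail tau d)
  (min_degree : forall (m : nat) (v : 'I_m.+1), (2 <= d m v)%N)
  (limits : @limiting_distributions R d)
  (L_ge0 : {ae Q, forall w, 0 <= L w})
  (explosion_free :
    (\sum_(1 <= k <oo)
      (generalised_inverse (cdf L) (expR (- expR k%:R)))%:E = +oo)%E) :
  [/\ (forall eps : R, 0 < eps ->
        (fun m => wcm_prob (G m)
           [set w | (eps%:E <
              `|wcm_dist_L w * ((2 * typical_dist tau (cdf L) m.+1)^-1)%:E
                - 1|)%E])
          @ \oo --> (0 : \bar R)%E),
      (forall eps : R, 0 < eps ->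
        (fun m => wcm_prob (G m)
           [set w | ((1 - eps)%:E <=
              wcm_dist_H w * ((typical_hops tau m.+1)^-1)%:E)%E])
          @ \oo --> (1 : \bar R)%E) &
      (forall eps : R, 0 < eps ->
        (fun m => wcm_prob (G m)
           [set w | exists p : seq (half_edge (d m)),
              [/\ wcm_is_path w p,
                  wcm_path_length w p
                    <= (1 + eps) * (2 * typical_dist tau (cdf L) m.+1) &
                  (size p)%:R <= (1 + eps) * typical_hops tau m.+1]])
          @ \oo --> (1 : \bar R)%E)].
Proof.
have [FD [FB [kappa kappa0 tv]]] := limits.
have tvB m : (dTV (biased_cdf (d m)) FB <= (m.+1%:R `^ (- kappa))%:E)%E.
  by apply: le_trans (tv m); rewrite le_max lexx orbT.
have [alpha alpha2 tailP] := power_law_tail_powers tail.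
(* one likely event gives the three claims *)
have typical eps eta : 0 < eps -> 0 < eta -> \forall m \near \oo,
    small (wcm_prob (G m)) (~` [set w | (forall p, wcm_is_path w p ->
        (1 - eps) * typical_hops tau m.+1 <= (size p)%:R /\
        (1 - eps) * (2 * typical_dist tau (cdf L) m.+1) <= wcm_path_length w p) /\
      exists p, [/\ wcm_is_path w p,
        wcm_path_length w p <= (1 + eps) * (2 * typical_dist tau (cdf L) m.+1) &
        (size p)%:R <= (1 + eps) * typical_hops tau m.+1]]) eta.
  move=> eps0 eta0; have eta2 : 0 < eta / 2 by rewrite divr_gt0.
  have lo := near_small_close_path tau_range min_degree kappa0 alpha2 tvB tailP G L_ge0
    explosion_free eps0 eta2.
  have up := near_small_no_typical_path tau_range min_degree kappa0 alpha2 tvB tailP G L_ge0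
    explosion_free eps0 eta2.
  apply: filterS2 lo up => m lo up.
  have := smallU (small_not_matching (G m)) (smallU lo up); apply: small_le; last by rewrite add0r -splitr.
  move=> w bad; have [Mw|Mw] := boolP (wcm_matching w \in perfect_matchings (d m)); last by left.
  right; have [far|near] := pselect (forall p, wcm_is_path w p ->
        (1 - eps) * typical_hops tau m.+1 <= (size p)%:R /\
        (1 - eps) * (2 * typical_dist tau (cdf L) m.+1) <= wcm_path_length w p); last by left.
  by right; split=> // ex; apply: bad.
split=> eps eps0.
- apply: cvg_small0 => [m|eta eta0]; first exact: measurable_dist_L_deviation.
  have pos := near_le_typical_dist tau_range L_ge0 explosion_free 1.
  have typ := typical _ _ eps0 eta0.
  apply: filterS2 pos typ => m pos; apply: small_le => // w /= dev [far [p [pp lp _]]].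
  have a0 : 0 < 2 * typical_dist tau (cdf L) m.+1 by rewrite mulr_gt0 // (lt_le_trans _ pos).
  move: dev; rewrite ltNge => /negP; apply; apply: dist_L_deviation_le => //.
    by move=> p' pp'; have [] := far p' pp'.
  by exists p.
- apply: cvg_small1 => [m|eta eta0]; first exact: measurable_dist_H_ge.
  have pos := near_le_loglog 1 (q_gt1 tau_range).
  have typ := typical _ _ eps0 eta0.
  apply: filterS2 pos typ => m pos; apply: small_le => // w /= short [far _].
  have h0 : 0 < typical_hops tau m.+1.
    by rewrite typical_hopsE // mulr_gt0 // (lt_le_trans _ pos).
  apply: short; apply: dist_H_ge; first by rewrite invr_gt0.
  by move=> p pp; rewrite ler_pdivlMr //; have [] := far p pp.
- apply: cvg_small1 => [m|eta eta0]; first exact: measurable_exists_path.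
  have typ := typical _ _ eps0 eta0.
  by apply: filterS typ => m; apply: small_le => // w /= none [_ ex]; apply: none.
Qed.
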